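(* Let $N\ge 1$, let $\alpha_1,\dots,\alpha_N>0$ and $\beta_1,\dots,\beta_N>0$, and let $G_1,\dots,G_N$ be independent random variables with $G_i\sim\mathcal G_{\alpha_i,\beta_i}$. Set $\mathsf G_N:=\sum_{i=1}^N G_i$. Let $\alpha,\beta>0$ be determined by $$\alpha\beta=\sum_{i=1}^N\alpha_i\beta_i,\qquad \alpha\beta^2=\sum_{i=1}^N\alpha_i\beta_i^2,$$ and let $U_N\sim\mathcal G_{\alpha,\beta}$. Set $$A_N:=\max_{1\le i\le N}\left\{\left|\frac{\beta_i}{\beta}-1\right|\beta_i\right\},\qquad B_N:=\max_{1\le i\le N}\left\{\left|\frac{\beta_i}{\beta}-1\right|\beta_i^2\right\}.$$ Then $$d_1(\mathsf G_N,U_N)\le 2A_N,\qquad d_2(\mathsf G_N,U_N)\le 2B_N+\alpha\beta\, e_\alpha A_N.$$ Moreover, if $\alpha>1$, then $$d_{\mathrm{Kol}}(\mathsf G_N,U_N)\le 2\left(\frac{A_N}{\beta\sqrt{2\pi(\alpha-1)}\,r_\alpha}\right)^{1/2},\qquad r_\alpha=\exp\left(\frac{1}{12\alpha-11}\right).$$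
   Context: For $a,b>0$, $\mathcal G_{a,b}$ denotes the Gamma distribution with shape $a$ and scale $b$, i.e. with density $p_{a,b}(x)=\frac{1}{\Gamma(a)b^a}x^{a-1}e^{-x/b}\mathbf 1_{\{x>0\}}$. Distances. $\mathcal Z_1$ is the class of continuously differentiable $h:(0,\infty)\to\mathbb R$ with $\|h'\|_\infty\le1$; $\mathcal Z_2$ is the class of twice continuously differentiable $h:(0,\infty)\to\mathbb R$ with $\|h''\|_\infty\le1$ (supremum norms on $(0,\infty)$). For positive random variables $X,Y$ with finite moments of order $j\in\{1,2\}$, $d_j(X,Y):=\sup_{h\in\mathcal Z_j}|\mathbb E[h(X)]-\mathbb E[h(Y)]|$. Also $d_{\mathrm{Kol}}(X,Y):=\sup_{z\in\mathbb R}|\mathbb P[X\le z]-\mathbb P[Y\le z]|$. The constant $e_a$, $a>0$. Write $P_{a,1}(x)=\int_0^xp_{a,1}(u)\,du$, $\overline P_{a,1}(x)=\int_x^\infty p_{a,1}(u)\,du$, $\underline{\mathrm P}^1_{a,1}(x)=\int_0^xP_{a,1}(u)\,du$, $\overline{\mathrm P}^1_{a,1}(x)=\int_x^\infty\overline P_{a,1}(u)\,du$, $\underline M_{a,1}(y)=\frac{P_{a,1}(y)}{y\,p_{a,1}(y)}$, $\overline M_{a,1}(y)=\frac{\overline P_{a,1}(y)}{y\,p_{a,1}(y)}$ for $x,y>0$, and $$C_{a,1}^2(z)=\overline M_{a,1}''(z)\int_0^z\underline{\mathrm P}^1_{a,1}(x)\,dx+\underline M_{a,1}''(z)\int_z^\infty\overline{\mathrm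 P}^1_{a,1}(x)\,dx,\qquad z>0.$$ Then $e_a:=\sup_{z>0}C_{a,1}^2(z)$, which is finite. *)

(* Defs.v *)
From HB Require Import structures.
From mathcomp Require Import all_boot all_order all_algebra.
From mathcomp Require Import all_classical all_reals all_analysis.
Set Implicit Arguments.
Unset Strict Implicit.
Unset Printing Implicit Defensive.

Import Order.TTheory GRing.Theory Num.Theory.
Import numFieldNormedType.Exports.

Local Open Scope classical_set_scope.
Local Open Scope ring_scope.

Definition Gamma (R : realType) (a : R) : R :=
  \int[lebesgue_measure]_(x in `]0, +oo[) (x `^ (a - 1) * expR (- x)).

Definition gamma_pdf (R : realType) (a b x : R) : R :=
  (Gamma a * b `^ a)^-1 * x `^ (a - 1) * expR (- x / b) * \1_(`]0, +oo[) x.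

Definition gamma_prob (R : realType) (a b : R) (V : set R) : \bar R :=
  (\int[lebesgue_measure]_(x in V) (gamma_pdf a b x)%:E)%E.

Definition has_gamma_law (R : realType) (d : measure_display)
    (T : measurableType d) (P : probability T R) (X : {RV P >-> R})
    (a b : R) : Prop :=
  forall V : set R, measurable V -> distribution P X V = gamma_prob a b V.
Arguments has_gamma_law {R d T} P X a b.

Definition mutually_independent (R : realType) (d : measure_display)
    (T : measurableType d) (P : probability T R) (I : finType)
    (X : I -> {RV P >-> R}) : Prop :=
  forall (J : {set I}) (B : I -> set R), (forall i, measurable (B i)) ->
    (P (\bigcap_(i in [set` J]) (X i @^-1` B i)) =
     \prod_(i in J) P (X i @^-1` B i))%E.
Arguments mutually_independent {R d T} P {I} X.

Definition sup_norm_pos (R : realType) (f : R -> R) : \bar R :=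
  ereal_sup [set `|f x|%:E | x in `]0, +oo[].

(* Functions on (0, +oo) are represented by total functions [R -> R], whose
   values on ]-oo, 0] play no role. *)
Definition Z1 (R : realType) : set (R -> R) :=
  [set h : R -> R | [/\ forall x : R, 0 < x -> derivable h x 1,
               forall x : R, 0 < x -> {for x, continuous h^`()%classic} &
               (sup_norm_pos h^`()%classic <= 1)%E]].

Definition Z2 (R : realType) : set (R -> R) :=
  [set h : R -> R | [/\ forall x : R, 0 < x -> derivable h x 1,
               forall x : R, 0 < x -> derivable h^`()%classic x 1,
               forall x : R, 0 < x -> {for x, continuous h^`(2)%classic} &
               (sup_norm_pos h^`(2)%classic <= 1)%E]].

(* E[h(X)] for a test function [h] on (0, +oo).  A Gamma variable is positive
   only almost surely; the integrand is set to 0 on the null event where [X] is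
   not positive. *)
Definition expect_test (R : realType) (d : measure_display)
    (T : measurableType d) (P : probability T R) (X : {RV P >-> R})
    (h : R -> R) : \bar R :=
  ('E_P[fun w => if (0 < X w)%R then h (X w) else 0%R])%E.
Arguments expect_test {R d T} P X h.

Definition dist_test (R : realType) (H : set (R -> R))
    (d1 d2 : measure_display)
    (T1 : measurableType d1) (P1 : probability T1 R) (X : {RV P1 >-> R})
    (T2 : measurableType d2) (P2 : probability T2 R) (Y : {RV P2 >-> R})
    : \bar R :=
  ereal_sup [set `| expect_test P1 X h - expect_test P2 Y h |%E | h in H].
Arguments dist_test {R} H {d1 d2 T1} P1 X {T2} P2 Y.

Definition dist1 (R : realType) (d1 d2 : measure_display)
    (T1 : measurableType d1) (P1 : probability T1 R) (X : {RV P1 >-> R})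
    (T2 : measurableType d2) (P2 : probability T2 R) (Y : {RV P2 >-> R})
    : \bar R := dist_test (@Z1 R) P1 X P2 Y.
Arguments dist1 {R d1 d2 T1} P1 X {T2} P2 Y.

Definition dist2 (R : realType) (d1 d2 : measure_display)
    (T1 : measurableType d1) (P1 : probability T1 R) (X : {RV P1 >-> R})
    (T2 : measurableType d2) (P2 : probability T2 R) (Y : {RV P2 >-> R})
    : \bar R := dist_test (@Z2 R) P1 X P2 Y.
Arguments dist2 {R d1 d2 T1} P1 X {T2} P2 Y.

Definition dist_Kol (R : realType) (d1 d2 : measure_display)
    (T1 : measurableType d1) (P1 : probability T1 R) (X : {RV P1 >-> R})
    (T2 : measurableType d2) (P2 : probability T2 R) (Y : {RV P2 >-> R})
    : \bar R :=
  ereal_sup [set `| cdf (P := P1) X z - cdf (P := P2) Y z |%E | z in [set: R]].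
Arguments dist_Kol {R d1 d2 T1} P1 X {T2} P2 Y.

Definition gP (R : realType) (a x : R) : R :=
  \int[lebesgue_measure]_(u in `[0, x]) gamma_pdf a 1 u.

Definition gPbar (R : realType) (a x : R) : R :=
  \int[lebesgue_measure]_(u in `[x, +oo[) gamma_pdf a 1 u.

Definition gP1 (R : realType) (a x : R) : R :=
  \int[lebesgue_measure]_(u in `[0, x]) gP a u.

Definition gP1bar (R : realType) (a x : R) : R :=
  \int[lebesgue_measure]_(u in `[x, +oo[) gPbar a u.

Definition gM (R : realType) (a y : R) : R :=
  gP a y / (y * gamma_pdf a 1 y).

Definition gMbar (R : realType) (a y : R) : R :=
  gPbar a y / (y * gamma_pdf a 1 y).

Definition gC2 (R : realType) (a z : R) : R :=
  (gMbar a)^`(2)%classic z * (\int[lebesgue_measure]_(x in `[0, z]) gP1 a x) +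
  (gM a)^`(2)%classic z * (\int[lebesgue_measure]_(x in `[z, +oo[) gP1bar a x).

(* The set is bounded for [a > 0], so this [sup] in R is the genuine one. *)
Definition e_const (R : realType) (a : R) : R :=
  sup [set gC2 a z | z in `]0, +oo[].

(* All terms are nonnegative, so starting the maximum from 0 is harmless. *)
Definition A_max (R : realType) (N : nat) (bs : 'I_N -> R) (b : R) : R :=
  \big[Num.max/0]_(i < N) (`|bs i / b - 1| * bs i).

Definition B_max (R : realType) (N : nat) (bs : 'I_N -> R) (b : R) : R :=
  \big[Num.max/0]_(i < N) (`|bs i / b - 1| * bs i ^+ 2).

(* Main.v *)
(* Stein's method for the Gamma law.  For a test function h the equation
     beta x f'(x) + (alpha beta - x) f(x) = h(x) - E[h(U)]
   has an explicit solution f, and the Stein identity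
     E[(G_i - alpha_i beta_i) g(GN)] = beta_i E[G_i g'(GN)]
   (integration by parts in G_i, the other variables being fixed), used for
   g = f and then for g = f', turns E[h(GN)] - E[h(U)] into
     sum_i (beta - beta_i) beta_i E[G_i f''(GN)];
   matching the two moments kills the first order term.  For h in Z_1 one has
   |x f''(x)| <= 2 / beta, which bounds d_1.  For h in Z_2 one more Stein
   identity for g = f'' together with |f''| <= e_alpha / beta and
   |x f'''(x)| <= 2 / beta bounds d_2.

   The derivatives of the solution at unit scale are combinations of the first
   and second iterated remainders of h whose coefficients are the derivatives of
   the kernels P/(x p) and (1 - P)/(x p); these coefficients have constant sign,
   so that the extremal case is read off from Wronskian identities.

   The Kolmogorov bound follows from the d_1 bound by smoothing an indicator
   with a C^1 ramp of width eps, the density of U being at most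
   rho = 1 / (beta sqrt(2 pi (alpha - 1)) r_alpha):
     eps |F_GN - F_U| <= 2 A + rho eps^2 / 2   for every eps > 0.
   The bound on the density is its value at the mode (alpha - 1) beta combined
   with Robbins' lower bound on Gamma(alpha), proved here at real arguments by
   comparing consecutive Stirling ratios and Laplace's method at infinity. *)

Require Import Defs.
From HB Require Import structures.
From mathcomp Require Import all_boot all_order all_algebra.
From mathcomp Require Import all_classical all_reals all_analysis.
From mathcomp Require Import measurable_realfun.
From mathcomp Require Import ring lra.
Import Order.TTheory GRing.Theory Num.Theory.
Import numFieldNormedType.Exports.
Local Open Scope classical_set_scope.
Local Open Scope ring_scope.

Set Implicit Arguments.
Unset Strict Implicit.

(** * Derivatives and improper integrals *)

Section Derivatives.
Context {R : realType}.
Implicit Types (f g : R -> R) (x a b : R).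

(** A density of shape below 1 is unbounded at 0, so every boundary condition is a limit at 0+ or at
    +oo and every derivative is taken on (0, +oo) only. A remainder is bounded by comparing its
    derivative with that of an explicit function which has the same limit at one end; this avoids
    estimating integrals of the test function.

    Two kinds of bounds on the solution occur. The sharp ones, on [f''], [x f''] and [x f'''], enter
    the constants of the theorem and are read off at the extremal remainders. The growth bounds,
    with unspecified constants, only make expectations finite; linear growth of [f] and [f'] is what
    the second moments of Gamma variables can pay for.

    The summands interact with the test function only through the total sum, so the Stein identity
    has to be proved for one variable with the sum of the others frozen at a value [y >= 0], and
    independence is needed in the form: one summand against the sum of the rest.

    The shape of the definitions also matters: a divergent real integral has value 0, so neither
    convergence nor positivity of [Gamma alpha] is available for free. *)

Lemma is_deriv_eq f x a b : is_derive x 1 f a -> a = b -> is_derive x 1 f b.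
Proof. by move=> df <-. Qed.

Lemma is_deriv_cst (c x : R) : is_derive x 1 (fun=> c : R) 0.
Proof. exact: is_derive_cst. Qed.

Lemma is_deriv_id (x : R) : is_derive x 1 (fun y => y : R) 1.
Proof. exact: is_derive_id. Qed.

Lemma is_deriv_add f g x a b : is_derive x 1 f a -> is_derive x 1 g b ->
  is_derive x 1 (fun y => f y + g y) (a + b).
Proof. by move=> df dg; exact: (is_deriveD df dg). Qed.

Lemma is_deriv_opp f x a : is_derive x 1 f a -> is_derive x 1 (fun y => - f y) (- a).
Proof. by move=> df; exact: (is_deriveN df). Qed.

Lemma is_deriv_sub f g x a b : is_derive x 1 f a -> is_derive x 1 g b ->
  is_derive x 1 (fun y => f y - g y) (a - b).
Proof. by move=> df dg; exact: (is_deriveB df dg). Qed.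

Lemma is_deriv_mul f g x a b : is_derive x 1 f a -> is_derive x 1 g b ->
  is_derive x 1 (fun y => f y * g y) (a * g x + f x * b).
Proof.
move=> df dg; apply: is_deriv_eq (is_deriveM df dg) _.
by rewrite /GRing.scale/= addrC [g x * _]mulrC.
Qed.

Lemma is_deriv_div f g x a b : g x != 0 ->
  is_derive x 1 f a -> is_derive x 1 g b ->
  is_derive x 1 (fun y => f y / g y) (a / g x - f x * b / g x ^+ 2).
Proof.
move=> gx df dg; have dV := is_deriveV gx dg.
apply: is_deriv_eq (is_deriv_mul df dV) _; rewrite /GRing.scale/=.
by field.
Qed.

Lemma is_deriv_comp f g x a b : is_derive (g x) 1 f a -> is_derive x 1 g b ->
  is_derive x 1 (fun y => f (g y)) (a * b).
Proof. by move=> df dg; exact: (is_derive1_comp df dg). Qed.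

Lemma is_deriv_exp f x a : is_derive x 1 f a ->
  is_derive x 1 (fun y => expR (f y)) (expR (f x) * a).
Proof. by move=> df; apply: is_deriv_comp => //; exact: is_derive_expR. Qed.

Lemma is_deriv_ln f x a : 0 < f x -> is_derive x 1 f a ->
  is_derive x 1 (fun y => ln (f y)) ((f x)^-1 * a).
Proof. by move=> fx df; apply: is_deriv_comp => //; exact: is_derive1_ln. Qed.

Lemma is_deriv_near f g x a : (\near x, f x = g x) -> is_derive x 1 f a ->
  is_derive x 1 g a.
Proof. exact: near_eq_is_derive. Qed.

Lemma is_deriv_pos f g x a : 0 < x -> (forall y, 0 < y -> f y = g y) ->
  is_derive x 1 f a -> is_derive x 1 g a.
Proof.
move=> x0 fg; apply: is_deriv_near; near=> y; apply: fg.
by near: y; exact: lt_nbhsr.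
Unshelve. all: by end_near. Qed.

Lemma is_deriv_derivable f x a : is_derive x 1 f a -> derivable f x 1.
Proof. by case. Qed.

Lemma is_deriv_val f x a : is_derive x 1 f a -> f^`()%classic x = a.
Proof. by move=> df; rewrite derive1E; exact: derive_val. Qed.

Lemma is_deriv_continuous f x a : is_derive x 1 f a -> {for x, continuous f}.
Proof.
by move=> /is_deriv_derivable /derivable1_diffP /differentiable_continuous.
Qed.

Lemma continuous_within f (A : set R) : (forall x, A x -> {for x, continuous f}) ->
  {within A, continuous f}.
Proof.
move=> cf; apply/subspace_continuousP => x /cf; apply: cvg_trans.
exact/cvg_app/cvg_within.
Qed.

Lemma within_of_deriv (A : set R) f (df : R -> R) :
  (forall x, A x -> is_derive x 1 f (df x)) -> {within A, continuous f}.
Proof.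
by move=> d; apply: continuous_within => x /d; exact: is_deriv_continuous.
Qed.

Lemma mvt f (df : R -> R) a b : a <= b ->
  (forall x, a <= x <= b -> is_derive x 1 f (df x)) ->
  exists2 c, a <= c <= b & f b - f a = df c * (b - a).
Proof.
move=> ab d; have [||c cab ->] := @MVT_segment R f df a b ab.
- by move=> x; rewrite in_itv/= => /andP[ax xb]; apply: d; rewrite !ltW.
- by apply: (@within_of_deriv _ _ df) => x; rewrite /= in_itv/=; exact: d.
by exists c => //; move: cab; rewrite in_itv.
Qed.

Lemma nondecr_of_deriv f (df : R -> R) a b : a <= b ->
  (forall x, a <= x <= b -> is_derive x 1 f (df x)) ->
  (forall x, a <= x <= b -> 0 <= df x) -> f a <= f b.
Proof.
move=> ab d d0; have [c cab E] := mvt ab d.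
by rewrite -subr_ge0 E mulr_ge0 ?subr_ge0// d0.
Qed.

Lemma nonincr_of_deriv f (df : R -> R) a b : a <= b ->
  (forall x, a <= x <= b -> is_derive x 1 f (df x)) ->
  (forall x, a <= x <= b -> df x <= 0) -> f b <= f a.
Proof.
move=> ab d d0; have [c cab E] := mvt ab d.
by rewrite -subr_le0 E mulr_le0_ge0 ?subr_ge0// d0.
Qed.

Lemma lipschitz_of_deriv f (df : R -> R) (K a b : R) :
  (forall x : R, 0 < x -> is_derive x 1 f (df x)) ->
  (forall x, 0 < x -> `|df x| <= K) ->
  0 < a -> 0 < b -> `|f a - f b| <= K * `|a - b|.
Proof.
move=> d dK; wlog ab : a b / a <= b.
  move=> W a0 b0; case: (leP a b) => [|/ltW] ab; first exact: W.
  by rewrite distrC [`|a - b|]distrC; exact: W.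
move=> a0 b0; have [|c /andP[ac _] E] := @mvt f df a b ab.
  by move=> x /andP[ax _]; apply: d; exact: lt_le_trans ax.
rewrite distrC E normrM [`|a - b|]distrC ler_wpM2r// dK//.
exact: lt_le_trans ac.
Qed.

Lemma ge0_at_of_incr_cvg0 f (df : R -> R) b : 0 < b ->
  (forall x : R, 0 < x -> x <= b -> is_derive x 1 f (df x)) ->
  (forall x, 0 < x -> x <= b -> 0 <= df x) ->
  f x @[x --> 0^'+] --> 0 -> 0 <= f b.
Proof.
move=> b0 d d0 f0; apply: (cvgr_to_le f0); near=> y.
have y0 : 0 < y by near: y; exact: nbhs_right_gt.
apply: (@nondecr_of_deriv _ df).
- by near: y; exact: nbhs_right_le.
- by move=> z /andP[yz zb]; apply: d => //; exact: lt_le_trans yz.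
- by move=> z /andP[yz zb]; apply: d0 => //; exact: lt_le_trans yz.
Unshelve. all: by end_near. Qed.

Lemma ge0_of_incr_cvg0 f (df : R -> R) x :
  (forall x : R, 0 < x -> is_derive x 1 f (df x)) ->
  (forall x, 0 < x -> 0 <= df x) ->
  f x @[x --> 0^'+] --> 0 -> 0 < x -> 0 <= f x.
Proof.
move=> d d0 f0 x0; apply: (ge0_at_of_incr_cvg0 (df := df) x0 _ _ f0).
  by move=> y y0 _; exact: d.
by move=> y y0 _; exact: d0.
Qed.

Lemma ge0_of_decr_cvgy (m : R) f (df : R -> R) x :
  (forall x : R, m < x -> is_derive x 1 f (df x)) ->
  (forall x, m < x -> df x <= 0) ->
  f x @[x --> +oo] --> 0 -> m < x -> 0 <= f x.
Proof.
move=> d d0 f0 x0; apply: (cvgr_to_le f0); near=> y.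
apply: (@nonincr_of_deriv _ df).
- by near: y; apply: nbhs_pinfty_ge; exact: num_real.
- by move=> z /andP[yz _]; apply: d; exact: lt_le_trans yz.
- by move=> z /andP[yz _]; apply: d0; exact: lt_le_trans yz.
Unshelve. all: by end_near. Qed.

(** Both [g - f] and [g + f] are nondecreasing and vanish at 0+. With its mirror image at +oo, this
    is the tool by which the remainders of the Stein solution are bounded. *)
Lemma abs_le_of_deriv_cvg0 f g (df dg : R -> R) x :
  (forall x : R, 0 < x -> is_derive x 1 f (df x)) ->
  (forall x : R, 0 < x -> is_derive x 1 g (dg x)) ->
  (forall x, 0 < x -> `|df x| <= dg x) ->
  f x @[x --> 0^'+] --> 0 -> g x @[x --> 0^'+] --> 0 ->
  0 < x -> `|f x| <= g x.
Proof.
move=> Df Dg le f0 g0 x0; rewrite ler_norml; apply/andP; split.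
  rewrite -subr_ge0 opprK.
  apply: (@ge0_of_incr_cvg0 (fun x => f x + g x) (fun x => df x + dg x)) => //.
  - by move=> z z0; apply: is_deriv_add; [exact: Df|exact: Dg].
  - by move=> z /le; rewrite ler_norml -subr_ge0 opprK => /andP[].
  - by rewrite -[X in _ --> X]addr0; exact: cvgD.
rewrite -subr_ge0.
apply: (@ge0_of_incr_cvg0 (fun x => g x - f x) (fun x => dg x - df x)) => //.
- by move=> z z0; apply: is_deriv_sub; [exact: Dg|exact: Df].
- by move=> z /le; rewrite ler_norml subr_ge0 => /andP[].
- by rewrite -[X in _ --> X]subr0; exact: cvgB.
Qed.

Lemma abs_le_of_deriv_cvgy (m : R) f g (df dg : R -> R) x :
  (forall x : R, m < x -> is_derive x 1 f (df x)) ->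
  (forall x : R, m < x -> is_derive x 1 g (- dg x)) ->
  (forall x, m < x -> `|df x| <= dg x) ->
  f x @[x --> +oo] --> 0 -> g x @[x --> +oo] --> 0 ->
  m < x -> `|f x| <= g x.
Proof.
move=> Df Dg le f0 g0 x0; rewrite ler_norml; apply/andP; split.
  rewrite -subr_ge0 opprK.
  apply: (@ge0_of_decr_cvgy m (fun x => f x + g x) (fun x => df x - dg x)) => //.
  - by move=> z z0; apply: is_deriv_add; [exact: Df|exact: Dg].
  - by move=> z /le; rewrite ler_norml subr_le0 => /andP[].
  - by rewrite -[X in _ --> X]addr0; exact: cvgD.
rewrite -subr_ge0.
apply: (@ge0_of_decr_cvgy m (fun x => g x - f x) (fun x => - dg x - df x)) => //.
- by move=> z z0; apply: is_deriv_sub; [exact: Dg|exact: Df].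
- by move=> z /le; rewrite ler_norml subr_le0 lerNl => /andP[]; rewrite lerNl.
- by rewrite -[X in _ --> X]subr0; exact: cvgB.
Qed.

Lemma cvg0_le {T : Type} (F : set_system T) {FF : Filter F} (f g : T -> R) (K : R) :
  (\near F, `|f F| <= K * g F) -> g @ F --> 0 -> f @ F --> 0.
Proof.
move=> fg g0; apply/norm_cvg0P.
have H : \forall x \near F, (cst 0 x : R) <= `|f x| <= K * g x.
  by apply: filterS fg => x ->; rewrite /= normr_ge0.
have K0 : K * g x @[x --> F] --> 0.
  by rewrite -(mulr0 K); apply: cvgM => //; exact: cvg_cst.
exact: (squeeze_cvgr H (cvg_cst _) K0).
Qed.

Lemma cvg_mull {T : Type} {F : set_system T} {FF : Filter F} (c l : R) (f : T -> R) :
  f x @[x --> F] --> l -> c * f x @[x --> F] --> c * l.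
Proof. by move=> fl; apply: cvgM => //; exact: cvg_cst. Qed.

Lemma cvg_to_eq {T : Type} {F : set_system T} {FF : Filter F} (f : T -> R) (l m : R) :
  f x @[x --> F] --> l -> l = m -> f x @[x --> F] --> m.
Proof. by move=> fl <-. Qed.

Lemma cvg_add {T : Type} {F : set_system T} {FF : Filter F} (f g : T -> R) (l m : R) :
  f x @[x --> F] --> l -> g x @[x --> F] --> m ->
  (f x + g x) @[x --> F] --> l + m.
Proof. exact: cvgD. Qed.

Lemma cvg_sub {T : Type} {F : set_system T} {FF : Filter F} (f g : T -> R) (l m : R) :
  f x @[x --> F] --> l -> g x @[x --> F] --> m ->
  (f x - g x) @[x --> F] --> l - m.
Proof. exact: cvgB. Qed.

Lemma cvg_invy : x^-1 @[x --> +oo] --> (0 : R).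
Proof.
apply/(@gtr0_cvgV0 _ _ _ _ (fun x : R => x)); last exact: cvg_id.
by near=> x; near: x; apply: nbhs_pinfty_gt; exact: num_real.
Unshelve. all: by end_near. Qed.

End Derivatives.
Arguments cvg_mull {R T F FF} c {l f}.

(** * The fundamental theorem of calculus on the open half-line *)

Section ImproperFTC.
Context {R : realType}.
Notation mu := (@lebesgue_measure R).
Implicit Types (f F : R -> R).

Lemma measurable_pos f : (forall x : R, 0 < x -> {for x, continuous f}) ->
  measurable_fun (`]0, +oo[%classic : set R) f.
Proof.
move=> cf; apply: open_continuous_measurable_fun => //.
by move=> x; rewrite inE/= in_itv/= andbT; exact: cf.
Qed.

(** An exhaustion by compact intervals that stay away from 0, where the integrand may blow up. The
    shift by two keeps the endpoints distinct already for [n = 0]. *)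
Let E (n : nat) : set R := `[n.+2%:R^-1, n.+2%:R].

Let E_sub n : E n `<=` (`]0, +oo[%classic : set R).
Proof.
move=> x; rewrite /E /= !in_itv/= andbT => /andP[+ _].
by apply: lt_le_trans; rewrite invr_gt0.
Qed.

Let E_nondecr : nondecreasing_seq E.
Proof.
move=> m n mn; apply/subsetPset => x; rewrite /E /= !in_itv/= => /andP[a b].
apply/andP; split; last by rewrite (le_trans b)// ler_nat !ltnS.
by apply: le_trans a; rewrite lef_pV2 ?posrE// ler_nat !ltnS.
Qed.

Let E_inf (x : R) : 0 < x -> \forall n \near \oo, E n x.
Proof.
move=> x0; near=> n; rewrite /E /= in_itv/=; apply/andP; split.
  rewrite invf_ple ?posrE//.
  by apply: (@le_trans _ _ n%:R); [near: n; exact: nbhs_infty_ger|rewrite ler_nat -addn2 leq_addr].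
by apply: (@le_trans _ _ n%:R); [near: n; exact: nbhs_infty_ger|rewrite ler_nat -addn2 leq_addr].
Unshelve. all: by end_near. Qed.

Let E_cup : \bigcup_n E n = (`]0, +oo[%classic : set R).
Proof.
apply/seteqP; split; first by move=> x [n _ /E_sub].
move=> x; rewrite /= in_itv/= andbT => /E_inf [n _ En].
by exists n => //; exact: En (leqnn n).
Qed.

Let integral_E f F n : (forall x : R, 0 < x -> {for x, continuous f}) ->
  (forall x : R, 0 < x -> is_derive x 1 F (f x)) ->
  (\int[mu]_(x in E n) (f x)%:E = (F n.+2%:R - F n.+2%:R^-1)%:E)%E.
Proof.
move=> cf dF; have n0 : 0 < n.+2%:R^-1 :> R by rewrite invr_gt0.
rewrite (@continuous_FTC2 _ f F) ?EFinB//.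
- rewrite (@lt_trans _ _ 1) ?invf_lt1// ltr1n//.
- by apply: continuous_within => x /=; rewrite in_itv/= => /andP[? _]; apply: cf; apply: lt_le_trans n0 _.
- split.
  + move=> x; rewrite in_itv/= => /andP[? _]; apply: is_deriv_derivable (dF _ _).
    exact: lt_trans ltac:(eassumption).
  + exact/cvg_at_right_filter/(is_deriv_continuous (dF _ _)).
  + by apply/cvg_at_left_filter/(is_deriv_continuous (dF _ _)).
- move=> x; rewrite in_itv/= => /andP[? _]; apply: is_deriv_val (dF _ _).
  exact: lt_trans ltac:(eassumption).
Qed.

Let F_cvg F (l0 l1 : R) : F x @[x --> 0^'+] --> l0 -> F x @[x --> +oo] --> l1 ->
  (F n.+2%:R - F n.+2%:R^-1) @[n --> \oo] --> l1 - l0.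
Proof.
move=> F0 F1.
have cy : n.+2%:R @[n --> \oo] --> (+oo : set_system R).
  apply/cvgryPge => A; near=> n.
  by apply: (@le_trans _ _ n%:R); [near: n; exact: nbhs_infty_ger|rewrite ler_nat -addn2 leq_addr].
apply: cvgB; first exact: cvg_comp _ _ cy F1.
suff c0 : (n.+2%:R^-1 : R) @[n --> \oo] --> (0:R)^'+.
  exact: cvg_comp _ _ c0 F0.
have c0 : (n.+2%:R^-1 : R) @[n --> \oo] --> (0:R).
  have /= := cvg_comp (fun n => n.+1) _ _ (@cvg_harmonic R).
  by apply => A [n _ An]; exists n => // m nm; apply: An => /=; exact: leqW.
move=> A A0.
have /= := c0 _ A0.
by rewrite /nbhs/= /fmap/=; apply: filterS => n; apply; rewrite invr_gt0.
Unshelve. all: by end_near. Qed.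

(** Monotone convergence along the exhaustion: for a nonnegative integrand the limits of a primitive
    give the integral, with no prior integrability. [FTC_pos] treats signed integrands by dominated
    convergence and therefore assumes it. *)
Lemma ge0_FTC_pos f F (l0 l1 : R) :
  (forall x : R, 0 < x -> 0 <= f x) ->
  (forall x : R, 0 < x -> {for x, continuous f}) ->
  (forall x : R, 0 < x -> is_derive x 1 F (f x)) ->
  F x @[x --> 0^'+] --> l0 -> F x @[x --> +oo] --> l1 ->
  (\int[mu]_(x in `]0%R, +oo[) (f x)%:E = (l1 - l0)%:E)%E.
Proof.
move=> f0 cf dF F0 F1; have mf := measurable_pos cf.
have mE n : measurable (E n) by exact: measurable_itv.
have : (\int[mu]_(x in E n) (f x)%:E)%E @[n --> \oo] -->
    (\int[mu]_(x in \bigcup_n E n) (f x)%:E)%E.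
  apply: ge0_nondecreasing_set_cvg_integral => //.
    by move=> n; apply/measurable_EFinP; exact: measurable_funS mf.
  by move=> n x /E_sub; rewrite /= in_itv/= andbT lee_fin; exact: f0.
under eq_fun do rewrite (integral_E _ cf dF).
rewrite E_cup => /(cvg_unique _); apply => //.
by apply/cvg_EFin; [exact: nearW|exact: F_cvg].
Qed.

Lemma ge0_integrable_pos f F (l0 l1 : R) :
  (forall x : R, 0 < x -> 0 <= f x) ->
  (forall x : R, 0 < x -> {for x, continuous f}) ->
  (forall x : R, 0 < x -> is_derive x 1 F (f x)) ->
  F x @[x --> 0^'+] --> l0 -> F x @[x --> +oo] --> l1 ->
  mu.-integrable `]0, +oo[ (EFin \o f).
Proof.
move=> f0 cf dF F0 F1; have mf := measurable_pos cf; apply/integrableP; split.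
  exact/measurable_EFinP.
rewrite (_ : (\int[_]_(x in _) _)%E = (l1 - l0)%:E) ?ltry//.
rewrite -(ge0_FTC_pos f0 cf dF F0 F1); apply: eq_integral => x.
by rewrite inE/= in_itv/= andbT => x0; rewrite ger0_norm// f0.
Qed.

Lemma FTC_pos f F (l0 l1 : R) :
  mu.-integrable `]0, +oo[ (EFin \o f) ->
  (forall x : R, 0 < x -> {for x, continuous f}) ->
  (forall x : R, 0 < x -> is_derive x 1 F (f x)) ->
  F x @[x --> 0^'+] --> l0 -> F x @[x --> +oo] --> l1 ->
  (\int[mu]_(x in `]0%R, +oo[) (f x)%:E = (l1 - l0)%:E)%E.
Proof.
move=> intf cf dF F0 F1; have mf := measurable_pos cf.
have mE n : measurable (E n) by exact: measurable_itv.
pose D : set (measurableTypeR R) := `]0%R, +oo[%classic.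
have mD : measurable D by exact: measurable_itv.
have mfE n : measurable_fun D ((EFin \o f) \_ (E n)).
  apply/(measurable_restrict _ (mE n) mD); rewrite setIidr//.
  by apply/measurable_EFinP; exact: measurable_funS mf.
have fE : {ae mu, forall x, D x ->
    ((EFin \o f) \_ (E n)) x @[n --> \oo] --> (EFin \o f) x}.
  apply: aeW => x; rewrite /D /= in_itv/= andbT => /E_inf Ex.
  by apply: cvg_near_cst; apply: filterS Ex => n En; rewrite patchE mem_set.
have le_f : {ae mu, forall x n, D x ->
    (`|((EFin \o f) \_ (E n)) x| <= (abse \o (EFin \o f)) x)%E}.
  apply: aeW => x n _; rewrite patchE; case: ifP => // _.
  by rewrite abse0 abse_ge0.
have mfD : measurable_fun D (EFin \o f) by exact/measurable_EFinP.
have [_ _] := dominated_convergence mD mfE mfD fE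
  (integrable_abse intf) le_f.
under eq_fun => n.
  rewrite -integral_mkcondr setIidr // (integral_E _ cf dF); over.
move=> /(cvg_unique _); apply => //.
by apply/cvg_EFin; [exact: nearW|exact: F_cvg].
Qed.

End ImproperFTC.

Lemma Rintegral_from0 (R : realType) (f F : R -> R) (x : R) : 0 < x ->
  (forall y : R, 0 < y -> is_derive y 1 F (f y)) ->
  (forall y : R, 0 < y -> {for y, continuous f}) ->
  f y @[y --> 0^'+] --> f 0 -> F y @[y --> 0^'+] --> F 0 ->
  \int[lebesgue_measure]_(u in `[0, x]) f u = F x - F 0.
Proof.
move=> x0 dF cf f0 F0; rewrite /Rintegral (@continuous_FTC2 _ f F)//.
- apply/(continuous_within_itvP _ x0); split => //.
    by move=> y; rewrite in_itv/= => /andP[y0 _]; exact: cf.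
  by apply: cvg_at_left_filter; exact: cf.
- split => //.
    move=> y; rewrite in_itv/= => /andP[y0 _].
    exact: is_deriv_derivable (dF _ y0).
  by apply: cvg_at_left_filter; exact: is_deriv_continuous (dF _ x0).
- move=> y; rewrite in_itv/= => /andP[y0 _]; exact: is_deriv_val (dF _ y0).
Qed.

Lemma Rintegral_toy (R : realType) (f F : R -> R) (x l : R) : 0 < x ->
  (forall y : R, 0 < y -> 0 <= f y) ->
  (forall y : R, 0 < y -> is_derive y 1 F (f y)) ->
  (forall y : R, 0 < y -> {for y, continuous f}) ->
  F y @[y --> +oo] --> l ->
  \int[lebesgue_measure]_(u in `[x, +oo[) f u = l - F x.
Proof.
move=> x0 f0 dF cf Fl; apply: Rintegral_ge0_continuous_FTC2y => //.
- by move=> y xy; apply: f0; exact: lt_le_trans xy.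
- apply: continuous_within => y /=; rewrite in_itv/= andbT => xy.
  by apply: cf; exact: lt_le_trans xy.
- by move=> y xy; apply: is_deriv_derivable (dF _ _); exact: lt_trans xy.
- by apply: cvg_at_right_filter; exact: is_deriv_continuous (dF _ x0).
- move=> y; rewrite in_itv/= andbT => xy; apply: is_deriv_val (dF _ _).
  exact: lt_trans xy.
Qed.

Lemma derive1n2_pos (R : realType) (f df d2f : R -> R) (x : R) : 0 < x ->
  (forall y : R, 0 < y -> is_derive y 1 f (df y)) ->
  (forall y : R, 0 < y -> is_derive y 1 df (d2f y)) ->
  f^`(2)%classic x = d2f x.
Proof.
move=> x0 Df Ddf; rewrite derive1nS; apply: is_deriv_val.
by apply: (is_deriv_pos x0 _ (Ddf _ x0)) => y /Df/is_deriv_val.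
Qed.

Lemma integrable_obnd_cbnd (R : realType) (f : R -> \bar R) (x : R) (b : itv_bound R) :
  lebesgue_measure.-integrable [set` Interval (BRight x) b] f ->
  lebesgue_measure.-integrable [set` Interval (BLeft x) b] f.
Proof.
move=> /integrableP[mf intf]; apply/integrableP; split.
  exact/emeasurable_fun_itv_obnd_cbndP.
by rewrite -integral_itv_obnd_cbnd//; exact: measurableT_comp.
Qed.

(** Unfolds to the same term as [gP a] when [f] is [gamma_pdf a 1]. Under integrability it is
    differentiable wherever [f] is continuous, so the behaviour of [f] at 0 does not matter. *)
Definition primitive (R : realType) (f : R -> R) (x : R) : R :=
  \int[lebesgue_measure]_(u in `[0, x]) f u.

Section Primitive.
Context {R : realType}.
Notation mu := (@lebesgue_measure R).
Variable f : R -> R.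
Hypothesis intf : mu.-integrable `[0, +oo[ (EFin \o f).

Lemma primitive_deriv (x : R) : 0 < x -> {for x, continuous f} ->
  is_derive x 1 (primitive f) (f x).
Proof.
move=> x0 cf; have xx : x < x + 1 by rewrite ltrDl.
have ix : mu.-integrable `[0, x + 1] (EFin \o f).
  by apply: integrableS intf => //; exact: subset_itvl.
have [d v] := continuous_FTC1_closed xx ix x0 cf.
by split; [exact: d|rewrite -derive1E; exact: v].
Qed.

Lemma primitive_cvg0 : primitive f x @[x --> 0^'+] --> 0.
Proof.
have := @parameterized_integral_cvg_left R 0 1 f ltr01.
move=> H; apply: cvg_at_right_filter; apply: H.
by apply: integrableS intf => //; exact: subset_itvl.
Qed.

Lemma primitive_cvgy :
  primitive f x @[x --> +oo] --> \int[mu]_(x in `[0, +oo[) f x.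
Proof.
apply/cvg_pinftyP => u uy.
pose D : set (measurableTypeR R) := `[0%R, +oo[%classic.
pose E n : set (measurableTypeR R) := `[0%R, u n]%classic.
have mD : measurable D by exact: measurable_itv.
have mE n : measurable (E n) by exact: measurable_itv.
have ED n : E n `<=` D by exact: subset_itvl.
have mfD : measurable_fun D (EFin \o f) by exact: measurable_int intf.
have mfE n : measurable_fun D ((EFin \o f) \_ (E n)).
  apply/(measurable_restrict _ (mE n) mD); rewrite setIidr//.
  exact: measurable_funS mfD.
have fE : {ae mu, forall x, D x ->
    ((EFin \o f) \_ (E n)) x @[n --> \oo] --> (EFin \o f) x}.
  apply: aeW => x; rewrite /D /= in_itv/= andbT => x0.
  apply: cvg_near_cst; near=> n; rewrite patchE mem_set//.
  rewrite /E/= in_itv/= x0/=; near: n; exact: (cvgryPge _).1.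
have le_f : {ae mu, forall x n, D x ->
    (`|((EFin \o f) \_ (E n)) x| <= (abse \o (EFin \o f)) x)%E}.
  apply: aeW => x n _; rewrite patchE; case: ifP => // _.
  by rewrite abse0 abse_ge0.
have [_ _] := dominated_convergence mD mfE mfD fE
  (integrable_abse intf) le_f.
under eq_fun => n.
  rewrite -integral_mkcondr setIidr //; over.
rewrite -/D -(fineK (integrable_fin_num mD intf)) => /fine_cvg.
exact.
Unshelve. all: by end_near. Qed.

End Primitive.

(** * Gamma densities *)

Section GammaDensity.
Context {R : realType}.
Notation mu := (@lebesgue_measure R).
Implicit Types x : R.

(** The function [u], with one more power of [x], is nonincreasing beyond [(s + 1) b] and hence
    bounded there; the claim is [u x / x] tending to 0. *)
Lemma powR_expR_cvgy (s b : R) : 0 < b ->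
  x `^ s * expR (- x / b) @[x --> +oo] --> 0.
Proof.
move=> b0; pose u x : R := x `^ (s + 1) * expR (- x / b).
pose m := Num.max 1 ((s + 1) * b).
have m0 : 0 < m by rewrite lt_max ltr01.
have du (x : R) : 0 < x -> is_derive x 1 u (u x * ((s + 1) / x - b^-1)).
  move=> x0.
  have d1 := is_derive1_powR (s + 1) x0.
  have d2 : is_derive x 1 (fun x => expR (- x / b)) (expR (- x / b) * (- b^-1)).
    apply: (is_deriv_exp (f := fun x => - x / b)); apply: is_deriv_eq (is_deriv_mul (is_deriv_opp (is_deriv_id x)) (is_deriv_cst b^-1 x)) _.
    by rewrite mulr0 addr0 mulN1r.
  apply: is_deriv_eq (is_deriv_mul d1 d2) _; rewrite /u powRB ?(gt_eqF x0) ?implybT//.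
  rewrite powRr1 ?ltW//; field.
  by rewrite !gt_eqF.
have u_le x : m <= x -> u x <= u m.
  move=> mx; apply: (@nonincr_of_deriv _ u (fun x => u x * ((s + 1) / x - b^-1))) => //.
    by move=> y /andP[my _]; apply: du; exact: lt_le_trans my.
  move=> y /andP[my _]; have y0 := lt_le_trans m0 my.
  apply: mulr_ge0_le0; first by rewrite mulr_ge0 ?powR_ge0 ?expR_ge0.
  rewrite subr_le0 ler_pdivrMr// -ler_pdivrMl ?invr_gt0// invrK mulrC.
  by apply: le_trans my; rewrite le_max lexx orbT.
apply: (@cvg0_le _ _ _ _ _ (fun x => x^-1) (u m)); last exact: cvg_invy.
near=> x.
have mx : m <= x by near: x; apply: nbhs_pinfty_ge; exact: num_real.
have x0 := lt_le_trans m0 mx.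
rewrite ger0_norm ?mulr_ge0 ?powR_ge0 ?expR_ge0//.
rewrite ler_pdivlMr//; apply: le_trans (u_le _ mx).
have -> : u x = x `^ s * x * expR (- x / b).
  by rewrite /u powRD ?(gt_eqF x0) ?implybT// powRr1 ?(ltW x0).
by rewrite mulrAC.
Unshelve. all: by end_near. Qed.

Variables a b : R.
Hypotheses (a0 : 0 < a) (b0 : 0 < b).
Notation p := (gamma_pdf a b).

Lemma Gamma_ge0 (c : R) : 0 <= Gamma c.
Proof.
apply: Rintegral_ge0 => x _; by rewrite mulr_ge0 ?powR_ge0 ?expR_ge0.
Qed.

Let C := (Gamma a * b `^ a)^-1.

Let C_ge0 : 0 <= C.
Proof. by rewrite /C invr_ge0 mulr_ge0 ?Gamma_ge0 ?powR_ge0. Qed.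

Lemma gamma_pdf_pos x : 0 < x -> p x = C * (x `^ (a - 1) * expR (- x / b)).
Proof.
move=> x0; rewrite /gamma_pdf indicE mem_set ?mulr1 ?mulrA//=.
by rewrite in_itv/= x0.
Qed.

Lemma gamma_pdf_le0 x : x <= 0 -> p x = 0.
Proof.
move=> x0; rewrite /gamma_pdf indicE memNset ?mulr0//=.
by rewrite in_itv/= andbT; apply/negP; rewrite -leNgt.
Qed.

Lemma gamma_pdf_ge0 x : 0 <= p x.
Proof.
by rewrite /gamma_pdf !mulr_ge0 ?powR_ge0 ?expR_ge0 ?indicE.
Qed.

Lemma gamma_pdf_gt0 x : 0 < Gamma a -> 0 < x -> 0 < p x.
Proof.
move=> G0 x0; rewrite gamma_pdf_pos// /C mulr_gt0 ?invr_gt0 ?mulr_gt0 ?powR_gt0 ?expR_gt0//.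
Qed.

Lemma gamma_pdf_deriv x : 0 < x ->
  is_derive x 1 p (((a - 1) / x - b^-1) * p x).
Proof.
move=> x0; apply: (is_deriv_pos x0 (f := fun x => C * (x `^ (a - 1) * expR (- x / b)))).
  by move=> y y0; rewrite gamma_pdf_pos.
have d1 := is_derive1_powR (a - 1) x0.
have d2 : is_derive x 1 (fun x => expR (- x / b)) (expR (- x / b) * (- b^-1)).
  apply: (is_deriv_exp (f := fun x => - x / b)); apply: is_deriv_eq (is_deriv_mul (is_deriv_opp (is_deriv_id x)) (is_deriv_cst b^-1 x)) _.
  by rewrite mulr0 addr0 mulN1r.
apply: is_deriv_eq (is_deriv_mul (is_deriv_cst C x) (is_deriv_mul d1 d2)) _.
rewrite gamma_pdf_pos// [in X in _ + C * (X + _)]powRB ?(gt_eqF x0) ?implybT//.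
rewrite powRr1 ?ltW//; field.
by rewrite !gt_eqF.
Qed.

Lemma gamma_pdf_continuous x : 0 < x -> {for x, continuous p}.
Proof. by move=> x0; exact: is_deriv_continuous (gamma_pdf_deriv x0). Qed.

Lemma gamma_pdf_cvg0 (k : nat) : x ^+ k.+1 * p x @[x --> 0^'+] --> 0.
Proof.
apply: (@cvg0_le _ _ _ _ _ (fun x => x `^ a) C); last exact: powR_cvg0.
near=> x.
have x0 : 0 < x by near: x; exact: nbhs_right_gt.
have x1 : x <= 1 by near: x; exact: nbhs_right_le.
rewrite gamma_pdf_pos// ger0_norm; last first.
  by rewrite !mulr_ge0 ?powR_ge0 ?expR_ge0// exprn_ge0 ?ltW.
rewrite mulrCA ler_wpM2l// exprSr -mulrA [x * _]mulrA.
rewrite mulr_powRB1 ?(ltW x0)//.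
rewrite -[leRHS]mul1r ler_pM ?exprn_ge0 ?mulr_ge0 ?powR_ge0 ?expR_ge0 ?(ltW x0)//.
  by rewrite exprn_ile1 ?(ltW x0).
rewrite -[leRHS]mulr1 ler_wpM2l ?powR_ge0// -expR0 ler_expR.
by rewrite mulNr oppr_le0 divr_ge0 ?ltW.
Unshelve. all: by end_near. Qed.

Lemma gamma_pdf_cvgy (k : nat) : x ^+ k * p x @[x --> +oo] --> 0.
Proof.
apply: (@cvg0_le _ _ _ _ _ (fun x => x `^ (a - 1 + k%:R) * expR (- x / b)) C);
  last exact: powR_expR_cvgy.
near=> x.
have x0 : 0 < x by near: x; apply: nbhs_pinfty_gt; exact: num_real.
rewrite gamma_pdf_pos// ger0_norm; last first.
  by rewrite !mulr_ge0 ?powR_ge0 ?expR_ge0// exprn_ge0 ?ltW.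
rewrite (@powRD _ _ (a - 1)) ?(gt_eqF x0) ?implybT// powR_mulrn ?(ltW x0)//.
by rewrite mulrCA ler_wpM2l// mulrCA mulrA.
Unshelve. all: by end_near. Qed.

Lemma measurable_gamma_pdf : measurable_fun [set: R] p.
Proof.
have -> : p = p \_ `]0, +oo[.
  apply/funext => x; rewrite patchE; case: ifPn => // /negP.
  rewrite inE/= in_itv/= andbT => /negP; rewrite -leNgt => /gamma_pdf_le0.
  exact.
apply/(measurable_restrictT _ _).1 => //.
by apply: measurable_pos => x; exact: gamma_pdf_continuous.
Qed.

Hypothesis intp : mu.-integrable `[0, +oo[ (EFin \o p).
Notation P := (primitive p).

Lemma gamma_cdf_deriv x : 0 < x -> is_derive x 1 P (p x).
Proof.
by move=> x0; apply: primitive_deriv => //; exact: gamma_pdf_continuous.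
Qed.

(** The relation [(x p)' = (a - x / b) p] makes this a primitive of [x p], and
    [(x ^ 2 p)' = (a + 1 - x / b) x p] yields [Q2] for [x ^ 2 p] in the same way. Finiteness of the
    second moment follows from limits of these primitives, without any recurrence for the Gamma
    function. *)
Let Q1 x := a * b * P x - b * (x * p x).

Let Q1_deriv x : 0 < x -> is_derive x 1 Q1 (x * p x).
Proof.
move=> x0; have dP := gamma_cdf_deriv x0; have dp := gamma_pdf_deriv x0.
apply: is_deriv_eq (is_deriv_sub (is_deriv_mul (is_deriv_cst (a * b) x) dP)
  (is_deriv_mul (is_deriv_cst b x) (is_deriv_mul (is_deriv_id x) dp))) _.
by field; rewrite !gt_eqF.
Qed.

Let Q2 x := b * (a + 1) * Q1 x - b * (x ^+ 2 * p x).

Let Q2_deriv x : 0 < x -> is_derive x 1 Q2 (x ^+ 2 * p x).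
Proof.
move=> x0; have dQ := Q1_deriv x0; have dp := gamma_pdf_deriv x0.
have dX : is_derive x 1 (fun x => x ^+ 2) (x *+ 2).
  apply: is_deriv_eq (is_deriv_mul (is_deriv_id x) (is_deriv_id x)) _.
  by rewrite mul1r mulr1 mulr2n.
apply: is_deriv_eq (is_deriv_sub (is_deriv_mul (is_deriv_cst (b * (a + 1)) x) dQ)
  (is_deriv_mul (is_deriv_cst b x) (is_deriv_mul dX dp))) _.
by field; rewrite !gt_eqF.
Qed.

Let P0 := primitive_cvg0 intp.
Let Py := primitive_cvgy intp.

Let Q1_cvg0 : Q1 x @[x --> 0^'+] --> 0.
Proof.
refine (cvg_to_eq (cvg_sub (cvg_mull (a * b) P0) (cvg_mull b (@gamma_pdf_cvg0 0))) _).
by rewrite !mulr0 subr0.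
Qed.

Let Q1_cvgy : Q1 x @[x --> +oo] --> a * b * \int[mu]_(x in `[0, +oo[) p x.
Proof.
refine (cvg_to_eq (cvg_sub (cvg_mull (a * b) Py) (cvg_mull b (@gamma_pdf_cvgy 1))) _).
by rewrite mulr0 subr0.
Qed.

Let Q2_cvg0 : Q2 x @[x --> 0^'+] --> 0.
Proof.
refine (cvg_to_eq (cvg_sub (cvg_mull (b * (a + 1)) Q1_cvg0)
  (cvg_mull b (@gamma_pdf_cvg0 1))) _).
by rewrite !mulr0 subr0.
Qed.

Let Q2_cvgy : exists l : R, Q2 x @[x --> +oo] --> l.
Proof.
eexists.
exact (cvg_sub (cvg_mull (b * (a + 1)) Q1_cvgy) (cvg_mull b (@gamma_pdf_cvgy 2))).
Qed.

Lemma gamma_second_moment_integrable :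
  mu.-integrable `]0, +oo[ (fun x => (x ^+ 2 * p x)%:E).
Proof.
have [l Q2l] := Q2_cvgy.
apply: (ge0_integrable_pos (f := fun x => x ^+ 2 * p x) _ _ Q2_deriv Q2_cvg0 Q2l).
  by move=> x x0; rewrite mulr_ge0 ?gamma_pdf_ge0// sqr_ge0.
move=> x x0; apply: continuousM; first exact: exprn_continuous.
exact: gamma_pdf_continuous.
Qed.

Lemma gamma_integrable_dominated (g : R -> R) (K : R) :
  measurable_fun (`]0, +oo[%classic : set R) g ->
  (forall x, 0 < x -> `|g x| <= K * (1 + x ^+ 2)) ->
  mu.-integrable `[0, +oo[ (fun x => (g x * p x)%:E).
Proof.
move=> mg gK.
pose D : set (measurableTypeR R) := `]0%R, +oo[%classic.
have mD : measurable D by exact: measurable_itv.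
have pD : mu.-integrable D (EFin \o p).
  by apply: integrableS intp => //; apply: subset_itvr; rewrite bnd_simp.
have i1 : mu.-integrable D (fun x => (K%:E * (p x + x ^+ 2 * p x)%:E)%E).
  apply: integrableZl => //.
  exact: (integrableD mD pD gamma_second_moment_integrable).
have i2 : mu.-integrable D (fun x => (g x * p x)%:E).
  apply: le_integrable i1 => //.
    apply/measurable_EFinP/measurable_funM => //.
    by apply: measurable_funS measurable_gamma_pdf.
  move=> x; rewrite /D/= in_itv/= andbT => x0; rewrite lee_fin.
  rewrite normrM (ger0_norm (gamma_pdf_ge0 x)).
  apply: le_trans (ler_norm _).
  apply: le_trans (ler_wpM2r (gamma_pdf_ge0 x) (gK _ x0)) _.
  by rewrite -mulrA mulrDl mul1r.
exact: integrable_obnd_cbnd.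
Qed.

End GammaDensity.

(** * The distribution function at unit scale *)

Section UnitScale.
Context {R : realType}.
Notation mu := (@lebesgue_measure R).
Implicit Types x : R.
Variable a : R.
Hypotheses (a0 : 0 < a) (G0 : 0 < Gamma a).
Notation p := (gamma_pdf a 1).

Let g x := x `^ (a - 1) * expR (- x).

Let g_continuous x : 0 < x -> {for x, continuous g}.
Proof.
move=> x0; apply: continuousM.
  exact: is_deriv_continuous (is_derive1_powR (a - 1) x0).
by apply: continuous_comp; [exact: opp_continuous|exact: continuous_expR].
Qed.

(** A real integral takes the value 0 when the extended one is infinite, so [G0] already excludes
    divergence. *)
Let g_integrable : mu.-integrable `]0, +oo[ (EFin \o g).
Proof.
apply/integrableP; split.
  have mg := measurable_pos g_continuous.
  exact/measurable_EFinP.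
under eq_integral => x _.
  rewrite /= ger0_norm; last by rewrite mulr_ge0 ?powR_ge0 ?expR_ge0.
  over.
rewrite ltey; apply/eqP => E; move: G0.
by rewrite /Gamma /Rintegral E ltxx.
Qed.

Let pE x : 0 < x -> p x = (Gamma a)^-1 * g x.
Proof. by move=> x0; rewrite gamma_pdf_pos// powR1 mulr1 divr1. Qed.

Lemma gamma1_integrable : mu.-integrable `[0, +oo[ (EFin \o p).
Proof.
apply: integrable_obnd_cbnd.
have mD : measurable (`]0%R, +oo[%classic : set (measurableTypeR R)).
  exact: measurable_itv.
apply: eq_integrable (integrableZl mD (Gamma a)^-1 g_integrable) => //.
by move=> x; rewrite inE/= in_itv/= andbT => x0; rewrite pE.
Qed.

Lemma gamma1_mass : \int[mu]_(x in `[0, +oo[) p x = 1.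
Proof.
rewrite -Rintegral_itv_obnd_cbnd; last first.
  by apply: integrableS gamma1_integrable => //; apply: subset_itvr; rewrite bnd_simp.
under eq_Rintegral.
  move=> x; rewrite inE/= in_itv/= andbT => x0; rewrite pE//; over.
rewrite RintegralZl//; first by rewrite mulVf ?gt_eqF.
Qed.

Notation P := (gP a).
Notation Pbar := (fun x => 1 - P x).

Lemma gP_deriv x : 0 < x -> is_derive x 1 P (p x).
Proof. by move=> x0; apply: gamma_cdf_deriv => //; exact: gamma1_integrable. Qed.

Lemma gP_cvg0 : P x @[x --> 0^'+] --> 0.
Proof. exact: primitive_cvg0 gamma1_integrable. Qed.

Lemma gP_cvgy : P x @[x --> +oo] --> (1 : R).
Proof. by have := primitive_cvgy gamma1_integrable; rewrite gamma1_mass. Qed.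

Lemma gPbarE x : 0 < x -> gPbar a x = 1 - P x.
Proof.
move=> x0; rewrite -gamma1_mass /gP (@Rintegral_itvB _ p) ?bnd_simp ?ltW//; last exact: gamma1_integrable.
rewrite Rintegral_itv_obnd_cbnd//; apply: integrableS gamma1_integrable => //.
by apply: subset_itvr; rewrite bnd_simp ltW.
Qed.

Lemma gP0 : P 0 = 0.
Proof. by rewrite /gP set_itv1 Rintegral_set1. Qed.

Lemma gP_ge0 x : 0 <= P x.
Proof. by apply: Rintegral_ge0 => y _; exact: gamma_pdf_ge0. Qed.

Lemma gPbar_deriv x : 0 < x -> is_derive x 1 Pbar (- p x).
Proof.
move=> x0; apply: is_deriv_eq (is_deriv_sub (is_deriv_cst 1 x) (gP_deriv x0)) _.
by rewrite sub0r.
Qed.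

Lemma gPbar_cvgy : (1 - P x) @[x --> +oo] --> (0 : R).
Proof.
refine (cvg_to_eq (cvg_sub (cvg_cst (1 : R)) gP_cvgy) _); exact: subrr.
Qed.

Lemma gPbar_ge0 x : 0 < x -> 0 <= 1 - P x.
Proof.
move=> x0; apply: (ge0_of_decr_cvgy (m := 0) _ _ gPbar_cvgy x0).
  by move=> y; exact: gPbar_deriv.
by move=> y _; rewrite oppr_le0 gamma_pdf_ge0.
Qed.

End UnitScale.

(** * Stein kernels of the Gamma law *)

Section SteinKernel.
Context {R : realType}.
Notation mu := (@lebesgue_measure R).
Implicit Types x : R.
Variable a : R.
Hypotheses (a0 : 0 < a) (G0 : 0 < Gamma a).
Notation p := (gamma_pdf a 1).
Notation P := (gP a).

(* [lowPk] is k! times the k-fold iterated integral of [P] from 0, and also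
   [x ^ (k + 1) p] times the k-th derivative of [P / (x p)].  Likewise [uppPk] is
   k! times the k-fold iterated integral of [1 - P] up to +oo, and
   [(- 1) ^ k x ^ (k + 1) p] times the k-th derivative of [(1 - P) / (x p)]. *)
Definition lowP1 x : R := (x - a) * P x + x * p x.
Definition lowP2 x : R := x * P x + (x - a - 1) * lowP1 x.
Definition lowP3 x : R := 2 * x * lowP1 x + (x - a - 2) * lowP2 x.
Definition uppP1 x : R := (a - x) * (1 - P x) + x * p x.
Definition uppP2 x : R := x * (1 - P x) - (x - a - 1) * uppP1 x.
Definition uppP3 x : R := 2 * x * uppP1 x - (x - a - 2) * uppP2 x.

Let xp_deriv x : 0 < x -> is_derive x 1 (fun x => x * p x) ((a - x) * p x).
Proof.
move=> x0; apply: is_deriv_eq (is_deriv_mul (is_deriv_id x) (gamma_pdf_deriv a ltr01 x0)) _.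
by field; rewrite gt_eqF.
Qed.

Let sub_deriv (c x : R) : is_derive x 1 (fun x => x - c) 1.
Proof. by apply: is_deriv_eq (is_deriv_sub (is_deriv_id x) (is_deriv_cst c x)) _; rewrite subr0. Qed.

Lemma lowP1_deriv x : 0 < x -> is_derive x 1 lowP1 (P x).
Proof.
move=> x0; apply: is_deriv_eq (is_deriv_add (is_deriv_mul (sub_deriv a x)
  (gP_deriv G0 x0)) (xp_deriv x0)) _.
by ring.
Qed.

Lemma lowP2_deriv x : 0 < x -> is_derive x 1 lowP2 (2 * lowP1 x).
Proof.
move=> x0; have d1 := is_deriv_mul (is_deriv_id x) (gP_deriv G0 x0).
have d2 := is_deriv_sub (sub_deriv a x) (is_deriv_cst 1 x).
apply: is_deriv_eq (is_deriv_add d1 (is_deriv_mul d2 (lowP1_deriv x0))) _.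
by rewrite /lowP1; ring.
Qed.

Lemma lowP3_deriv x : 0 < x -> is_derive x 1 lowP3 (3 * lowP2 x).
Proof.
move=> x0; have d1 := is_deriv_mul (is_deriv_mul (is_deriv_cst 2 x) (is_deriv_id x)) (lowP1_deriv x0).
have d2 := is_deriv_sub (sub_deriv a x) (is_deriv_cst 2 x).
apply: is_deriv_eq (is_deriv_add d1 (is_deriv_mul d2 (lowP2_deriv x0))) _.
by rewrite /lowP2; ring.
Qed.

Lemma uppP1_deriv x : 0 < x -> is_derive x 1 uppP1 (- (1 - P x)).
Proof.
move=> x0; have d := is_deriv_sub (is_deriv_cst a x) (is_deriv_id x).
apply: is_deriv_eq (is_deriv_add (is_deriv_mul d
  (gPbar_deriv G0 x0)) (xp_deriv x0)) _.
by ring.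
Qed.

Lemma uppP2_deriv x : 0 < x -> is_derive x 1 uppP2 (- (2 * uppP1 x)).
Proof.
move=> x0; have d1 := is_deriv_mul (is_deriv_id x) (gPbar_deriv G0 x0).
have d2 := is_deriv_sub (sub_deriv a x) (is_deriv_cst 1 x).
apply: is_deriv_eq (is_deriv_sub d1 (is_deriv_mul d2 (uppP1_deriv x0))) _.
by rewrite /uppP1; ring.
Qed.

Lemma uppP3_deriv x : 0 < x -> is_derive x 1 uppP3 (- (3 * uppP2 x)).
Proof.
move=> x0; have d1 := is_deriv_mul (is_deriv_mul (is_deriv_cst 2 x) (is_deriv_id x)) (uppP1_deriv x0).
have d2 := is_deriv_sub (sub_deriv a x) (is_deriv_cst 2 x).
apply: is_deriv_eq (is_deriv_sub d1 (is_deriv_mul d2 (uppP2_deriv x0))) _.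
by rewrite /uppP2; ring.
Qed.

Let id_cvg0 : (x : R) @[x --> 0^'+] --> (0 : R).
Proof. by apply: cvg_at_right_filter; exact: cvg_id. Qed.

Let xp_cvg0 : x * p x @[x --> 0^'+] --> 0.
Proof. exact: (gamma_pdf_cvg0 a0 ltr01 0). Qed.

Let P_cvg0 := gP_cvg0 G0.

Lemma lowP1_cvg0 : lowP1 x @[x --> 0^'+] --> 0.
Proof.
refine (cvg_to_eq (cvg_add (cvgM (cvg_sub id_cvg0 (cvg_cst a)) P_cvg0) xp_cvg0) _).
by rewrite mulr0 addr0.
Qed.

Lemma lowP2_cvg0 : lowP2 x @[x --> 0^'+] --> 0.
Proof.
refine (cvg_to_eq (cvg_add (cvgM id_cvg0 P_cvg0)
 (cvgM (cvg_sub (cvg_sub id_cvg0 (cvg_cst a)) (cvg_cst (1 : R))) lowP1_cvg0)) _).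
by rewrite !mulr0 addr0.
Qed.

Lemma lowP3_cvg0 : lowP3 x @[x --> 0^'+] --> 0.
Proof.
refine (cvg_to_eq (cvg_add (cvgM (cvg_mull 2 id_cvg0) lowP1_cvg0)
 (cvgM (cvg_sub (cvg_sub id_cvg0 (cvg_cst a)) (cvg_cst (2 : R))) lowP2_cvg0)) _).
by rewrite !mulr0 addr0.
Qed.

(** The derivative of [2 p - (1 - P)] is [(2 (a - 1) / x - 1) p], which is nonpositive beyond
    [2 (a - 1)], and the difference tends to 0. This carries the exponential decay of the density
    over to the tail. *)
Lemma gPbar_le x : 0 < x -> 2 * (a - 1) < x -> 1 - P x <= 2 * p x.
Proof.
move=> x0 ax; pose m := Num.max 0 (2 * (a - 1)).
rewrite -subr_ge0; apply: (ge0_of_decr_cvgy (m := m) (f := fun x => 2 * p x - (1 - P x))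
  (df := fun x => 2 * (((a - 1) / x - 1^-1) * p x) - (- p x))).
- move=> y; rewrite gt_max => /andP[y0 _].
  apply: is_deriv_eq (is_deriv_sub (is_deriv_mul (is_deriv_cst 2 y)
    (gamma_pdf_deriv a ltr01 y0)) (gPbar_deriv G0 y0)) _.
  by rewrite mul0r add0r.
- move=> y; rewrite gt_max => /andP[y0 ay].
  rewrite (_ : _ - _ = (2 * (a - 1) / y - 1) * p y); last by field; rewrite gt_eqF.
  by rewrite mulr_le0_ge0 ?gamma_pdf_ge0// subr_le0 ler_pdivrMr// mul1r ltW.
- have py : p x @[x --> +oo] --> 0.
    by have := gamma_pdf_cvgy a ltr01 0; under eq_fun do rewrite mul1r.
  refine (cvg_to_eq (cvg_sub (cvg_mull 2 py) (gPbar_cvgy G0)) _).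
  by rewrite mulr0 subr0.
- by rewrite gt_max x0.
Qed.

Lemma gPbar_pow_cvgy (k : nat) : x ^+ k * (1 - P x) @[x --> +oo] --> (0 : R).
Proof.
apply: (@cvg0_le _ _ _ _ _ (fun x => x ^+ k * p x) 2); last exact: gamma_pdf_cvgy.
near=> x.
have x0 : 0 < x by near: x; apply: nbhs_pinfty_gt; exact: num_real.
have xa : 2 * (a - 1) < x by near: x; apply: nbhs_pinfty_gt; exact: num_real.
rewrite ger0_norm ?mulr_ge0 ?exprn_ge0 ?(ltW x0) ?gPbar_ge0//.
by rewrite mulrCA ler_wpM2l ?exprn_ge0 ?(ltW x0)// gPbar_le.
Unshelve. all: by end_near. Qed.

Let pk k := gamma_pdf_cvgy a (ltr01 : 0 < (1 : R)) k.
Let Pk := gPbar_pow_cvgy.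

Let uppP1_pow_cvgy (k : nat) : x ^+ k * uppP1 x @[x --> +oo] --> (0 : R).
Proof.
have E x : x ^+ k * uppP1 x = a * (x ^+ k * (1 - P x)) - x ^+ k.+1 * (1 - P x) + x ^+ k.+1 * p x.
  by rewrite /uppP1 exprS; ring.
under eq_fun do rewrite E.
refine (cvg_to_eq (cvg_add (cvg_sub (cvg_mull a (Pk k)) (Pk k.+1)) (pk k.+1)) _).
by rewrite mulr0 subr0 addr0.
Qed.

Let uppP2_pow_cvgy (k : nat) : x ^+ k * uppP2 x @[x --> +oo] --> (0 : R).
Proof.
have E x : x ^+ k * uppP2 x = x ^+ k.+1 * (1 - P x) - (x ^+ k.+1 * uppP1 x - (a + 1) * (x ^+ k * uppP1 x)).
  by rewrite /uppP2 exprS; ring.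
under eq_fun do rewrite E.
refine (cvg_to_eq (cvg_sub (Pk k.+1) (cvg_sub (uppP1_pow_cvgy k.+1) (cvg_mull (a + 1) (uppP1_pow_cvgy k)))) _).
by rewrite mulr0 !subr0.
Qed.

Lemma uppP1_cvgy : uppP1 x @[x --> +oo] --> (0 : R).
Proof. by have := uppP1_pow_cvgy 0; under eq_fun do rewrite mul1r. Qed.

Lemma uppP1_cvg0 : (a - uppP1 x) @[x --> 0^'+] --> (0 : R).
Proof.
refine (cvg_to_eq (cvg_sub (cvg_cst a) (cvg_add (cvgM (cvg_sub (cvg_cst a) id_cvg0)
  (cvg_sub (cvg_cst (1 : R)) P_cvg0)) xp_cvg0)) _).
by rewrite !subr0 mulr1 addr0 subrr.
Qed.

Lemma uppP1_lin_cvgy : x * uppP1 x @[x --> +oo] --> (0 : R).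
Proof. exact: (uppP1_pow_cvgy 1). Qed.

Lemma uppP2_cvgy : uppP2 x @[x --> +oo] --> (0 : R).
Proof. by have := uppP2_pow_cvgy 0; under eq_fun do rewrite mul1r. Qed.

Lemma uppP3_cvgy : uppP3 x @[x --> +oo] --> (0 : R).
Proof.
have E x : uppP3 x = 2 * (x ^+ 1 * uppP1 x) - (x ^+ 1 * uppP2 x - (a + 2) * (x ^+ 0 * uppP2 x)).
  by rewrite /uppP3; ring.
under eq_fun do rewrite E.
refine (cvg_to_eq (cvg_sub (cvg_mull 2 (uppP1_pow_cvgy 1)) (cvg_sub (uppP2_pow_cvgy 1) (cvg_mull (a + 2) (uppP2_pow_cvgy 0)))) _).
by rewrite !mulr0 !subr0.
Qed.

Lemma lowP1_ge0 x : 0 < x -> 0 <= lowP1 x.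
Proof.
move=> x0; apply: (ge0_of_incr_cvg0 lowP1_deriv _ lowP1_cvg0 x0) => y _.
exact: gP_ge0.
Qed.

Lemma lowP2_ge0 x : 0 < x -> 0 <= lowP2 x.
Proof.
move=> x0; apply: (ge0_of_incr_cvg0 lowP2_deriv _ lowP2_cvg0 x0) => y y0.
by rewrite mulr_ge0 ?lowP1_ge0.
Qed.

Lemma lowP3_ge0 x : 0 < x -> 0 <= lowP3 x.
Proof.
move=> x0; apply: (ge0_of_incr_cvg0 lowP3_deriv _ lowP3_cvg0 x0) => y y0.
by rewrite mulr_ge0 ?lowP2_ge0.
Qed.

Lemma uppP1_ge0 x : 0 < x -> 0 <= uppP1 x.
Proof.
move=> x0; apply: (ge0_of_decr_cvgy (m := 0) (df := fun y => - (1 - P y))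
  uppP1_deriv _ uppP1_cvgy x0) => y y0.
by rewrite oppr_le0 gPbar_ge0.
Qed.

Lemma uppP2_ge0 x : 0 < x -> 0 <= uppP2 x.
Proof.
move=> x0; apply: (ge0_of_decr_cvgy (m := 0) (df := fun y => - (2 * uppP1 y))
  uppP2_deriv _ uppP2_cvgy x0) => y y0.
by rewrite oppr_le0 mulr_ge0 ?uppP1_ge0.
Qed.

Lemma uppP3_ge0 x : 0 < x -> 0 <= uppP3 x.
Proof.
move=> x0; apply: (ge0_of_decr_cvgy (m := 0) (df := fun y => - (3 * uppP2 y))
  uppP3_deriv _ uppP3_cvgy x0) => y y0.
by rewrite oppr_le0 mulr_ge0 ?uppP2_ge0.
Qed.

Let p_neq0 x : 0 < x -> p x != 0.
Proof. by move=> x0; rewrite gt_eqF// gamma_pdf_gt0. Qed.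

Lemma gP1E x : 0 < x -> gP1 a x = lowP1 x.
Proof.
move=> x0; rewrite /gP1 (Rintegral_from0 x0 lowP1_deriv).
- by rewrite {2}/lowP1 gP0 mulr0 add0r mul0r subr0.
- by move=> y y0; exact: is_deriv_continuous (gP_deriv G0 y0).
- by rewrite gP0.
- by rewrite {2}/lowP1 gP0 mulr0 add0r mul0r; exact: lowP1_cvg0.
Qed.

Lemma integral_gP1 z : 0 < z -> \int[mu]_(x in `[0, z]) gP1 a x = lowP2 z / 2.
Proof.
move=> z0; have gP10 : gP1 a 0 = 0 by rewrite /gP1 set_itv1 Rintegral_set1.
have dF (y : R) : 0 < y -> is_derive y 1 (fun x => lowP2 x / 2) (gP1 a y).
  move=> y0; rewrite gP1E//.
  apply: is_deriv_eq (is_deriv_mul (lowP2_deriv y0) (is_deriv_cst 2^-1 y)) _.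
  by field.
rewrite (Rintegral_from0 z0 dF).
- by rewrite {2}/lowP2 /lowP1 gP0; ring.
- move=> y y0; apply: is_deriv_continuous (_ : is_derive y 1 _ (P y)).
  by apply: is_deriv_pos (lowP1_deriv y0) => // t /gP1E.
- rewrite gP10; have := lowP1_cvg0; apply: cvg_trans; apply: near_eq_cvg.
  by near=> y; rewrite gP1E//; near: y; exact: nbhs_right_gt.
- rewrite [in X in _ --> X]/lowP2 /lowP1 gP0.
  refine (cvg_to_eq (cvgM lowP2_cvg0 (cvg_cst (2^-1 : R))) _); ring.
Unshelve. all: by end_near. Qed.

Lemma gP1barE x : 0 < x -> gP1bar a x = uppP1 x.
Proof.
move=> x0; rewrite /gP1bar.
transitivity (\int[mu]_(u in `[x, +oo[) (1 - P u)).
  apply: eq_Rintegral => u; rewrite inE/= in_itv/= andbT => xu.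
  by rewrite gPbarE//; exact: lt_le_trans xu.
have dF (y : R) : 0 < y -> is_derive y 1 (fun x => - uppP1 x) (1 - P y).
  by move=> y0; apply: is_deriv_eq (is_deriv_opp (uppP1_deriv y0)) _; rewrite opprK.
rewrite (Rintegral_toy (l := 0) x0 _ dF) ?opprK ?add0r//.
- by move=> y; exact: gPbar_ge0.
- by move=> y y0; exact: is_deriv_continuous (gPbar_deriv G0 y0).
- rewrite -oppr0; apply: cvgN; exact: uppP1_cvgy.
Qed.

Lemma integral_gP1bar z : 0 < z -> \int[mu]_(x in `[z, +oo[) gP1bar a x = uppP2 z / 2.
Proof.
move=> z0.
transitivity (\int[mu]_(u in `[z, +oo[) uppP1 u).
  apply: eq_Rintegral => u; rewrite inE/= in_itv/= andbT => xu.
  by rewrite gP1barE//; exact: lt_le_trans xu.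
have dF (y : R) : 0 < y -> is_derive y 1 (fun x => - (uppP2 x / 2)) (uppP1 y).
  move=> y0; apply: is_deriv_eq (is_deriv_opp (is_deriv_mul (uppP2_deriv y0) (is_deriv_cst 2^-1 y))) _.
  by field.
rewrite (Rintegral_toy (l := 0) z0 _ dF) ?opprK ?add0r//.
- by move=> y; exact: uppP1_ge0.
- by move=> y y0; exact: is_deriv_continuous (uppP1_deriv y0).
- rewrite -oppr0; apply: cvgN.
  by refine (cvg_to_eq (cvgM uppP2_cvgy (cvg_cst (2^-1 : R))) _); rewrite mul0r.
Qed.

Lemma gM_deriv x : 0 < x -> is_derive x 1 (gM a) (lowP1 x / (x ^+ 2 * p x)).
Proof.
move=> x0; have p0 := p_neq0 x0; have x1 : x != 0 by rewrite gt_eqF.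
apply: is_deriv_eq (is_deriv_div _ (gP_deriv G0 x0) (xp_deriv x0)) _.
  by rewrite mulf_neq0.
by rewrite /lowP1; field; rewrite x1 p0.
Qed.

Lemma powM_gamma_pdf_deriv (k : nat) x : 0 < x ->
  is_derive x 1 (fun x => x ^+ k.+1 * p x) ((a + k%:R - x) * x ^+ k * p x).
Proof.
elim: k x => [|k IH] x x0.
  by apply: is_deriv_eq (xp_deriv x0) _; rewrite expr0; ring.
have := is_deriv_mul (is_deriv_id x) (IH x x0).
rewrite (_ : (fun y => y * _) = (fun x => x ^+ k.+2 * p x)); last first.
  by apply/funext => y; rewrite [in RHS]exprS mulrA.
by move=> d; apply: is_deriv_eq d _; rewrite -natr1 exprS; ring.
Qed.

Lemma dgM_deriv x : 0 < x ->
  is_derive x 1 (fun x => lowP1 x / (x ^+ 2 * p x)) (lowP2 x / (x ^+ 3 * p x)).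
Proof.
move=> x0; have p0 := p_neq0 x0; have x1 : x != 0 by rewrite gt_eqF.
apply: is_deriv_eq (is_deriv_div _ (lowP1_deriv x0) (powM_gamma_pdf_deriv 1 x0)) _.
  by rewrite mulf_neq0// expf_neq0.
by rewrite /lowP2; field; rewrite x1 p0.
Qed.

Lemma gMbar_deriv x : 0 < x -> is_derive x 1 (gMbar a) (- uppP1 x / (x ^+ 2 * p x)).
Proof.
move=> x0; have p0 := p_neq0 x0; have x1 : x != 0 by rewrite gt_eqF.
apply: (is_deriv_pos (f := fun x => (1 - P x) / (x * p x)) x0).
  by move=> y y0; rewrite /gMbar gPbarE.
apply: is_deriv_eq (is_deriv_div _ (gPbar_deriv G0 x0) (xp_deriv x0)) _.
  by rewrite mulf_neq0.
by rewrite /uppP1; field; rewrite x1 p0.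
Qed.

Lemma dgMbar_deriv x : 0 < x ->
  is_derive x 1 (fun x => - uppP1 x / (x ^+ 2 * p x)) (uppP2 x / (x ^+ 3 * p x)).
Proof.
move=> x0; have p0 := p_neq0 x0; have x1 : x != 0 by rewrite gt_eqF.
apply: is_deriv_eq (is_deriv_div _ (is_deriv_opp (uppP1_deriv x0)) (powM_gamma_pdf_deriv 1 x0)) _.
  by rewrite mulf_neq0// expf_neq0.
by rewrite /uppP2; field; rewrite x1 p0.
Qed.

(** The two terms of [gC2] are equal: the second derivatives of the kernels are [uppP2] and [lowP2]
    over [z ^ 3 p], and the integrals that multiply them are [lowP2 / 2] and [uppP2 / 2]. *)
Lemma gC2E z : 0 < z -> gC2 a z = uppP2 z * lowP2 z / (z ^+ 3 * p z).
Proof.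
move=> z0; rewrite /gC2 integral_gP1// integral_gP1bar//.
rewrite (derive1n2_pos z0 gM_deriv dgM_deriv).
rewrite (derive1n2_pos z0 gMbar_deriv dgMbar_deriv).
by field; rewrite p_neq0 ?gt_eqF.
Qed.

(** Up to sign and to powers of [x] and [p], these are the Wronskians of the kernels [P / (x p)] and
    [(1 - P) / (x p)], of their first derivatives and of their second derivatives. They evaluate the
    numerators of the Stein solution at the extremal remainders; [wronskian1] corresponds to the
    test function [x], whose solution is the constant -1. *)
Lemma wronskian1 x : (1 - P x) * lowP1 x + P x * uppP1 x = x * p x.
Proof. by rewrite /lowP1 /uppP1; ring. Qed.

Lemma wronskian2 x : uppP2 x * lowP1 x + lowP2 x * uppP1 x = x ^+ 2 * p x.
Proof. by rewrite /lowP2 /uppP2 /lowP1 /uppP1; ring. Qed.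

Lemma wronskian3 x : uppP3 x * lowP2 x + lowP3 x * uppP2 x = 2 * (x ^+ 3 * p x).
Proof. by rewrite /lowP3 /uppP3 /lowP2 /uppP2 /lowP1 /uppP1; ring. Qed.

(** [lowP2] is twice the integral from 0 of the nondecreasing function [lowP1]. *)
Lemma lowP2_le x : 0 < x -> lowP2 x <= 2 * x * lowP1 x.
Proof.
move=> x0; rewrite -subr_ge0.
apply: (ge0_of_incr_cvg0 (f := fun x => 2 * x * lowP1 x - lowP2 x) (df := fun x => 2 * x * P x)) x0.
- move=> y y0; apply: is_deriv_eq (is_deriv_sub (is_deriv_mul (is_deriv_mul (is_deriv_cst 2 y) (is_deriv_id y)) (lowP1_deriv y0)) (lowP2_deriv y0)) _.
  by ring.
- by move=> y y0; rewrite !mulr_ge0 ?gP_ge0 ?ltW.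
- refine (cvg_to_eq (cvg_sub (cvgM (cvg_mull 2 id_cvg0) lowP1_cvg0) lowP2_cvg0) _).
  by rewrite !mulr0 subr0.
Qed.

(** By [lowP2_le] the numerator is at most [2 z] times one of the two nonnegative terms of
    [wronskian2]. This is the boundedness that gives [e_const] the meaning of a supremum. *)
Lemma gC2_le2 z : 0 < z -> gC2 a z <= 2.
Proof.
move=> z0; rewrite gC2E// ler_pdivrMr; last by rewrite mulr_gt0 ?exprn_gt0// gamma_pdf_gt0.
apply: le_trans (ler_wpM2l (uppP2_ge0 z0) (lowP2_le z0)) _.
have -> : uppP2 z * (2 * z * lowP1 z) = 2 * z * (uppP2 z * lowP1 z) by ring.
have -> : 2 * (z ^+ 3 * p z) = 2 * z * (z ^+ 2 * p z) by ring.
rewrite -wronskian2 ler_wpM2l ?mulr_ge0 ?(ltW z0)//.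
by rewrite lerDl mulr_ge0 ?lowP2_ge0 ?uppP1_ge0.
Qed.

Lemma gC2_le_e_const z : 0 < z -> gC2 a z <= e_const a.
Proof.
move=> z0; apply: ub_le_sup.
  by exists 2 => _ [y + <-]; rewrite /= in_itv/= andbT; exact: gC2_le2.
by exists z => //=; rewrite in_itv/= z0.
Qed.

End SteinKernel.

(** * The Stein equation at unit scale *)

Section SteinSolution.
Context {R : realType}.
Notation mu := (@lebesgue_measure R).
Implicit Types x : R.
Variable a : R.
Hypotheses (a0 : 0 < a) (G0 : 0 < Gamma a).
Notation p := (gamma_pdf a 1).
Notation P := (gP a).
Notation E1 := (lowP1 a).
Notation E2 := (lowP2 a).
Notation E3 := (lowP3 a).
Notation F1 := (uppP1 a).
Notation F2 := (uppP2 a).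
Notation F3 := (uppP3 a).

Variables (h h1 : R -> R) (K : R).
Hypotheses (dh : forall x, 0 < x -> is_derive x 1 h (h1 x))
  (hK : forall x, 0 < x -> `|h x| <= K * (1 + x ^+ 2)).

Let hp x := h x * p x.

Definition stein_mean : R := \int[mu]_(x in `[0, +oo[) (h x * p x).
Notation c := stein_mean.

Let H := primitive hp.

(* The derivatives of these remainders are [P h'] and [- (1 - P) h'], so that
   they are controlled by iterated integrals of [P] and [1 - P]. *)
Definition stein_low x : R := P x * h x - H x.
Definition stein_upp x : R := c - H x - (1 - P x) * h x.
Notation I := stein_low.
Notation J := stein_upp.

(* This is [(H - c P) / (x p)]; in terms of the remainders the coefficients of
   the solution and of its derivatives have a constant sign. *)
Definition stein_sol x : R := - ((1 - P x) * I x + P x * J x) / (x * p x).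
Definition stein_sol1 x : R := (F1 x * I x - E1 x * J x) / (x ^+ 2 * p x).
Definition stein_sol2 x : R := h1 x / x - (F2 x * I x + E2 x * J x) / (x ^+ 3 * p x).

Let p_neq0 x : 0 < x -> p x != 0.
Proof. by move=> x0; rewrite gt_eqF// gamma_pdf_gt0. Qed.

Let xkp_gt0 (k : nat) x : 0 < x -> 0 < x ^+ k * p x.
Proof. by move=> x0; rewrite mulr_gt0 ?exprn_gt0// gamma_pdf_gt0. Qed.

Let hp_integrable : mu.-integrable `[0, +oo[ (EFin \o hp).
Proof.
apply: (gamma_integrable_dominated a0 ltr01 (gamma1_integrable G0) _ hK).
by apply: measurable_pos => x x0; exact: is_deriv_continuous (dh x0).
Qed.

Let H_deriv x : 0 < x -> is_derive x 1 H (h x * p x).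
Proof.
move=> x0; apply: primitive_deriv => //.
apply: continuousM; first exact: is_deriv_continuous (dh x0).
exact: gamma_pdf_continuous.
Qed.

Let H_cvg0 : H x @[x --> 0^'+] --> 0.
Proof. exact: primitive_cvg0 hp_integrable. Qed.

Let H_cvgy : H x @[x --> +oo] --> c.
Proof. exact: primitive_cvgy hp_integrable. Qed.

Let I_deriv x : 0 < x -> is_derive x 1 I (P x * h1 x).
Proof.
move=> x0; apply: is_deriv_eq (is_deriv_sub (is_deriv_mul (gP_deriv G0 x0) (dh x0)) (H_deriv x0)) _.
by ring.
Qed.

Let J_deriv x : 0 < x -> is_derive x 1 J (- (1 - P x) * h1 x).
Proof.
move=> x0; apply: is_deriv_eq (is_deriv_sub (is_deriv_sub (is_deriv_cst c x) (H_deriv x0))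
  (is_deriv_mul (gPbar_deriv G0 x0) (dh x0))) _.
by ring.
Qed.

Let I_cvg0 : I x @[x --> 0^'+] --> (0 : R).
Proof.
suff Ph0 : P x * h x @[x --> 0^'+] --> (0 : R).
  by refine (cvg_to_eq (cvg_sub Ph0 H_cvg0) _); rewrite subr0.
apply: (@cvg0_le _ _ _ _ _ P (K * (1 + 1))); last exact: gP_cvg0.
near=> x.
have x0 : 0 < x by near: x; exact: nbhs_right_gt.
have x1 : x <= 1 by near: x; exact: nbhs_right_le.
have K0 : 0 <= K.
  by have := le_trans (normr_ge0 _) (hK x0); rewrite pmulr_lge0// ltr_pwDl// sqr_ge0.
rewrite normrM (ger0_norm (gP_ge0 _ _)) mulrC ler_wpM2r ?gP_ge0//.
apply: le_trans (hK x0) _; rewrite ler_wpM2l// lerD2l.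
by rewrite expr_le1// ltW.
Unshelve. all: by end_near. Qed.

Let J_cvgy : J x @[x --> +oo] --> (0 : R).
Proof.
suff Ph0 : (1 - P x) * h x @[x --> +oo] --> (0 : R).
  by refine (cvg_to_eq (cvg_sub (cvg_sub (cvg_cst c) H_cvgy) Ph0) _); rewrite subrr subr0.
apply: (@cvg0_le _ _ _ _ _ (fun x => x ^+ 0 * (1 - P x) + x ^+ 2 * (1 - P x)) K); last first.
  by refine (cvg_to_eq (cvg_add (gPbar_pow_cvgy G0 0) (gPbar_pow_cvgy G0 2)) _); rewrite addr0.
near=> x.
have x0 : 0 < x by near: x; apply: nbhs_pinfty_gt; exact: num_real.
rewrite normrM (ger0_norm (gPbar_ge0 G0 x0)) mulrC -mulrDl expr0 mulrA.
by rewrite ler_wpM2r ?gPbar_ge0// hK.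
Unshelve. all: by end_near. Qed.

Lemma stein_equation x : 0 < x ->
  x * stein_sol1 x + (a - x) * stein_sol x = h x - c.
Proof.
move=> x0; rewrite /stein_sol1 /stein_sol /stein_low /stein_upp /lowP1 /uppP1.
by field; rewrite p_neq0// gt_eqF.
Qed.

Let xkp_deriv (k : nat) x : 0 < x ->
  is_derive x 1 (fun x => x ^+ k.+1 * p x) ((a + k%:R - x) * x ^+ k * p x).
Proof. exact: powM_gamma_pdf_deriv. Qed.

Lemma stein_sol_deriv x : 0 < x -> is_derive x 1 stein_sol (stein_sol1 x).
Proof.
move=> x0; have p0 := p_neq0 x0; have x1 : x != 0 by rewrite gt_eqF.
have d1 := is_deriv_mul (gPbar_deriv G0 x0) (I_deriv x0).
have d2 := is_deriv_mul (gP_deriv G0 x0) (J_deriv x0).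
apply: is_deriv_eq (is_deriv_div _ (is_deriv_opp (is_deriv_add d1 d2)) (xkp_deriv 0 x0)) _.
  by rewrite mulf_neq0// expf_neq0.
rewrite /stein_sol1 /stein_low /stein_upp /lowP1 /uppP1.
by field; rewrite x1 p0.
Qed.

Lemma stein_sol1_deriv x : 0 < x -> is_derive x 1 stein_sol1 (stein_sol2 x).
Proof.
move=> x0; have p0 := p_neq0 x0; have x1 : x != 0 by rewrite gt_eqF.
have d1 := is_deriv_mul (uppP1_deriv G0 x0) (I_deriv x0).
have d2 := is_deriv_mul (lowP1_deriv G0 x0) (J_deriv x0).
apply: is_deriv_eq (is_deriv_div _ (is_deriv_sub d1 d2) (xkp_deriv 1 x0)) _.
  by rewrite mulf_neq0// expf_neq0.
rewrite /stein_sol2 /lowP2 /uppP2.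
have W := wronskian1 a x.
(* The terms with [h1] are collected into the combination of [wronskian1], which reduces them to
   [h1 x / x]. *)
transitivity (- ((1 - P x) * I x + P x * J x) / (x ^+ 2 * p x)
   + h1 x * ((1 - P x) * E1 x + P x * F1 x) / (x ^+ 2 * p x)
   - (F1 x * I x - E1 x * J x) * (a + 1 - x) / (x ^+ 3 * p x)).
  by field; rewrite x1 p0.
by rewrite W; field; rewrite x1 p0.
Qed.

(** * Bounds for test functions with a bounded first derivative *)

Section LipschitzTest.
Hypothesis h1_le1 : forall x, 0 < x -> `|h1 x| <= 1.

Let I_le x : 0 < x -> `|I x| <= E1 x.
Proof.
apply: (abs_le_of_deriv_cvg0 I_deriv (lowP1_deriv G0)) => //; last exact: lowP1_cvg0.
move=> y y0; rewrite normrM (ger0_norm (gP_ge0 _ _)).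
by rewrite -[leRHS]mulr1 ler_wpM2l ?gP_ge0 ?h1_le1.
Qed.

Let J_le x : 0 < x -> `|J x| <= F1 x.
Proof.
apply: (abs_le_of_deriv_cvgy (m := 0) J_deriv (uppP1_deriv G0)) => //; last exact: uppP1_cvgy.
move=> y y0; rewrite normrM normrN (ger0_norm (gPbar_ge0 G0 y0)).
by rewrite -[leRHS]mulr1 ler_wpM2l ?gPbar_ge0 ?h1_le1.
Qed.

Let abs_lin (s t u v : R) (s' t' : R) : 0 <= s -> 0 <= t -> `|u| <= s' -> `|v| <= t' ->
  `|s * u + t * v| <= s * s' + t * t'.
Proof.
move=> s0 t0 us vt; apply: le_trans (ler_normD _ _) _.
by rewrite !normrM (ger0_norm s0) (ger0_norm t0) lerD// ler_wpM2l.
Qed.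

Lemma stein_sol_le1 x : 0 < x -> `|stein_sol x| <= 1.
Proof.
move=> x0; have xp := xkp_gt0 1 x0; rewrite expr1 in xp.
rewrite /stein_sol normrM normfV normrN (gtr0_norm xp) ler_pdivrMr// mul1r.
rewrite -wronskian1; apply: abs_lin; [exact: gPbar_ge0|exact: gP_ge0|exact: I_le|exact: J_le].
Qed.

(** The 2 is 1 + 1: one for [h1], one for the remainder term, which [wronskian2] evaluates at the
    extremal remainders. *)
Lemma stein_sol2_le2 x : 0 < x -> `|x * stein_sol2 x| <= 2.
Proof.
move=> x0; have xp := xkp_gt0 2 x0.
have -> : x * stein_sol2 x = h1 x - (F2 x * I x + E2 x * J x) / (x ^+ 2 * p x).
  by rewrite /stein_sol2; field; rewrite p_neq0// gt_eqF.
apply: le_trans (ler_normB _ _) _; rewrite -[2]/(1 + 1) lerD ?h1_le1//.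
rewrite normrM normfV (gtr0_norm xp) ler_pdivrMr// mul1r -wronskian2.
by apply: abs_lin; [exact: uppP2_ge0|exact: lowP2_ge0|exact: I_le|exact: J_le].
Qed.

(** Up to 1 the remainder bounds give [2 E1 F1 / (x ^ 2 p)], where [F1 <= a] and the other factor is
    monotone. Beyond 1 the Stein equation expresses [x f'] by [h] and [f], and the quadratic growth
    of [h] divided by [x] is linear. *)
Lemma stein_sol1_linear_growth : exists C, forall x, 0 < x -> `|stein_sol1 x| <= C * (1 + x).
Proof.
(* The derivative of [gM a] at 1; this derivative is nondecreasing, so [m] bounds it on (0, 1]. *)
pose m := E1 1 / (1 ^+ 2 * p 1).
have K0 : 0 <= K.
  by have := le_trans (normr_ge0 _) (hK ltr01); rewrite pmulr_lge0// ltr_pwDl// sqr_ge0.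
have m0 : 0 <= m by rewrite divr_ge0 ?lowP1_ge0// ltW// xkp_gt0.
exists (2 * m * a + (K + `|c| + a + 1)) => x x0.
have xp := xkp_gt0 2 x0.
case: (leP x 1) => x1.
  have le_m : E1 x / (x ^+ 2 * p x) <= m.
    apply: (@nondecr_of_deriv _ (fun x => E1 x / (x ^+ 2 * p x)) (fun x => E2 x / (x ^+ 3 * p x))) => //.
      by move=> y /andP[xy _]; apply: dgM_deriv => //; exact: lt_le_trans xy.
    move=> y /andP[xy _]; have y0 := lt_le_trans x0 xy.
    by rewrite divr_ge0 ?lowP2_ge0// ltW// xkp_gt0.
  have le_a : F1 x <= a.
    rewrite -subr_ge0; apply: (ge0_of_incr_cvg0 (f := fun x => a - F1 x) (df := fun x => 1 - P x)) x0.
    - move=> y y0; apply: is_deriv_eq (is_deriv_sub (is_deriv_cst a y) (uppP1_deriv G0 y0)) _.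
      by rewrite sub0r opprK.
    - by move=> y; exact: gPbar_ge0.
    - exact: uppP1_cvg0.
  have -> : stein_sol1 x = (F1 x * I x + E1 x * (- J x)) / (x ^+ 2 * p x).
    by rewrite /stein_sol1 mulrN.
  apply: (@le_trans _ _ (2 * m * a * (1 + 0))); last first.
    have t0 : 0 <= 2 * m * a by rewrite mulr_ge0 ?(ltW a0)// mulr_ge0.
    have t1 : 0 <= K + `|c| + a + 1 by rewrite !addr_ge0// (ltW a0).
    have t2 := mulr_ge0 t0 (ltW x0); have t3 := mulr_ge0 t1 (ltW x0).
    by rewrite addr0 mulr1 mulrDr mulr1 mulrDl; lra.
  rewrite normrM normfV (gtr0_norm xp).
  have := @abs_lin (F1 x) (E1 x) (I x) (- J x) (E1 x) (F1 x) (uppP1_ge0 G0 x0) (lowP1_ge0 a0 G0 x0) (I_le x0).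
  rewrite normrN => /(_ (J_le x0)) le1.
  apply: le_trans (ler_wpM2r _ le1) _; first by rewrite invr_ge0 ltW.
  rewrite (_ : _ / _ = 2 * (E1 x / (x ^+ 2 * p x)) * F1 x); last by ring.
  rewrite addr0 mulr1 ler_pM ?uppP1_ge0 ?mulr_ge0// ?ler_wpM2l//.
  - by rewrite lowP1_ge0.
  - by rewrite invr_ge0 (ltW xp).
(* From here on [1 < x], and the Stein equation is solved for its first order term. *)
clearbody m; have := stein_equation x0 => E.
have -> : stein_sol1 x = (h x - c - (a - x) * stein_sol x) / x.
  by rewrite -E; field; rewrite gt_eqF.
rewrite normrM normfV (gtr0_norm x0) ler_pdivrMr//.
have b1 : `|h x - c - (a - x) * stein_sol x| <= K * (1 + x ^+ 2) + `|c| + (a + x).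
  apply: le_trans (ler_normB _ _) _; apply: lerD.
    by apply: le_trans (ler_normB _ _) _; rewrite lerD// hK.
  rewrite normrM -[leRHS]mulr1 ler_pM ?stein_sol_le1//.
  by apply: le_trans (ler_normB _ _) _; rewrite !gtr0_norm.
apply: le_trans b1 _.
have c0 := normr_ge0 c.
have xx : 1 <= x ^+ 2 by rewrite expr_ge1// ltW.
have xa : 0 <= (x - 1) * a by rewrite mulr_ge0 ?subr_ge0 ?(ltW x1) ?(ltW a0).
have xm : 0 <= 2 * m * a * (1 + x) * x.
  by rewrite !mulr_ge0 ?addr_ge0 ?(ltW x0) ?(ltW a0).
have xK : 0 <= K * (x - 1) by rewrite mulr_ge0 ?subr_ge0 ?(ltW x1) ?(ltW a0).
have xc : 0 <= `|c| * (x - 1) by rewrite mulr_ge0 ?subr_ge0 ?(ltW x1) ?(ltW a0).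
have xxc : 0 <= `|c| * x ^+ 2 by rewrite mulr_ge0 ?sqr_ge0.
have xxa : 0 <= a * x ^+ 2 by rewrite mulr_ge0 ?sqr_ge0// (ltW a0).
have -> : (2 * m * a + (K + `|c| + a + 1)) * (1 + x) * x =
  2 * m * a * (1 + x) * x + (K * x + K * x ^+ 2 + (`|c| * x + `|c| * x ^+ 2) + (a * x + a * x ^+ 2) + (x + x ^+ 2)) by ring.
nra.
Qed.

End LipschitzTest.

(** * Bounds for test functions with a bounded second derivative *)

Section SmoothTest.
Variables (h2 : R -> R) (K1 : R).
Hypotheses (dh1 : forall x, 0 < x -> is_derive x 1 h1 (h2 x))
  (h2_le1 : forall x, 0 < x -> `|h2 x| <= 1)
  (h1K : forall x, 0 < x -> `|h1 x| <= K1 * (1 + x)).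

Let K1_ge0 : 0 <= K1.
Proof.
by have := le_trans (normr_ge0 _) (h1K ltr01); rewrite pmulr_lge0.
Qed.

(** One more integration by parts: the derivatives of these second remainders are [E1 h2] and
    [- F1 h2], hence the bounds [E2 / 2] and [F2 / 2]. *)
Definition stein_low2 x : R := E1 x * h1 x - I x.
Definition stein_upp2 x : R := J x - F1 x * h1 x.
Notation I2 := stein_low2.
Notation J2 := stein_upp2.

Definition stein_sol3 x : R := h2 x / x - (F3 x * I2 x + E3 x * J2 x) / (x ^+ 4 * p x).

Let I2_deriv x : 0 < x -> is_derive x 1 I2 (E1 x * h2 x).
Proof.
move=> x0; apply: is_deriv_eq (is_deriv_sub (is_deriv_mul (lowP1_deriv G0 x0) (dh1 x0)) (I_deriv x0)) _.
by ring.
Qed.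

Let J2_deriv x : 0 < x -> is_derive x 1 J2 (- F1 x * h2 x).
Proof.
move=> x0; apply: is_deriv_eq (is_deriv_sub (J_deriv x0) (is_deriv_mul (uppP1_deriv G0 x0) (dh1 x0))) _.
by ring.
Qed.

Let I2_cvg0 : I2 x @[x --> 0^'+] --> (0 : R).
Proof.
suff Ph0 : E1 x * h1 x @[x --> 0^'+] --> (0 : R).
  by refine (cvg_to_eq (cvg_sub Ph0 I_cvg0) _); rewrite subr0.
apply: (@cvg0_le _ _ _ _ _ E1 (K1 * (1 + 1))); last exact: lowP1_cvg0.
near=> x.
have x0 : 0 < x by near: x; exact: nbhs_right_gt.
have x1 : x <= 1 by near: x; exact: nbhs_right_le.
have e0 := lowP1_ge0 a0 G0 x0.
rewrite normrM (ger0_norm e0) mulrC ler_wpM2r//.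
by apply: le_trans (h1K x0) _; rewrite ler_wpM2l// lerD2l.
Unshelve. all: by end_near. Qed.

Let J2_cvgy : J2 x @[x --> +oo] --> (0 : R).
Proof.
suff Ph0 : F1 x * h1 x @[x --> +oo] --> (0 : R).
  by refine (cvg_to_eq (cvg_sub J_cvgy Ph0) _); rewrite subr0.
apply: (@cvg0_le _ _ _ _ _ (fun x => F1 x + x * F1 x) K1); last first.
  by refine (cvg_to_eq (cvg_add (uppP1_cvgy G0) (uppP1_lin_cvgy G0)) _); rewrite addr0.
near=> x.
have x0 : 0 < x by near: x; apply: nbhs_pinfty_gt; exact: num_real.
have e0 := uppP1_ge0 G0 x0.
have -> : K1 * (F1 x + x * F1 x) = F1 x * (K1 * (1 + x)) by ring.
by rewrite normrM (ger0_norm e0) ler_wpM2l// h1K.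
Unshelve. all: by end_near. Qed.

Let I2_le x : 0 < x -> `|I2 x| <= E2 x / 2.
Proof.
apply: (abs_le_of_deriv_cvg0 (g := fun x => E2 x / 2) (dg := E1) I2_deriv) => //.
- move=> y y0; apply: is_deriv_eq (is_deriv_mul (lowP2_deriv G0 y0) (is_deriv_cst 2^-1 y)) _.
  by field.
- move=> y y0; rewrite normrM (ger0_norm (lowP1_ge0 a0 G0 y0)).
  by rewrite -[leRHS]mulr1 ler_wpM2l ?lowP1_ge0 ?h2_le1.
- by refine (cvg_to_eq (cvgM (lowP2_cvg0 a0 G0) (cvg_cst (2^-1 : R))) _); rewrite mul0r.
Qed.

Let J2_le x : 0 < x -> `|J2 x| <= F2 x / 2.
Proof.
apply: (abs_le_of_deriv_cvgy (m := 0) (g := fun x => F2 x / 2) (dg := F1) J2_deriv) => //.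
- move=> y y0; apply: is_deriv_eq (is_deriv_mul (uppP2_deriv G0 y0) (is_deriv_cst 2^-1 y)) _.
  by field.
- move=> y y0; rewrite normrM normrN (ger0_norm (uppP1_ge0 G0 y0)).
  by rewrite -[leRHS]mulr1 ler_wpM2l ?uppP1_ge0 ?h2_le1.
- by refine (cvg_to_eq (cvgM (uppP2_cvgy G0) (cvg_cst (2^-1 : R))) _); rewrite mul0r.
Qed.

(** [wronskian2] writes [h1 / x] over the common denominator, where it merges with the first
    remainders. The first derivative of [h] thereby disappears into quantities controlled by the
    second one. *)
Let stein_sol2E x : 0 < x -> stein_sol2 x = (F2 x * I2 x - E2 x * J2 x) / (x ^+ 3 * p x).
Proof.
move=> x0; have p0 := p_neq0 x0; have x1 : x != 0 by rewrite gt_eqF.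
transitivity (h1 x * (F2 x * E1 x + E2 x * F1 x) / (x ^+ 3 * p x) - (F2 x * I x + E2 x * J x) / (x ^+ 3 * p x)).
  by rewrite wronskian2 /stein_sol2; field; rewrite x1 p0.
by rewrite /stein_low2 /stein_upp2; field; rewrite x1 p0.
Qed.

Lemma stein_sol2_deriv x : 0 < x -> is_derive x 1 stein_sol2 (stein_sol3 x).
Proof.
move=> x0; have p0 := p_neq0 x0; have x1 : x != 0 by rewrite gt_eqF.
apply: (is_deriv_pos (f := fun x => (F2 x * I2 x - E2 x * J2 x) / (x ^+ 3 * p x)) x0).
  by move=> y /stein_sol2E.
have d1 := is_deriv_mul (uppP2_deriv G0 x0) (I2_deriv x0).
have d2 := is_deriv_mul (lowP2_deriv G0 x0) (J2_deriv x0).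
apply: is_deriv_eq (is_deriv_div _ (is_deriv_sub d1 d2) (xkp_deriv 2 x0)) _.
  by rewrite mulf_neq0// expf_neq0.
transitivity (- 2 * (F1 x * I2 x + E1 x * J2 x) / (x ^+ 3 * p x)
   + h2 x * (F2 x * E1 x + E2 x * F1 x) / (x ^+ 3 * p x)
   - (F2 x * I2 x - E2 x * J2 x) * (a + 2 - x) / (x ^+ 4 * p x)).
  by field; rewrite x1 p0.
by rewrite wronskian2 /stein_sol3 /lowP3 /uppP3; field; rewrite x1 p0.
Qed.

Let abs_lin (s t u v : R) (s' t' : R) : 0 <= s -> 0 <= t -> `|u| <= s' -> `|v| <= t' ->
  `|s * u + t * v| <= s * s' + t * t'.
Proof.
move=> s0 t0 us vt; apply: le_trans (ler_normD _ _) _.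
by rewrite !normrM (ger0_norm s0) (ger0_norm t0) lerD// ler_wpM2l.
Qed.

(** Inserting [E2 / 2] and [F2 / 2] for the second remainders produces exactly [gC2 a x]; this is
    where the constant of the theorem originates. *)
Lemma stein_sol2_le_e_const x : 0 < x -> `|stein_sol2 x| <= e_const a.
Proof.
move=> x0; have xp := xkp_gt0 3 x0.
apply: le_trans (gC2_le_e_const a0 G0 x0); rewrite gC2E// stein_sol2E//.
rewrite normrM normfV (gtr0_norm xp) ler_pM2r ?invr_gt0//.
rewrite -mulrN.
have -> : F2 x * E2 x = F2 x * (E2 x / 2) + E2 x * (F2 x / 2) by field.
apply: abs_lin; rewrite ?normrN; [exact: uppP2_ge0|exact: lowP2_ge0|exact: I2_le|exact: J2_le].
Qed.

Lemma stein_sol3_le2 x : 0 < x -> `|x * stein_sol3 x| <= 2.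
Proof.
move=> x0; have xp := xkp_gt0 3 x0.
have -> : x * stein_sol3 x = h2 x - (F3 x * I2 x + E3 x * J2 x) / (x ^+ 3 * p x).
  by rewrite /stein_sol3; field; rewrite p_neq0// gt_eqF.
apply: le_trans (ler_normB _ _) _; rewrite -[2]/(1 + 1) lerD ?h2_le1//.
rewrite normrM normfV (gtr0_norm xp) ler_pdivrMr// mul1r.
have -> : x ^+ 3 * p x = F3 x * (E2 x / 2) + E3 x * (F2 x / 2).
  have := wronskian3 a x => W.
  transitivity ((2 * (x ^+ 3 * p x)) / 2); first by field.
  by rewrite -W; field.
by apply: abs_lin; [exact: uppP3_ge0|exact: lowP3_ge0|exact: I2_le|exact: J2_le].
Qed.

Lemma stein_sol1_linear_growth2 : exists C, forall x, 0 < x -> `|stein_sol1 x| <= C * (1 + x).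
Proof.
exists (`|stein_sol1 1| + e_const a) => x x0.
have e0 := le_trans (normr_ge0 _) (stein_sol2_le_e_const ltr01).
have := lipschitz_of_deriv stein_sol1_deriv stein_sol2_le_e_const x0 ltr01 => L.
have -> : stein_sol1 x = stein_sol1 1 + (stein_sol1 x - stein_sol1 1) by ring.
apply: le_trans (ler_normD _ _) _.
have x1 : `|x - 1| <= 1 + x.
  by apply: le_trans (ler_normB _ _) _; rewrite normr1 (gtr0_norm x0) addrC.
have := ler_wpM2l e0 x1.
have := normr_ge0 (stein_sol1 1).
nra.
Qed.

(** The test function is compared with [K1 (x + x ^ 2 / 2)], whose derivative dominates that of [h].
    The remainders of this polynomial are explicit, and the quotient that bounds the solution
    reduces to [K1 (x + a + 3) / 2]. *)
Lemma stein_sol_linear_growth : exists C, forall x, 0 < x -> `|stein_sol x| <= C * (1 + x).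
Proof.
exists (K1 * (a + 3)) => x x0; have xp := xkp_gt0 1 x0; rewrite expr1 in xp.
have Ile : `|I x| <= K1 * (E1 x + (x * E1 x - E2 x / 2)).
  apply: (abs_le_of_deriv_cvg0 (g := fun x => K1 * (E1 x + (x * E1 x - E2 x / 2)))
    (dg := fun x => K1 * (P x + x * P x)) I_deriv _ _ I_cvg0 _ x0).
  - move=> y y0.
    have d := is_deriv_add (lowP1_deriv G0 y0) (is_deriv_sub (is_deriv_mul (is_deriv_id y) (lowP1_deriv G0 y0))
      (is_deriv_mul (lowP2_deriv G0 y0) (is_deriv_cst 2^-1 y))).
    by apply: is_deriv_eq (is_deriv_mul (is_deriv_cst K1 y) d) _; field.
  - move=> y y0; rewrite normrM (ger0_norm (gP_ge0 _ _)).
    rewrite (_ : K1 * _ = P y * (K1 * (1 + y))); last by ring.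
    by rewrite ler_wpM2l ?gP_ge0 ?h1K.
  - have z0 : (x : R) @[x --> 0^'+] --> (0 : R) by apply: cvg_at_right_filter; exact: cvg_id.
    have l1 := lowP1_cvg0 a0 G0; have l2 := lowP2_cvg0 a0 G0.
    refine (cvg_to_eq (cvg_mull K1 (cvg_add l1 (cvg_sub (cvgM z0 l1) (cvgM l2 (cvg_cst (2^-1 : R)))))) _).
    by rewrite !mul0r subr0 addr0 mulr0.
have Jle : `|J x| <= K1 * (F1 x + (x * F1 x + F2 x / 2)).
  apply: (abs_le_of_deriv_cvgy (m := 0) (g := fun x => K1 * (F1 x + (x * F1 x + F2 x / 2)))
    (dg := fun x => K1 * ((1 - P x) + x * (1 - P x))) J_deriv _ _ J_cvgy _ x0).
  - move=> y y0.
    have d := is_deriv_add (uppP1_deriv G0 y0) (is_deriv_add (is_deriv_mul (is_deriv_id y) (uppP1_deriv G0 y0))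
      (is_deriv_mul (uppP2_deriv G0 y0) (is_deriv_cst 2^-1 y))).
    by apply: is_deriv_eq (is_deriv_mul (is_deriv_cst K1 y) d) _; field.
  - move=> y y0; rewrite normrM normrN (ger0_norm (gPbar_ge0 G0 y0)).
    rewrite (_ : K1 * _ = (1 - P y) * (K1 * (1 + y))); last by ring.
    by rewrite ler_wpM2l ?gPbar_ge0 ?h1K.
  - have l1 := uppP1_cvgy G0; have l2 := uppP2_cvgy G0.
    refine (cvg_to_eq (cvg_mull K1 (cvg_add l1 (cvg_add (uppP1_lin_cvgy G0) (cvgM l2 (cvg_cst (2^-1 : R)))))) _).
    by rewrite mul0r !addr0 mulr0.
rewrite /stein_sol normrM normfV normrN (gtr0_norm xp) ler_pdivrMr//.
apply: le_trans (abs_lin (gPbar_ge0 G0 x0) (gP_ge0 a x) Ile Jle) _.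
have -> : (1 - P x) * (K1 * (E1 x + (x * E1 x - E2 x / 2))) + P x * (K1 * (F1 x + (x * F1 x + F2 x / 2)))
  = K1 * ((x + a + 3) / 2) * (x * p x).
  by rewrite /lowP2 /uppP2 /lowP1 /uppP1; field.
rewrite ler_wpM2r ?(ltW xp)// -mulrA ler_wpM2l//.
by have := mulr_gt0 a0 x0; rewrite mulrDr mulr1 mulrDl; have := a0; have := x0; lra.
Qed.

End SmoothTest.

End SteinSolution.

(** * Gamma laws and independence *)

Section Density.
Context {R : realType}.
Notation mu := (@lebesgue_measure R).
Variables (nu : {finite_measure set (measurableTypeR R) -> \bar R}) (p : R -> R).
Hypotheses (p_ge0 : forall x, 0 <= p x)
  (intp : mu.-integrable [set: measurableTypeR R] (EFin \o p))
  (nuE : forall V, measurable V -> nu V = (\int[mu]_(x in V) (p x)%:E)%E).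

Let nu_dom : nu `<< mu.
Proof.
apply/null_content_dominatesP => A mA muA0; rewrite nuE//.
have iA : mu.-integrable A (EFin \o p) by apply: integrableS intp.
exact: null_set_integral mA (measurable_int _ iA) muA0.
Qed.

Let nu_density : ae_eq mu [set: measurableTypeR R]
  (Radon_Nikodym_SigmaFinite.f nu mu) (EFin \o p).
Proof.
apply: integral_ae_eq => //.
- exact: (Radon_Nikodym_SigmaFinite.f_integrable nu_dom).
- exact: measurable_int intp.
- move=> E _ mE; rewrite -Radon_Nikodym_SigmaFinite.f_integral//.
  exact: nuE.
Qed.

(** The values of [nu] on measurable sets identify its Radon-Nikodym derivative with [p] almost
    everywhere, and the change of variables formula follows. *)
Lemma ge0_integral_density (f : measurableTypeR R -> \bar R) :
  measurable_fun [set: measurableTypeR R] f -> (forall x, (0 <= f x)%E) ->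
  (\int[nu]_x f x = \int[mu]_x (f x * (p x)%:E))%E.
Proof.
move=> mf f0; rewrite -(Radon_Nikodym_SigmaFinite.change_of_variables nu_dom f0)//.
have mp := measurable_int _ intp.
have mg := measurable_int _ (Radon_Nikodym_SigmaFinite.f_integrable nu_dom).
apply: ae_eq_integral => //.
- exact: emeasurable_funM.
- exact: emeasurable_funM.
- exact: (ae_eqe_mul2l f nu_density).
Qed.

End Density.

(** * Expectations under a Gamma law *)

Section GammaLaw.
Context {R : realType} {d : measure_display} {T : measurableType d}
  (P : probability T R) (X : {RV P >-> R}) (a b : R).
Notation mu := (@lebesgue_measure R).
Hypotheses (a0 : 0 < a) (b0 : 0 < b) (law : has_gamma_law P X a b).
Notation p := (gamma_pdf a b).

Lemma gamma_law_mass : (\int[mu]_x (p x)%:E = 1)%E.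
Proof. by rewrite -[LHS]law// probability_setT. Qed.

(** If [Gamma a] were 0, its inverse and with it the density would be 0 everywhere, against total
    mass 1. Convergence of the Gamma integral is thus extracted from the existence of the law. *)
Lemma gamma_law_Gamma_gt0 : 0 < Gamma a.
Proof.
rewrite lt_neqAle Gamma_ge0 andbT; apply/eqP => G0.
have := gamma_law_mass; rewrite integral0_eq; first by case=> /eqP; rewrite eq_sym oner_eq0.
by move=> x _; rewrite /gamma_pdf -G0 mul0r invr0 !mul0r.
Qed.

Lemma gamma_law_integrableT : mu.-integrable [set: R] (EFin \o p).
Proof.
apply/integrableP; split.
  by apply/measurable_EFinP; exact: measurable_gamma_pdf.
under eq_integral.
  move=> x _; rewrite /= ger0_norm ?gamma_pdf_ge0//; over.
by rewrite gamma_law_mass ltry.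
Qed.

Lemma gamma_law_integrable : mu.-integrable `[0, +oo[ (EFin \o p).
Proof. by apply: integrableS gamma_law_integrableT. Qed.

Lemma gamma_law_le0 : P (X @^-1` `]-oo, 0]) = 0%E.
Proof.
have := law (measurable_itv `]-oo, (0:R)]); rewrite /distribution /pushforward => ->.
rewrite /gamma_prob integral0_eq// => x; rewrite /= in_itv/= => x0.
by rewrite gamma_pdf_le0.
Qed.

Lemma gamma_law_ge0_integral (f : R -> \bar R) :
  measurable_fun [set: R] f -> (forall x, (0 <= f x)%E) ->
  (\int[P]_w f (X w) = \int[mu]_x (f x * (p x)%:E))%E.
Proof.
move=> mf f0; pose Y : T -> measurableTypeR R := X.
have mY : measurable_fun [set: T] Y := measurable_funPT X.
pose Yf : {mfun T >-> measurableTypeR R} :=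
  HB.pack Y (isMeasurableFun.Build _ _ _ _ Y mY).
rewrite -(@ge0_integral_density _ (distribution P Yf) p gamma_law_integrableT law f mf f0).
by rewrite (ge0_integral_distribution Yf mf f0).
Qed.

Lemma gamma_law_integral (f : R -> R) : measurable_fun [set: R] f ->
  (\int[distribution P X]_x (f x)%:E = \int[mu]_x (f x * p x)%:E)%E.
Proof.
move=> mf; have mfE : measurable_fun [set: R] (EFin \o f).
  exact/measurable_EFinP.
have mp := measurable_funepos mfE; have mn := measurable_funeneg mfE.
rewrite integralE [RHS]integralE !(ge0_integral_distribution X)//.
rewrite (gamma_law_ge0_integral mp)// (gamma_law_ge0_integral mn)//.
congr (_ - _)%E; apply: eq_integral => x _.
  rewrite !funeposE /= -!EFin_max -EFinM maxr_pMl ?gamma_pdf_ge0//.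
  by rewrite mul0r.
rewrite !funenegE /= -!EFin_max -EFinM maxr_pMl ?gamma_pdf_ge0//.
by rewrite mul0r mulNr.
Qed.

Lemma gamma_law_square_integrable :
  P.-integrable [set: T] (fun w => (X w ^+ 2)%:E).
Proof.
have mX : measurable_fun [set: R] (fun x : R => (x ^+ 2)%:E).
  by apply/measurable_EFinP; exact: measurable_funX.
apply/integrableP; split; first exact: (measurableT_comp mX).
under eq_integral.
  move=> w _; rewrite /= ger0_norm ?sqr_ge0//; over.
rewrite (gamma_law_ge0_integral mX); last by move=> x; rewrite lee_fin sqr_ge0.
have := gamma_second_moment_integrable a0 b0 gamma_law_integrable.
have mD : measurable (`]0%R, +oo[%classic : set (measurableTypeR R)).
  exact: measurable_itv.
move=> /(integrable_mkcond _ mD) /integrableP[_]; apply: le_lt_trans.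
rewrite le_eqVlt; apply/orP; left; apply/eqP; apply: eq_integral => x _.
rewrite patchE; case: ifPn; last first.
  rewrite notin_setE /= in_itv/= andbT => /negP; rewrite -leNgt => x0.
  by rewrite gamma_pdf_le0// mule0 normr0.
by rewrite -EFinM /= ger0_norm// mulr_ge0 ?sqr_ge0 ?gamma_pdf_ge0.
Qed.

End GammaLaw.

(** * Joint laws and sums of independent variables *)

Section ProductLaw.
Context {R : realType} {d : measure_display} {T : measurableType d}
  (P : probability T R).

(* The event [Q] is carried along so that the law of a partial sum can be
   computed jointly with events of the remaining variables. *)
Lemma product_law (X Y : {RV P >-> R}) (Q : set T) : measurable Q ->
  (forall A B : set R, measurable A -> measurable B ->
    P (X @^-1` A `&` (Y @^-1` B `&` Q)) =
    (P (X @^-1` A) * (P (Y @^-1` B) * P Q))%E) ->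
  forall E : set (R * R), measurable E ->
  P ((fun w => (X w, Y w)) @^-1` E `&` Q) =
  ((distribution P X \x distribution P Y) E * P Q)%E.
Proof.
move=> mQ PQ E mE.
have mXY : measurable_fun [set: T] (fun w => (X w, Y w)).
  by apply: measurable_fun_pair; exact: measurable_funPT.
pose XY : {mfun T >-> (R * R)%type} :=
  HB.pack (fun w => (X w, Y w)) (isMeasurableFun.Build _ _ _ _ _ mXY).
have PQfin : P Q \is a fin_num by exact: fin_num_measure.
have [PQ0|PQ0] := eqVneq (P Q) 0%E.
  rewrite PQ0 mule0; apply/eqP; rewrite eq_le measure_ge0 andbT -PQ0.
  apply: le_measure; [|by rewrite inE|by move=> w []].
  rewrite inE; apply: measurableI => //.
  by rewrite -[X in measurable X]setTI; exact (mXY measurableT _ mE).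
have c0 : 0 <= (fine (P Q))^-1 by rewrite invr_ge0 fine_ge0.
(* The law of the pair conditioned on [Q]. It agrees with the product measure on rectangles, so
   uniqueness of product measures applies. *)
pose m' := mscale (NngNum c0) (pushforward (mrestr P mQ) XY).
have PQ1 : fine (P Q) != 0 by rewrite fine_eq0.
have -> : (distribution P X \x distribution P Y)%E E = m' mXY E.
  apply: product_measure_unique => // A B mA mB.
  rewrite /m' /= /mscale /= /pushforward /mrestr.
  rewrite (_ : _ `&` Q = X @^-1` A `&` (Y @^-1` B `&` Q)); last by rewrite setIA.
  rewrite PQ// /distribution /pushforward muleC -!muleA; congr (_ * _)%E.
  rewrite -[RHS]mule1; congr (_ * _)%E.
  by rewrite -[X in (X * _)%E](fineK PQfin) -EFinM mulfV.
rewrite /m' /= /mscale /= /pushforward /mrestr muleAC.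
by rewrite -[X in (_ * X * _)%E](fineK PQfin) -EFinM mulVf// mul1e.
Qed.

End ProductLaw.

Section IndependentSum.
Context {R : realType} {d : measure_display} {T : measurableType d}
  (P : probability T R) (I : finType) (X : I -> {RV P >-> R}).
Hypothesis indep : mutually_independent P X.

Let sumX (s : seq I) w : R := \sum_(i <- s) X i w.

Let measurable_sumX s : measurable_fun [set: T] (sumX s).
Proof. by apply: measurable_sum => i; exact: measurable_funPT. Qed.

Let preim (B : I -> set R) (J : {set I}) : set T :=
  \bigcap_(i in [set` J]) (X i @^-1` B i).

Let measurable_preim B J : (forall i, measurable (B i)) -> measurable (preim B J).
Proof.
move=> mB; apply: fin_bigcap_measurable => // i _.
by rewrite -[X in measurable X]setTI; exact: measurable_funPT.
Qed.

Let preimU1 (B : I -> set R) (J : {set I}) k (A : set R) : k \notin J ->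
  (X k @^-1` A) `&` preim B J =
  preim (fun i => if i == k then A else B i) (k |: J).
Proof.
move=> kJ; apply/seteqP; split=> [w [Ak BJ] i /= /setU1P[->|iJ]|w H].
- by rewrite eqxx.
- case: eqP => [ik|_]; last exact: BJ.
  by rewrite ik (negbTE kJ) in iJ.
- split; first by have := H k; rewrite /= eqxx; apply; exact: setU11.
  move=> i /= iJ; have := H i; rewrite /= ifN; first by apply; exact/setU1r.
  by apply: contraNneq kJ => <-.
Qed.

(** Induction on [s] for all [J] at once: when [k] joins the sum, the factorisation over rectangles
    uses the induction hypothesis with [k] moved into the set of separate events. *)
Lemma sum_indep (s : seq I) : uniq s ->
  forall (J : {set I}) (A : set R) (B : I -> set R),
  {in J, forall i, i \notin s} -> measurable A -> (forall i, measurable (B i)) ->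
  (P (sumX s @^-1` A `&`
      \bigcap_(i in [set` J]) (X i @^-1` B i)) =
   P (sumX s @^-1` A) *
   \prod_(i in J) P (X i @^-1` B i))%E.
Proof.
elim: s => [_ J A B _ mA mB|k s IH /= /andP[ks us] J A B Js mA mB].
  rewrite -/(preim B J).
  have [A0|A0] := pselect (A 0).
    rewrite (_ : sumX [::] @^-1` A = setT) ?setTI ?probability_setT ?mul1e.
      exact: indep.
    by apply/seteqP; split=> // w _ /=; rewrite /sumX big_nil.
  rewrite (_ : sumX [::] @^-1` A = set0) ?set0I ?measure0 ?mul0e//.
  by apply/seteqP; split=> // w /=; rewrite /sumX big_nil.
rewrite -/(preim B J).
pose Y : {RV P >-> R} := HB.pack (sumX s) (isMeasurableFun.Build _ _ _ _ _ (measurable_sumX s)).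
have kJ : k \notin J by apply/negP => /Js; rewrite inE eqxx.
have Js' : {in k |: J, forall i, i \notin s}.
  move=> i /setU1P[->//|/Js]; rewrite inE negb_or => /andP[]//.
have prod (A' B' : set R) (J' : {set I}) : k \notin J' -> {in J', forall i, i \notin s} ->
  measurable A' -> measurable B' ->
  P (X k @^-1` A' `&` (Y @^-1` B' `&` preim B J')) =
  (P (X k @^-1` A') * (P (Y @^-1` B') * P (preim B J')))%E.
  move=> kJ' J's mA' mB'.
  rewrite setICA preimU1// IH//; last 2 first.
    by move=> i /setU1P[->//|/J's].
    by move=> i; case: ifP.
  rewrite big_setU1//= eqxx muleCA; congr (_ * _)%E; congr (_ * _)%E.
  rewrite [RHS](indep J' mB); apply: eq_bigr => i iJ.
  by rewrite ifN//; apply: contraNneq kJ' => <-.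
have E_eq : sumX (k :: s) @^-1` A = (fun w => (X k w, Y w)) @^-1` ((fun z => z.1 + z.2) @^-1` A).
  by apply/seteqP; split=> w /=; rewrite /sumX big_cons.
have mE : measurable ((fun z : R * R => z.1 + z.2) @^-1` A).
  rewrite -[X in measurable X]setTI.
  have : measurable_fun [set: R * R] (fun z : R * R => z.1 + z.2) by exact: measurable_funD.
  exact.
have J0 : {in J, forall i, i \notin s}.
  by move=> i /Js; rewrite inE negb_or => /andP[].
rewrite E_eq (product_law (measurable_preim _ mB) (fun A' B' => @prod A' B' J kJ J0))//.
(* The same law with no side event identifies the product measure with the law of the longer sum. *)
have k0 : k \notin finset.set0 by rewrite inE.
have s0 : {in (finset.set0 : {set I}), forall i, i \notin s} by move=> i; rewrite inE.
have := product_law (measurable_preim _ mB) (fun A' B' => @prod A' B' finset.set0 k0 s0) mE.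
have -> : preim B finset.set0 = setT.
  by apply/seteqP; split => // w _ i /=; rewrite inE.
rewrite setIT probability_setT mule1 => <-.
by rewrite indep.
Qed.

End IndependentSum.

(** * The Stein identity *)

Section JointLaw.
Context {R : realType} {d : measure_display} {T : measurableType d}
  (P : probability T R) (X Y : {RV P >-> R}).
Hypothesis indXY : forall A B : set R, measurable A -> measurable B ->
    P (X @^-1` A `&` Y @^-1` B) = (P (X @^-1` A) * P (Y @^-1` B))%E.

(** [product_law] with the sure event turns the law of the pair into a product measure; then Fubini,
    with [X] innermost so that [Y] can be frozen. *)
Lemma integral_joint_law (f : R * R -> \bar R) : measurable_fun [set: R * R] f ->
  P.-integrable [set: T] (fun w => f (X w, Y w)) ->
  (\int[P]_w f (X w, Y w) =
   \int[distribution P Y]_y \int[distribution P X]_x f (x, y))%E.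
Proof.
move=> mf intf.
have mXY : measurable_fun [set: T] (fun w => (X w, Y w)).
  by apply: measurable_fun_pair; exact: measurable_funPT.
pose XY : {mfun T >-> (R * R)%type} :=
  HB.pack (fun w => (X w, Y w)) (isMeasurableFun.Build _ _ _ _ _ mXY).
have lawE E : measurable E -> distribution P XY E = (distribution P X \x distribution P Y)%E E.
  move=> mE; rewrite -[RHS]mule1 -(probability_setT P).
  rewrite -(product_law (P := P) (X := X) (Y := Y) measurableT)//; first by rewrite setIT.
  by move=> A B mA mB; rewrite setIT probability_setT mule1 indXY.
have intXY : (distribution P X \x distribution P Y)%E.-integrable [set: R * R] f.
  have := @integrable_pushforward _ _ _ _ _ XY mXY P setT f mf intf measurableT.
  move=> /integrableP[_ fin]; apply/integrableP; split=> //.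
  apply: le_lt_trans fin; rewrite le_eqVlt; apply/orP; left; apply/eqP.
  by apply: eq_measure_integral => A mA _; exact: esym (lawE _ mA).
rewrite (integral21_prod_meas1 intXY) -(integral_distribution (X := XY) mf intf).
by apply: eq_measure_integral => A mA _; exact: lawE.
Qed.

End JointLaw.

(** * Integration by parts in one variable *)

Section SteinIdentity.
Context {R : realType} {d : measure_display} {T : measurableType d}
  (P : probability T R).
Notation mu := (@lebesgue_measure R).

Lemma integrable_quadratic (D : set T) (G : T -> R) (f : T -> R) (K : R) :
  measurable D -> P.-integrable D (fun w => (G w ^+ 2)%:E) ->
  measurable_fun D f -> (forall w, D w -> `|f w| <= K * (1 + G w ^+ 2)) ->
  P.-integrable D (EFin \o f).
Proof.
move=> mD intG mf fK.
have i1 : P.-integrable D (fun w => (K%:E * (1%:E + (G w ^+ 2)%:E))%E).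
  apply: integrableZl => //; apply: integrableD => //.
  exact: finite_measure_integrable_cst.
apply: le_integrable i1 => //; first exact/measurable_EFinP.
move=> w Dw; rewrite /= lee_fin.
by apply: le_trans (fK _ Dw) _; exact: ler_norm.
Qed.

Variables (X Y : {RV P >-> R}) (a b : R) (D : set T).
Hypotheses (a0 : 0 < a) (b0 : 0 < b) (law : has_gamma_law P X a b)
  (indXY : forall A B : set R, measurable A -> measurable B ->
    P (X @^-1` A `&` Y @^-1` B) = (P (X @^-1` A) * P (Y @^-1` B))%E)
  (mD : measurable D) (PD : P (~` D) = 0%E)
  (X_gt0 : forall w, D w -> 0 < X w) (Y_ge0 : forall w, D w -> 0 <= Y w)
  (intG : P.-integrable [set: T] (fun w => ((X w + Y w) ^+ 2)%:E)).
Notation p := (gamma_pdf a b).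

Variables (g g1 : R -> R) (C : R).
Hypotheses (dg : forall x : R, 0 < x -> is_derive x 1 g (g1 x))
  (cg1 : forall x : R, 0 < x -> {for x, continuous g1})
  (gC : forall x : R, 0 < x -> `|g x| <= C * (1 + x))
  (g1C : forall x : R, 0 < x -> `|x * g1 x| <= C * (1 + x ^+ 2)).

Let C_ge0 : 0 <= C.
Proof.
by have := le_trans (normr_ge0 _) (gC ltr01); rewrite pmulr_lge0.
Qed.

Let phi (z : R * R) : R :=
  (z.1 - a * b) * g (z.1 + z.2) - b * z.1 * g1 (z.1 + z.2).

(** The second coordinate may vanish: it stands for the sum of the other variables, which is empty
    when there is only one. *)
Let Q : set (R * R) := [set x : R | 0 < x] `*` [set y : R | 0 <= y].

Let mQ : measurable Q.
Proof.
have E1 : [set x : R | 0 < x] = `]0, +oo[%classic.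
  by apply/seteqP; split=> x /=; rewrite in_itv/= andbT.
have E2 : [set x : R | 0 <= x] = `[0, +oo[%classic.
  by apply/seteqP; split=> x /=; rewrite in_itv/= andbT.
by rewrite /Q E1 E2; apply: measurableX; exact: measurable_itv.
Qed.

Let mphi : measurable_fun Q phi.
Proof.
have mpos (k : R -> R) : (forall x : R, 0 < x -> {for x, continuous k}) ->
    measurable_fun Q (fun z => k (z.1 + z.2)).
  move=> ck; apply: (@measurable_comp _ _ _ _ _ _ (`]0, +oo[%classic : set R)).
  - exact: measurable_itv.
  - move=> _ [z [/= z1 z2] <-]; rewrite /= in_itv/= andbT; exact: ltr_pwDl.
  - exact: measurable_pos.
  - by apply: measurable_funTS; exact: measurable_funD.
have m1 : measurable_fun Q (fun z : R * R => z.1).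
  by apply: measurable_funTS; exact: measurable_fst.
apply: measurable_funB; apply: measurable_funM.
- by apply: measurable_funB => //; exact: measurable_cst.
- by apply: mpos => x /dg; exact: is_deriv_continuous.
- by apply: measurable_funM => //; exact: measurable_cst.
- exact: mpos.
Qed.

Let phi_le (x y : R) : 0 < x -> 0 <= y ->
  `|phi (x, y)| <= (C * (2 + 2 * a * b + b)) * (1 + (x + y) ^+ 2).
Proof.
move=> x0 y0; set s := x + y; have s0 : 0 < s by exact: ltr_pwDl.
have xs : x <= s by rewrite lerDl.
have ab := mulr_ge0 (ltW a0) (ltW b0).
apply: le_trans (ler_normB _ _) _.
have t1 : `|(x - a * b) * g s| <= (s + a * b) * (C * (1 + s)).
  rewrite normrM ler_pM ?gC//; apply: le_trans (ler_normB _ _) _.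
  by rewrite (gtr0_norm x0) (ger0_norm ab) lerD2r.
have t2 : `|b * x * g1 s| <= b * (C * (1 + s ^+ 2)).
  rewrite -mulrA normrM (gtr0_norm b0) ler_wpM2l ?(ltW b0)//.
  apply: le_trans (g1C s0); rewrite !normrM ler_wpM2r//.
  by rewrite (gtr0_norm x0) (gtr0_norm s0).
apply: le_trans (lerD t1 t2) _.
have -> : (s + a * b) * (C * (1 + s)) + b * (C * (1 + s ^+ 2)) =
   C * ((s + a * b) * (1 + s) + b * (1 + s ^+ 2)) by ring.
rewrite -mulrA ler_wpM2l//.
have := sqr_ge0 (s - 1); have := mulr_ge0 ab (sqr_ge0 (s - 1)).
rewrite !expr2; nra.
Qed.

(** For fixed [y] the integrand is the derivative in [x] of [- b x p(x) g(x + y)], and the linear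
    growth of [g] makes this primitive vanish at both ends. *)
Let inner0 (y : R) : 0 <= y ->
  (\int[mu]_(x in `]0%R, +oo[) (phi (x, y) * p x)%:E = 0)%E.
Proof.
move=> y0; have G0 := gamma_law_Gamma_gt0 law.
have ip := gamma_law_integrable b0 law.
pose F x := - b * (x * p x * g (x + y)).
have cphi (x : R) : 0 < x -> {for x, continuous (fun x => phi (x, y))}.
  move=> x0; have s0 : 0 < x + y by exact: ltr_pwDl.
  have cs : {for x, continuous (fun x => x + y)}.
    by apply: continuousD; [exact: cvg_id|exact: cvg_cst].
  have cg : {for x, continuous (fun x => g (x + y))}.
    apply: (@continuous_comp _ _ _ (fun x => x + y) g) => //.
    exact: is_deriv_continuous (dg s0).
  have cg' : {for x, continuous (fun x => g1 (x + y))}.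
    by apply: (@continuous_comp _ _ _ (fun x => x + y) g1) => //; exact: cg1.
  apply: continuousB; apply: continuousM => //.
    by apply: continuousB; [exact: cvg_id|exact: cvg_cst].
  by apply: continuousM; [exact: cvg_cst|exact: cvg_id].
have dF (x : R) : 0 < x -> is_derive x 1 F (phi (x, y) * p x).
  move=> x0; have s0 : 0 < x + y by exact: ltr_pwDl.
  have ds : is_derive x 1 (fun x => x + y) 1.
    by apply: is_deriv_eq (is_deriv_add (is_deriv_id x) (is_deriv_cst y x)) _; rewrite addr0.
  have dgs := is_deriv_comp (g := fun x => x + y) (dg s0) ds.
  have dp := is_deriv_mul (is_deriv_id x) (gamma_pdf_deriv a b0 x0).
  apply: is_deriv_eq (is_deriv_mul (is_deriv_cst (- b) x) (is_deriv_mul dp dgs)) _.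
  by rewrite /phi /=; field; rewrite !gt_eqF.
(* The last factor comes from [1 + (x + y)^2 <= 2 (1 + y^2) (1 + x^2)]. *)
pose K := (C * (2 + 2 * a * b + b)) * (2 * (1 + y ^+ 2)).
have iphi : mu.-integrable `]0, +oo[ (EFin \o (fun x => phi (x, y) * p x)).
  have := @gamma_integrable_dominated R a b a0 b0 ip (fun x => phi (x, y)) K.
  move=> H; have := H (measurable_pos cphi) => {}H.
  apply: integrableS (H _) => //; first by apply: subset_itvr; rewrite bnd_simp.
  move=> x x0; apply: le_trans (phi_le x0 y0) _.
  rewrite /K -[leRHS]mulrA; apply: ler_wpM2l.
    by rewrite mulr_ge0// !addr_ge0 ?mulr_ge0 ?(ltW a0) ?(ltW b0).
  have := sqr_ge0 (x - y); have := mulr_ge0 (sqr_ge0 x) (sqr_ge0 y).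
  have := sqr_ge0 x; have := sqr_ge0 y.
  by rewrite !expr2; nra.
have gs_le (x : R) : 0 < x -> `|g (x + y)| <= C * (1 + y + x).
  move=> x0; rewrite -addrA [y + x]addrC; apply: gC; exact: ltr_pwDl.
have F_le (x : R) : 0 < x -> `|F x| <= (b * C) * ((1 + y) * (x * p x) + x ^+ 2 * p x).
  move=> x0; rewrite normrM normrN (gtr0_norm b0) -[leRHS]mulrA ler_wpM2l ?(ltW b0)//.
  have xp : 0 <= x * p x by rewrite mulr_ge0 ?gamma_pdf_ge0// ltW.
  rewrite normrM (ger0_norm xp).
  apply: le_trans (ler_wpM2l xp (gs_le _ x0)) _.
  by rewrite le_eqVlt; apply/orP; left; apply/eqP; ring.
have F0 : F x @[x --> 0^'+] --> (0 : R).
  apply: (@cvg0_le _ _ _ _ _ (fun x => (1 + y) * (x * p x) + x ^+ 2 * p x) (b * C)).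
    near=> x; apply: F_le; near: x; exact: nbhs_right_gt.
  refine (cvg_to_eq (cvg_add (cvg_mull (1 + y) (gamma_pdf_cvg0 a0 b0 0)) (gamma_pdf_cvg0 a0 b0 1)) _).
  by rewrite mulr0 addr0.
have Fy : F x @[x --> +oo] --> (0 : R).
  apply: (@cvg0_le _ _ _ _ _ (fun x => (1 + y) * (x * p x) + x ^+ 2 * p x) (b * C)).
    near=> x; apply: F_le; near: x; apply: nbhs_pinfty_gt; exact: num_real.
  refine (cvg_to_eq (cvg_add (cvg_mull (1 + y) (gamma_pdf_cvgy a b0 1)) (gamma_pdf_cvgy a b0 2)) _).
  by rewrite mulr0 addr0.
rewrite (FTC_pos iphi _ dF F0 Fy) ?subrr// => x x0.
by apply: continuousM; [exact: cphi|exact: gamma_pdf_continuous].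
Unshelve. all: by end_near. Qed.

Let mphiQ : measurable_fun [set: R * R] (phi \_ Q).
Proof. exact/(measurable_restrictT _ mQ). Qed.

Let inner_law0 (y : R) : (\int[distribution P X]_x ((phi \_ Q) (x, y))%:E = 0)%E.
Proof.
have mx : measurable_fun [set: R] (fun x => (phi \_ Q) (x, y)).
  exact: measurable_fun_pair1.
rewrite (gamma_law_integral b0 law mx).
have [y0|y0] := leP 0 y; last first.
  rewrite integral0_eq// => x _; rewrite patchE memNset ?mul0r//.
  by move=> [_ /=]; rewrite leNgt y0.
rewrite -[RHS](inner0 y0) [RHS]integral_mkcond; apply: eq_integral => x _.
rewrite !patchE; case: ifPn => xQ; case: ifPn => x0 //.
- by exfalso; move: xQ x0; rewrite !inE notin_setE /= in_itv/= andbT => -[].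
- by exfalso; move: xQ x0; rewrite notin_setE inE /= in_itv/= andbT => H x0; apply: H.
- by rewrite mul0r.
Qed.

(** Extending [phi] by 0 outside [Q] makes it measurable on the whole plane. On [D] the pair lies in
    [Q], and off [D] there is no mass, so the joint law reduces the claim to the inner integrals. *)
Lemma stein_identity :
  (\int[P]_(w in D) ((X w - a * b) * g (X w + Y w) -
     b * X w * g1 (X w + Y w))%:E = 0)%E.
Proof.
pose f (z : R * R) := ((phi \_ Q) z)%:E.
have mf : measurable_fun [set: R * R] f by exact/measurable_EFinP.
have mXY : measurable_fun [set: T] (fun w => (X w, Y w)).
  by apply: measurable_fun_pair; exact: measurable_funPT.
have intf : P.-integrable [set: T] (fun w => f (X w, Y w)).
  apply: (@integrable_quadratic setT (fun w => X w + Y w) (fun w => (phi \_ Q) (X w, Y w)) (C * (2 + 2 * a * b + b))) => //.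
    exact: measurableT_comp.
  move=> w _; rewrite patchE; case: ifPn => [|_].
    by rewrite inE => -[/= x0 y0]; exact: phi_le.
  rewrite -[point]/(0 : R) normr0 mulr_ge0//; last by rewrite addr_ge0 ?sqr_ge0.
  by rewrite mulr_ge0// !addr_ge0 ?mulr_ge0 ?(ltW a0) ?(ltW b0).
transitivity (\int[P]_w f (X w, Y w))%E; last first.
  rewrite (integral_joint_law indXY mf intf) integral0_eq// => y _.
  exact: inner_law0.
rewrite [RHS](negligible_integral (measurableC mD) measurableT intf PD) setTD setCK.
apply: eq_integral => w; rewrite inE => Dw; rewrite /f patchE mem_set//.
by split; [exact: X_gt0|exact: Y_ge0].
Qed.

End SteinIdentity.

(** * Stein expansion for sums of independent Gamma variables *)

Section SteinSum.
Context {R : realType} {d : measure_display} {T : measurableType d}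
  (P : probability T R) (N : nat) (alphas betas : 'I_N -> R)
  (G : 'I_N -> {RV P >-> R}) (GN : {RV P >-> R}) (alpha beta : R).
Hypotheses (halphas : forall i, 0 < alphas i) (hbetas : forall i, 0 < betas i)
  (hind : mutually_independent P G)
  (hG : forall i, has_gamma_law P (G i) (alphas i) (betas i))
  (hGN : forall w : T, GN w = \sum_(i < N) G i w)
  (hN : (0 < N)%N)
  (halpha : 0 < alpha) (hbeta : 0 < beta)
  (hmean : alpha * beta = \sum_(i < N) alphas i * betas i)
  (hvar : alpha * beta ^+ 2 = \sum_(i < N) alphas i * betas i ^+ 2).

Lemma A_max_ge0 : 0 <= A_max betas beta.
Proof.
rewrite /A_max; elim/big_ind: _ => // [x y x0 y0|i _]; first by rewrite le_max x0.
by rewrite mulr_ge0// ltW.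
Qed.

Lemma B_max_ge0 : 0 <= B_max betas beta.
Proof.
rewrite /B_max; elim/big_ind: _ => // [x y x0 y0|i _]; first by rewrite le_max x0.
by rewrite mulr_ge0// sqr_ge0.
Qed.

Let diffE i : `|beta - betas i| = beta * `|betas i / beta - 1|.
Proof.
rewrite -[X in X * _](gtr0_norm hbeta) -normrM mulrBr mulrCA divff ?gt_eqF// !mulr1.
exact: distrC.
Qed.

Lemma beta_diff_le i : `|(beta - betas i) * betas i| <= beta * A_max betas beta.
Proof.
rewrite normrM (gtr0_norm (hbetas i)) diffE -mulrA ler_pM2l//.
exact: (@le_bigmax_cond _ _ _ _ i xpredT).
Qed.

Lemma beta_diff_sqr_le i : `|(beta - betas i) * betas i ^+ 2| <= beta * B_max betas beta.
Proof.
rewrite normrM (ger0_norm (sqr_ge0 (betas i))) diffE -mulrA ler_pM2l//.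
exact: (@le_bigmax_cond _ _ _ _ i xpredT).
Qed.

(** Solutions of the Stein equation are controlled on (0, +oo) only, so expectations are taken over
    this event of probability one. *)
Definition all_pos : set T := [set w | forall i, 0 < G i w].
Notation D := all_pos.

Let DE : D = \bigcap_(i in [set` (finset.setT : {set 'I_N})]) (G i @^-1` `]0, +oo[).
Proof.
apply/seteqP; split=> [w Dw i _ /=|w Dw i]; first by rewrite in_itv/= andbT; exact: Dw.
by have := Dw i; rewrite /= in_itv/= andbT; apply; rewrite inE.
Qed.

Lemma measurable_all_pos : measurable D.
Proof.
rewrite DE; apply: fin_bigcap_measurable => // i _.
by rewrite -[X in measurable X]setTI; exact: measurable_funPT.
Qed.
Let mD := measurable_all_pos.

Lemma all_pos_setC : P (~` D) = 0%E.
Proof.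
rewrite probability_setC// DE hind//.
rewrite big1 ?subee// => i _.
have m0 : measurable (G i @^-1` `]-oo, 0]).
  by rewrite -[X in measurable X]setTI; exact: measurable_funPT.
rewrite (_ : _ @^-1` _ = ~` (G i @^-1` `]-oo, 0])).
  by rewrite probability_setC// (gamma_law_le0 (hG i)) sube0.
apply/seteqP; split=> w /=; rewrite !in_itv/= andbT; first by rewrite leNgt => ->.
by move/negP; rewrite -ltNge.
Qed.
Let PD := all_pos_setC.

Lemma GN_gt0 w : D w -> 0 < GN w.
Proof.
move=> Dw; rewrite hGN (bigD1 (Ordinal hN))//= ltr_pwDl ?Dw//.
by apply: sumr_ge0 => i _; rewrite ltW.
Qed.

Let G_le_GN i w : D w -> G i w <= GN w.
Proof.
move=> Dw; rewrite hGN (bigD1 i)//= lerDl.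
by apply: sumr_ge0 => j _; rewrite ltW.
Qed.

Lemma GN_square_integrable : P.-integrable [set: T] (fun w => (GN w ^+ 2)%:E).
Proof.
have iS (s : seq 'I_N) :
    P.-integrable [set: T] (fun w => ((\sum_(i <- s) G i w) ^+ 2)%:E).
  elim: s => [|k s IH].
    apply: (@eq_integrable _ _ _ _ _ measurableT (cst 0%E)); last exact: integrable0.
    by move=> w _; rewrite big_nil expr0n.
  have mS (l : seq 'I_N) : measurable_fun [set: T] (fun w => \sum_(i <- l) G i w).
    by apply: measurable_sum => i; exact: measurable_funPT.
  have i2 := integrableZl measurableT 2
    (integrableD measurableT (gamma_law_square_integrable (halphas k) (hbetas k) (hG k)) IH).
  apply: le_integrable i2 => //.
    by apply/measurable_EFinP; apply: measurable_funX; exact: mS.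
  move=> w _; rewrite big_cons /= lee_fin.
  apply: le_trans (ler_norm _); rewrite ger0_norm ?sqr_ge0//.
  have := sqr_ge0 (G k w - \sum_(j <- s) G j w).
  by rewrite sqrrB sqrrD; lra.
have := iS (index_enum 'I_N).
by under eq_fun do rewrite -hGN.
Qed.

Notation E f := (\int[P]_(w in D) f w).

Let integrable_D (f : T -> R) (K : R) : measurable_fun D f ->
  (forall w, D w -> `|f w| <= K * (1 + GN w ^+ 2)) ->
  P.-integrable D (EFin \o f).
Proof.
move=> mf fK; apply: (integrable_quadratic mD _ mf fK).
by apply: integrableS GN_square_integrable.
Qed.

Let measurable_test (g : R -> R) : (forall x : R, 0 < x -> {for x, continuous g}) ->
  measurable_fun D (fun w => g (GN w)).
Proof.
move=> cg; apply: (@measurable_comp _ _ _ _ _ _ (`]0, +oo[%classic : set R)).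
- exact: measurable_itv.
- by move=> _ [w Dw <-]; rewrite /= in_itv/= andbT GN_gt0.
- exact: measurable_pos.
- by apply: measurable_funTS; exact: measurable_funPT.
Qed.

Let measurable_G i : measurable_fun D (G i).
Proof. by apply: measurable_funTS; exact: measurable_funPT. Qed.

Let linear_quadratic (C x : R) : 0 < x -> 0 <= C ->
  C * (1 + x) <= (2 * C) * (1 + x ^+ 2) /\ x * (C * (1 + x)) <= (2 * C) * (1 + x ^+ 2).
Proof.
move=> x0 C0; split.
  rewrite [2 * C]mulrC -mulrA ler_wpM2l//.
  by have := sqr_ge0 (x - 1); have := sqr_ge0 x; rewrite !expr2; nra.
rewrite mulrCA [2 * C]mulrC -mulrA ler_wpM2l//.
by have := sqr_ge0 (x - 1); have := sqr_ge0 x; rewrite !expr2; nra.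
Qed.

Let growth_ge0 (g : R -> R) (C : R) :
  (forall x : R, 0 < x -> `|g x| <= C * (1 + x)) -> 0 <= C.
Proof.
by move=> gC; have := le_trans (normr_ge0 _) (gC _ ltr01); rewrite pmulr_lge0.
Qed.

Section Growth.
Variables (g : R -> R) (C : R).
Hypotheses (cg : forall x : R, 0 < x -> {for x, continuous g})
  (gC : forall x : R, 0 < x -> `|g x| <= C * (1 + x)).

Let C0 : 0 <= C := growth_ge0 gC.

Lemma integrable_test : P.-integrable D (EFin \o (fun w => g (GN w))).
Proof.
apply: (@integrable_D _ (2 * C)); first exact: measurable_test.
move=> w /GN_gt0 x0; apply: le_trans (gC x0) _.
by have [] := linear_quadratic x0 C0.
Qed.

Lemma integrable_Gtest i : P.-integrable D (EFin \o (fun w => G i w * g (GN w))).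
Proof.
apply: (@integrable_D _ (2 * C)).
  by apply: measurable_funM => //; exact: measurable_test.
move=> w Dw; have x0 := GN_gt0 Dw; rewrite normrM (gtr0_norm (Dw i)).
apply: le_trans (ler_pM _ _ (G_le_GN i Dw) (gC x0)) _ => //; first exact: ltW.
by have [] := linear_quadratic x0 C0.
Qed.

End Growth.

Lemma integrable_Gsteep (g1 : R -> R) (C : R) i :
  (forall x : R, 0 < x -> {for x, continuous g1}) ->
  (forall x : R, 0 < x -> `|x * g1 x| <= C * (1 + x ^+ 2)) ->
  P.-integrable D (EFin \o (fun w => G i w * g1 (GN w))).
Proof.
move=> cg g1C; apply: (@integrable_D _ C).
  by apply: measurable_funM => //; exact: measurable_test.
move=> w Dw; have x0 := GN_gt0 Dw; apply: le_trans (g1C _ x0).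
by rewrite !normrM ler_wpM2r// (gtr0_norm (Dw i)) (gtr0_norm x0) G_le_GN.
Qed.

(** The Stein identity for [G i] with [Y] the sum of all other variables; their independence is
    [sum_indep] with the single side event on [G i]. *)
Lemma stein_step i (g g1 : R -> R) (C : R) :
  (forall x : R, 0 < x -> is_derive x 1 g (g1 x)) ->
  (forall x : R, 0 < x -> {for x, continuous g1}) ->
  (forall x : R, 0 < x -> `|g x| <= C * (1 + x)) ->
  (forall x : R, 0 < x -> `|x * g1 x| <= C * (1 + x ^+ 2)) ->
  E (fun w => G i w * g (GN w)) - alphas i * betas i * E (fun w => g (GN w)) =
  betas i * E (fun w => G i w * g1 (GN w)).
Proof.
move=> dg cg1 gC g1C.
have cg (x : R) (x0 : 0 < x) : {for x, continuous g} := is_deriv_continuous (dg x x0).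
pose s := [seq j <- index_enum 'I_N | j != i].
have mY : measurable_fun [set: T] (fun w => \sum_(j <- s) G j w).
  by apply: measurable_sum => j; exact: measurable_funPT.
pose Y : {RV P >-> R} := HB.pack (fun w => \sum_(j <- s) G j w)
  (isMeasurableFun.Build _ _ _ _ _ mY).
have GNE w : GN w = G i w + Y w.
  by rewrite hGN (bigD1 i)//= /Y/= /s big_filter.
have indXY (A B : set R) : measurable A -> measurable B ->
    P (G i @^-1` A `&` Y @^-1` B) = (P (G i @^-1` A) * P (Y @^-1` B))%E.
  move=> mA mB; rewrite setIC muleC.
  have us : uniq s by rewrite filter_uniq// index_enum_uniq.
  have is_ : {in [set i]%SET, forall j, j \notin s}.
    by move=> j; rewrite inE => /eqP ->; rewrite mem_filter eqxx.
  have := sum_indep hind us is_ mB (fun=> mA).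
  rewrite big_set1 => <-; congr (P (_ `&` _)).
  apply/seteqP; split=> [w Aw j /=|w Aw]; first by rewrite inE => /eqP ->.
  by apply: (Aw i); rewrite /= inE.
have Y_ge0 w : D w -> 0 <= Y w.
  by move=> Dw; rewrite /Y/=; apply: sumr_ge0 => j _; exact: ltW.
have intG : P.-integrable [set: T] (fun w => ((G i w + Y w) ^+ 2)%:E).
  by have := GN_square_integrable; under eq_fun do rewrite GNE.
have := stein_identity (halphas i) (hbetas i) (hG i) indXY mD PD
  (fun w Dw => Dw i) Y_ge0 intG dg cg1 gC g1C.
under eq_integral do rewrite -GNE.
move=> S0.
have iGg := integrable_Gtest cg gC i.
have ig := integrable_test cg gC.
have iGg1 := integrable_Gsteep i cg1 g1C.
have iag : P.-integrable D (EFin \o (fun w => alphas i * betas i * g (GN w))).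
  exact: (integrableZl mD (alphas i * betas i) ig).
have ibg : P.-integrable D (EFin \o (fun w => betas i * (G i w * g1 (GN w)))).
  exact: (integrableZl mD (betas i) iGg1).
rewrite -(RintegralZl (alphas i * betas i) mD ig) -(RintegralZl (betas i) mD iGg1) -(RintegralB mD iGg iag).
apply/eqP; rewrite -subr_eq0 -RintegralB//; last first.
  exact: (integrableB mD iGg iag).
apply/eqP; rewrite /Rintegral -[RHS]/(fine 0%E) -[in RHS]S0; congr fine.
apply: eq_integral => w _; congr EFin; ring.
Qed.

Let PD1 : P D = 1%E.
Proof.
by have := PD; rewrite probability_setC// => /eqP; rewrite sube_eq ?fin_num_measure// ?add0e => // /eqP.
Qed.

Let E_cst (c : R) : E (fun=> c) = c.
Proof.
by rewrite [LHS](Rintegral_cst _ mD) -[RHS]mulr1; congr (_ * _); exact: (congr1 fine PD1).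
Qed.

Let E_norm_le (q : T -> R) (M : R) : P.-integrable D (EFin \o q) ->
  (forall w, D w -> `|q w| <= M) -> `|E q| <= M.
Proof.
move=> iq qM; rewrite -(E_cst M); apply: le_trans (le_normr_Rintegral mD iq) _.
apply: le_Rintegral => //; first exact: integrable_norm.
by apply: finite_measure_integrable_cst.
Qed.

Lemma Rintegral_weighted_sum (k : 'I_N -> R) (q : R -> R) :
  (forall i, P.-integrable D (EFin \o (fun w => G i w * q (GN w)))) ->
  P.-integrable D (EFin \o (fun w => \sum_i k i * (G i w * q (GN w)))) /\
  E (fun w => \sum_i k i * (G i w * q (GN w))) = \sum_i k i * E (fun w => G i w * q (GN w)).
Proof.
move=> iq.
have iZ i : P.-integrable D (fun w => (k i * (G i w * q (GN w)))%:E).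
  exact: (integrableZl mD (k i) (iq i)).
split.
  apply: (@eq_integrable _ _ _ _ _ mD (fun w => (\sum_i (k i * (G i w * q (GN w)))%:E)%E)).
    by move=> w _; rewrite sumEFin.
  exact: integrable_sum.
rewrite /Rintegral; under eq_integral do rewrite -sumEFin.
rewrite integral_sum// -sum_fine; last by move=> i _; exact: integrable_fin_num.
by apply: eq_bigr => i _; rewrite -RintegralZl.
Qed.

(** The variables are positive, so pulling out the largest weight leaves
    [sum_i G_i |q(GN)| = GN |q(GN)| <= M] pointwise. The bound therefore involves a maximum over [i]
    and does not grow with [N]. *)
Lemma weighted_sum_le (k : 'I_N -> R) (q : R -> R) (K M : R) : 0 <= K ->
  (forall i, `|k i| <= K) -> (forall x : R, 0 < x -> {for x, continuous q}) ->
  (forall x : R, 0 < x -> `|x * q x| <= M) ->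
  `|\sum_i k i * E (fun w => G i w * q (GN w))| <= K * M.
Proof.
move=> K0 kK cq qM.
have M0 : 0 <= M by apply: le_trans (qM _ ltr01); exact: normr_ge0.
have iq i : P.-integrable D (EFin \o (fun w => G i w * q (GN w))).
  apply: (@integrable_Gsteep q M i cq) => x x0; apply: le_trans (qM _ x0) _.
  by rewrite ler_peMr// lerDl sqr_ge0.
have [is_ <-] := Rintegral_weighted_sum k iq.
apply: E_norm_le is_ _ => w Dw; apply: le_trans (ler_norm_sum _ _ _) _.
apply: (@le_trans _ _ (\sum_i K * (G i w * `|q (GN w)|))).
  apply: ler_sum => i _; rewrite !normrM (gtr0_norm (Dw i)) ler_wpM2r//.
  by rewrite mulr_ge0// ltW// Dw.
rewrite -mulr_sumr -mulr_suml -hGN ler_wpM2l//.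
by rewrite -[X in X * _](gtr0_norm (GN_gt0 Dw)) -normrM qM// GN_gt0.
Qed.

Lemma expect_testE (h : R -> R) (K : R) :
  (forall x : R, 0 < x -> {for x, continuous h}) ->
  (forall x : R, 0 < x -> `|h x| <= K * (1 + x ^+ 2)) ->
  expect_test P GN h = (E (fun w => h (GN w)))%:E.
Proof.
move=> ch hK.
have ih : P.-integrable D (EFin \o (fun w => h (GN w))).
  apply: (@integrable_D _ K); first exact: measurable_test.
  by move=> w Dw; exact: hK (GN_gt0 Dw).
rewrite /expect_test unlock /Rintegral fineK; last exact: integrable_fin_num.
pose h0 : R -> R := h \_ `]0, +oo[%classic.
have h0E w : (if 0 < GN w then h (GN w) else 0) = h0 (GN w).
  rewrite /h0 patchE; have [x0|x0] := boolP (0 < GN w).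
    by rewrite mem_set//= in_itv/= x0.
  by rewrite memNset//= in_itv/= andbT; exact/negP.
have mh0 : measurable_fun [set: R] h0.
  by apply/(measurable_restrictT _ _).1 => //; exact: measurable_pos.
have ih0 : P.-integrable [set: T] (EFin \o (fun w => h0 (GN w))).
  apply: (@integrable_quadratic _ _ _ _ setT GN _ K) => //.
  - exact: GN_square_integrable.
  - by apply: measurableT_comp => //; exact: measurable_funPT.
  - move=> w _; rewrite -h0E; case: ifPn => [x0|_]; first exact: hK.
    rewrite normr0 mulr_ge0 ?addr_ge0 ?sqr_ge0//.
    by have := le_trans (normr_ge0 _) (hK _ ltr01); rewrite pmulr_lge0// ltr_pwDl// sqr_ge0.
transitivity (\int[P]_w (EFin \o (fun w => h0 (GN w))) w)%E.
  by apply: eq_integral => w _; congr EFin; exact: h0E.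
rewrite (negligible_integral (measurableC mD) measurableT ih0 PD) setTD setCK.
by apply: eq_integral => w; rewrite inE => Dw; rewrite /= -h0E (GN_gt0 Dw).
Qed.

Section Expansion.
Variables (f f1 f2 h : R -> R) (c C : R).
Hypotheses (df : forall x : R, 0 < x -> is_derive x 1 f (f1 x))
  (df1 : forall x : R, 0 < x -> is_derive x 1 f1 (f2 x))
  (cf2 : forall x : R, 0 < x -> {for x, continuous f2})
  (fC : forall x : R, 0 < x -> `|f x| <= C * (1 + x))
  (f1C : forall x : R, 0 < x -> `|f1 x| <= C * (1 + x))
  (f2C : forall x : R, 0 < x -> `|x * f2 x| <= C * (1 + x ^+ 2))
  (stein_eq : forall x : R, 0 < x ->
     beta * x * f1 x + (alpha * beta - x) * f x = h x - c).

Let cf (x : R) (x0 : 0 < x) : {for x, continuous f} := is_deriv_continuous (df x0).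
Let cf1 (x : R) (x0 : 0 < x) : {for x, continuous f1} := is_deriv_continuous (df1 x0).
Let C0 : 0 <= C := growth_ge0 fC.

Lemma stein_expansion :
  E (fun w => h (GN w)) - c =
  \sum_(i < N) (beta - betas i) * betas i * E (fun w => G i w * f2 (GN w)).
Proof.
pose Ef := E (fun w => f (GN w)); pose Ef1 := E (fun w => f1 (GN w)).
pose t i := E (fun w => G i w * f (GN w)).
pose u i := E (fun w => G i w * f1 (GN w)).
pose v i := E (fun w => G i w * f2 (GN w)).
have tE i : t i = alphas i * betas i * Ef + betas i * u i.
  rewrite -(@stein_step i f f1 (2 * C)) //; first by rewrite subrKC.
    move=> x x0; apply: le_trans (fC x0) _.
    by rewrite ler_wpM2r ?addr_ge0 ?(ltW x0)// ler_peMl// ler1n.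
  move=> x x0; rewrite normrM (gtr0_norm x0).
  apply: le_trans (ler_wpM2l (ltW x0) (f1C x0)) _.
  by have [] := linear_quadratic x0 C0.
have uE i : u i = alphas i * betas i * Ef1 + betas i * v i.
  by rewrite -(@stein_step i f1 f2 C) // subrKC.
have if_ := integrable_test cf fC.
have iGf1 i := integrable_Gtest cf1 f1C i.
have iGf i := integrable_Gtest cf fC i.
have hE : E (fun w => h (GN w)) = c + \sum_i beta * u i + alpha * beta * Ef - \sum_i t i.
  have [i1 e1] := Rintegral_weighted_sum (fun=> beta) iGf1.
  have [i2 e2] := Rintegral_weighted_sum (fun=> 1) iGf.
  have iaf : P.-integrable D (EFin \o (fun w => alpha * beta * f (GN w))).
    exact: (integrableZl mD (alpha * beta) if_).
  have ic : P.-integrable D (EFin \o (cst c)) by exact: finite_measure_integrable_cst.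
  have i3 := integrableD mD i1 iaf.
  have i4 := integrableB mD i3 i2.
  transitivity (E (fun w => c + ((\sum_i beta * (G i w * f1 (GN w)) + alpha * beta * f (GN w)) -
     \sum_i 1 * (G i w * f (GN w))))).
    apply: eq_Rintegral => w; rewrite inE => Dw.
    have GNs (k y : R) : \sum_i k * (G i w * y) = k * (GN w * y).
      by rewrite hGN mulr_suml mulr_sumr.
    rewrite !GNs.
    have := stein_eq (GN_gt0 Dw); lra.
  rewrite RintegralD// RintegralB// RintegralD// e1 e2 RintegralZl//.
  rewrite E_cst /t.
  by under [in X in _ - X]eq_bigr do rewrite mul1r; rewrite !addrA.
rewrite hE.
(* Equality of the means cancels the terms with [Ef]. *)
rewrite (eq_bigr _ (fun i _ => tE i)) big_split/= -mulr_suml -hmean.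
transitivity (\sum_i (beta - betas i) * u i).
  under [RHS]eq_bigr do rewrite mulrBl.
  by rewrite sumrB; ring.
transitivity (\sum_i ((beta - betas i) * (alphas i * betas i * Ef1) +
    (beta - betas i) * (betas i * v i))).
  by apply: eq_bigr => i _; rewrite uE mulrDr.
rewrite big_split/= (_ : \sum_i _ * (_ * Ef1) = 0) ?add0r.
  by apply: eq_bigr => i _; rewrite mulrA.
(* The total coefficient of [Ef1] is [beta (alpha beta) - alpha beta^2 = 0], by both moment
   conditions. *)
transitivity ((beta * \sum_i alphas i * betas i - \sum_i alphas i * betas i ^+ 2) * Ef1).
  rewrite mulr_sumr -sumrB mulr_suml; apply: eq_bigr => i _; ring.
by rewrite -hmean -hvar expr2 mulrCA subrr mul0r.
Qed.

Lemma steep_expansion_le (M : R) : (forall x : R, 0 < x -> `|x * f2 x| <= M) ->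
  `|E (fun w => h (GN w)) - c| <= beta * A_max betas beta * M.
Proof.
move=> f2M; rewrite stein_expansion; apply: weighted_sum_le => //.
  by rewrite mulr_ge0 ?A_max_ge0 ?(ltW hbeta).
by move=> i; exact: beta_diff_le.
Qed.

(** The third Stein identity splits [E[G_i f2]]. In the part with [E[f2]] the weights
    [alphas i * betas i] add up to [alpha beta], the factor in front of [e_const]; the part with
    [f3] carries an additional [betas i], hence [B_max]. *)
Lemma smooth_expansion_le (f3 : R -> R) (M2 M3 : R) :
  (forall x : R, 0 < x -> is_derive x 1 f2 (f3 x)) ->
  (forall x : R, 0 < x -> {for x, continuous f3}) ->
  (forall x : R, 0 < x -> `|f2 x| <= M2) -> (forall x : R, 0 < x -> `|x * f3 x| <= M3) ->
  `|E (fun w => h (GN w)) - c| <=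
     beta * B_max betas beta * M3 + beta * A_max betas beta * (alpha * beta) * M2.
Proof.
move=> df2 cf3 f2M f3M; rewrite stein_expansion.
have M20 : 0 <= M2 by apply: le_trans (f2M _ ltr01); exact: normr_ge0.
have M30 : 0 <= M3 by apply: le_trans (f3M _ ltr01); exact: normr_ge0.
have f2L (x : R) : 0 < x -> `|f2 x| <= (M2 + M3) * (1 + x).
  move=> x0; apply: le_trans (f2M _ x0) _; rewrite mulrDr mulr1.
  by rewrite -addrA lerDl addr_ge0// mulr_ge0 ?addr_ge0// ltW.
have f3L (x : R) : 0 < x -> `|x * f3 x| <= (M2 + M3) * (1 + x ^+ 2).
  move=> x0; apply: le_trans (f3M _ x0) _; rewrite mulrDr mulr1 [M2 + M3]addrC.
  by rewrite -addrA lerDl addr_ge0// mulr_ge0 ?addr_ge0// sqr_ge0.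
pose Ef2 := E (fun w => f2 (GN w)); pose w3 i := E (fun w => G i w * f3 (GN w)).
have vE i : E (fun w => G i w * f2 (GN w)) = alphas i * betas i * Ef2 + betas i * w3 i.
  by rewrite -(@stein_step i f2 f3 (M2 + M3)) // subrKC.
rewrite (_ : \sum_(i < N) _ = \sum_i (beta - betas i) * betas i ^+ 2 * w3 i +
    (\sum_i (beta - betas i) * betas i * (alphas i * betas i)) * Ef2); last first.
  by rewrite mulr_suml -big_split/=; apply: eq_bigr => i _; rewrite vE; ring.
apply: le_trans (ler_normD _ _) _; apply: lerD.
  apply: weighted_sum_le => //.
    by rewrite mulr_ge0 ?B_max_ge0 ?(ltW hbeta).
  by move=> i; exact: beta_diff_sqr_le.
rewrite normrM ler_pM//.
  apply: le_trans (ler_norm_sum _ _ _) _.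
  rewrite hmean mulr_sumr; apply: ler_sum => i _.
  have ab0 : 0 <= alphas i * betas i by rewrite mulr_ge0// ltW.
  by rewrite normrM (ger0_norm ab0) ler_wpM2r// beta_diff_le.
apply: E_norm_le; last by move=> w Dw; exact: f2M (GN_gt0 Dw).
by apply: (@integrable_test f2 (M2 + M3)).
Qed.

End Expansion.

End SteinSum.

(** * The Stein equation at arbitrary scale *)

Section ScaledStein.
Context {R : realType}.
Implicit Types x y : R.

Lemma continuous_pos (f g : R -> R) x : 0 < x -> (forall y, 0 < y -> f y = g y) ->
  {for x, continuous f} -> {for x, continuous g}.
Proof.
move=> x0 fg cf; rewrite /prop_for /continuous_at -(fg _ x0).
apply: cvg_trans cf; apply: near_eq_cvg.
by near=> y; apply: fg; near: y; exact: lt_nbhsr.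
Unshelve. all: by end_near. Qed.

Lemma product_rule_pos (b : R) (g g1 k k1 : R -> R) : 0 < b ->
  (forall x, 0 < x -> is_derive x 1 g (g1 x)) ->
  (forall x, 0 < x -> is_derive x 1 k (k1 x)) ->
  (forall x, 0 < x -> b * x * g x = k x) ->
  forall x, 0 < x -> b * x * g1 x = k1 x - b * g x.
Proof.
move=> b0 dg dk gk x x0.
have d1 : is_derive x 1 (fun y => b * y * g y) (b * g x + b * x * g1 x).
  apply: is_deriv_eq (is_deriv_mul (is_deriv_mul (is_deriv_cst b x) (is_deriv_id x)) (dg _ x0)) _.
  by ring.
have d2 := is_deriv_pos x0 gk d1.
have := is_deriv_val d2; rewrite (is_deriv_val (dk _ x0)) => ->; ring.
Qed.

(** Continuity of the highest derivative comes from the equation: differentiating [b x g = k] gives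
    [g1 = (k1 - b g) / (b x)], so [g1] need not be examined through its own formula. *)
Lemma continuous_deriv_pos (b : R) (g g1 k k1 : R -> R) : 0 < b ->
  (forall x, 0 < x -> is_derive x 1 g (g1 x)) ->
  (forall x, 0 < x -> is_derive x 1 k (k1 x)) ->
  (forall x, 0 < x -> b * x * g x = k x) ->
  (forall x, 0 < x -> {for x, continuous k1}) ->
  forall x, 0 < x -> {for x, continuous g1}.
Proof.
move=> b0 dg dk gk ck1 x x0.
apply: (continuous_pos (f := fun y => (k1 y - b * g y) * (b * y)^-1) x0).
  move=> y y0; rewrite -(product_rule_pos b0 dg dk gk y0).
  by rewrite mulrAC divff ?mul1r// mulf_neq0 ?gt_eqF.
have dby : is_derive x 1 (fun y : R => b * y) b.
  by apply: is_deriv_eq (is_deriv_mul (is_deriv_cst b x) (is_deriv_id x)) _; ring.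
apply: continuousM.
  apply: continuousB; first exact: ck1.
  apply: continuousM; first exact: cst_continuous.
  exact: is_deriv_continuous (dg _ x0).
apply: continuousV; first by rewrite mulf_neq0 ?gt_eqF.
exact: is_deriv_continuous dby.
Qed.

Variables (alpha beta : R).
Hypotheses (alpha0 : 0 < alpha) (beta0 : 0 < beta) (G0 : 0 < Gamma alpha).

Let ib0 : 0 < beta^-1. Proof. by rewrite invr_gt0. Qed.

Let div_gt0 x : 0 < x -> 0 < x / beta. Proof. by move=> x0; rewrite divr_gt0. Qed.

Let scale_deriv (c : R) (F F1 : R -> R) x :
  (forall y, 0 < y -> is_derive y 1 F (F1 y)) -> 0 < x ->
  is_derive x 1 (fun y => c * F (y / beta)) (c / beta * F1 (x / beta)).
Proof.
move=> dF x0.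
have ds : is_derive x 1 (fun y : R => y / beta) beta^-1.
  by apply: is_deriv_eq (is_deriv_mul (is_deriv_id x) (is_deriv_cst beta^-1 x)) _; ring.
apply: is_deriv_eq (is_deriv_mul (is_deriv_cst c x) (is_deriv_comp (g := fun y => y / beta) (dF _ (div_gt0 x0)) ds)) _.
by ring.
Qed.

Let unscale_deriv (c : R) (F F1 : R -> R) x :
  (forall y, 0 < y -> is_derive y 1 F (F1 y)) -> 0 < x ->
  is_derive x 1 (fun y => c * F (beta * y)) (c * beta * F1 (beta * x)).
Proof.
move=> dF x0.
have ds : is_derive x 1 (fun y : R => beta * y) beta.
  by apply: is_deriv_eq (is_deriv_mul (is_deriv_cst beta x) (is_deriv_id x)) _; ring.
have bx0 : 0 < beta * x by rewrite mulr_gt0.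
apply: is_deriv_eq (is_deriv_mul (is_deriv_cst c x) (is_deriv_comp (g := fun y => beta * y) (dF _ bx0) ds)) _.
by ring.
Qed.

Let scale_growth (c C : R) (F : R -> R) (n : nat) (s : R) : 0 < s ->
  (forall y, 0 < y -> `|F y| <= C * (1 + y ^+ n)) ->
  forall x, 0 < x -> `|c * F (s * x)| <= `|c| * C * (1 + s ^+ n) * (1 + x ^+ n).
Proof.
move=> s0 FC x x0; have sx0 : 0 < s * x by rewrite mulr_gt0.
have C0 : 0 <= C.
  by have := le_trans (normr_ge0 _) (FC _ ltr01); rewrite pmulr_lge0// expr1n addr_gt0.
rewrite normrM -!mulrA ler_wpM2l//; apply: le_trans (FC _ sx0) _.
rewrite ler_wpM2l// exprMn.
have sn0 : 0 <= s ^+ n by rewrite exprn_ge0// ltW.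
have xn0 : 0 <= x ^+ n by rewrite exprn_ge0// ltW.
lra.
Qed.

(** What the expansion of a sum requires of a solution. The constant [c] is not yet identified with
    the mean of [h], and [C] serves only for integrability. *)
Definition stein_solution (f f1 f2 h : R -> R) (c C : R) : Prop :=
  [/\ forall x, 0 < x -> is_derive x 1 f (f1 x),
      forall x, 0 < x -> is_derive x 1 f1 (f2 x),
      forall x, 0 < x -> {for x, continuous f2},
      [/\ forall x, 0 < x -> `|f x| <= C * (1 + x),
          forall x, 0 < x -> `|f1 x| <= C * (1 + x) &
          forall x, 0 < x -> `|x * f2 x| <= C * (1 + x ^+ 2)] &
      forall x, 0 < x -> beta * x * f1 x + (alpha * beta - x) * f x = h x - c].

Let growth_weaken (F : R -> R) (C D : R) (n : nat) : 0 <= D ->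
  (forall x, 0 < x -> `|F x| <= C * (1 + x ^+ n)) ->
  forall x, 0 < x -> `|F x| <= (C + D) * (1 + x ^+ n).
Proof.
move=> D0 FC x x0; apply: le_trans (FC _ x0) _.
by rewrite mulrDl lerDl mulr_ge0// addr_ge0// exprn_ge0// ltW.
Qed.

Let growth_const (F : R -> R) (C : R) (n : nat) :
  (forall x, 0 < x -> `|F x| <= C * (1 + x ^+ n)) -> 0 <= C.
Proof.
move=> FC; have := le_trans (normr_ge0 _) (FC _ ltr01).
by rewrite pmulr_lge0// expr1n addr_gt0.
Qed.

Let const_growth (F : R -> R) (C : R) (n : nat) :
  (forall x, 0 < x -> `|F x| <= C) ->
  forall x, 0 < x -> `|F x| <= C * (1 + x ^+ n).
Proof.
move=> FC x x0; have C0 := le_trans (normr_ge0 _) (FC _ x0).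
by apply: le_trans (FC _ x0) _; rewrite ler_peMr// lerDl exprn_ge0// ltW.
Qed.

Let growth3 (f f1 f2 : R -> R) :
  (exists C, forall x, 0 < x -> `|f x| <= C * (1 + x ^+ 1)) ->
  (exists C, forall x, 0 < x -> `|f1 x| <= C * (1 + x ^+ 1)) ->
  (exists C, forall x, 0 < x -> `|x * f2 x| <= C * (1 + x ^+ 2)) ->
  exists C, [/\ forall x, 0 < x -> `|f x| <= C * (1 + x),
          forall x, 0 < x -> `|f1 x| <= C * (1 + x) &
          forall x, 0 < x -> `|x * f2 x| <= C * (1 + x ^+ 2)].
Proof.
move=> [C fC] [C1 f1C] [C2 f2C].
have C0 := growth_const fC; have C10 := growth_const f1C.
have C20 := growth_const (F := fun x => x * f2 x) f2C.
exists (C + C1 + C2); split=> x x0.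
- by rewrite -addrA; apply: (growth_weaken _ fC) => //; exact: addr_ge0.
- by rewrite (addrC C) -addrA; apply: (growth_weaken _ f1C) => //; exact: addr_ge0.
- by rewrite addrC; apply: (@growth_weaken (fun x => x * f2 x)) => //; exact: addr_ge0.
Qed.

Section Solution.
Variables (h h1 : R -> R) (K : R).
Hypotheses (dh : forall x, 0 < x -> is_derive x 1 h (h1 x))
  (ch1 : forall x, 0 < x -> {for x, continuous h1})
  (hK : forall x, 0 < x -> `|h x| <= K * (1 + x ^+ 2)).

(** The factor that normalises the test function at unit scale: [beta^-1] preserves a bound on the
    first derivative, [beta^-2] one on the second. *)
Variable k : R.
Let hb x := k * h (beta * x).
Let hb1 x := k * beta * h1 (beta * x).
Let Kb := `|k| * K * (1 + beta ^+ 2).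
Let dhb x : 0 < x -> is_derive x 1 hb (hb1 x).
Proof. exact: unscale_deriv. Qed.
Let hbK x : 0 < x -> `|hb x| <= Kb * (1 + x ^+ 2).
Proof. exact: scale_growth. Qed.

Hypothesis k0 : 0 < k.
Let f x := (k * beta)^-1 * stein_sol alpha hb (x / beta).
Let f1 x := (k * beta)^-1 / beta * stein_sol1 alpha hb (x / beta).
Let f2 x := (k * beta)^-1 / beta / beta * stein_sol2 alpha hb hb1 (x / beta).
Let c := k^-1 * stein_mean alpha hb.

Let df x : 0 < x -> is_derive x 1 f (f1 x).
Proof. by apply: scale_deriv => y; exact: (stein_sol_deriv alpha0 G0 dhb hbK). Qed.

Let df1 x : 0 < x -> is_derive x 1 f1 (f2 x).
Proof. by apply: scale_deriv => y; exact: (stein_sol1_deriv alpha0 G0 dhb hbK). Qed.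

Let stein_eq x : 0 < x -> beta * x * f1 x + (alpha * beta - x) * f x = h x - c.
Proof.
move=> x0; have hbE : hb (x / beta) = k * h x by rewrite /hb mulrCA divff ?gt_eqF// mulr1.
have := stein_equation G0 hb (div_gt0 x0).
rewrite hbE => /(congr1 (fun z => k^-1 * z)).
rewrite [in RHS]mulrBr mulKf ?gt_eqF// -/c => <-.
rewrite /f1 /f; field.
by rewrite !gt_eqF.
Qed.

Let dk x : 0 < x -> is_derive x 1 (fun y => h y - c - (alpha * beta - y) * f y)
  (h1 x + f x - (alpha * beta - x) * f1 x).
Proof.
move=> x0.
apply: is_deriv_eq (is_deriv_sub (is_deriv_sub (dh x0) (is_deriv_cst c x))
  (is_deriv_mul (is_deriv_sub (is_deriv_cst (alpha * beta) x) (is_deriv_id x)) (df x0))) _.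
by ring.
Qed.

Let kE x : 0 < x -> beta * x * f1 x = h x - c - (alpha * beta - x) * f x.
Proof. by move=> x0; rewrite -stein_eq//; ring. Qed.

Let cf2 x : 0 < x -> {for x, continuous f2}.
Proof.
apply: (continuous_deriv_pos beta0 df1 dk kE) => {}x x0.
apply: continuousB.
  by apply: continuousD; [exact: ch1|exact: is_deriv_continuous (df x0)].
apply: continuousM; last exact: is_deriv_continuous (df1 x0).
exact: is_deriv_continuous (is_deriv_sub (is_deriv_cst (alpha * beta) x) (is_deriv_id x)).
Qed.

Let solution_growth (c0 : R) (F : R -> R) :
  (exists C, forall x, 0 < x -> `|F x| <= C * (1 + x)) ->
  exists C, forall x, 0 < x -> `|c0 * F (x / beta)| <= C * (1 + x ^+ 1).
Proof.
move=> [C FC]; exists (`|c0| * C * (1 + beta^-1 ^+ 1)) => x x0.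
by rewrite [x / beta]mulrC; apply: (@scale_growth c0 C F 1).
Qed.

Lemma stein_solution_lipschitz : k = beta^-1 ->
  (forall x, 0 < x -> `|h1 x| <= 1) ->
  exists g g1 g2 d C,
    stein_solution g g1 g2 h d C /\ forall x, 0 < x -> `|x * g2 x| <= 2 / beta.
Proof.
move=> kE1 h1_le1.
have hb1_le1 x : 0 < x -> `|hb1 x| <= 1.
  by move=> x0; rewrite /hb1 kE1 mulVf ?gt_eqF// mul1r h1_le1// mulr_gt0.
have f2_le x : 0 < x -> `|x * f2 x| <= 2 / beta.
  move=> x0; have := stein_sol2_le2 alpha0 G0 dhb hbK hb1_le1 (div_gt0 x0).
  rewrite /f2 kE1 mulVf ?gt_eqF// invr1 => le2.
  rewrite (_ : x * _ = beta^-1 * (x / beta * stein_sol2 alpha hb hb1 (x / beta))); last by ring.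
  by rewrite normrM gtr0_norm// mulrC ler_wpM2r// ltW.
have [C [fC f1C f2C]] : exists C, [/\ forall x, 0 < x -> `|f x| <= C * (1 + x),
          forall x, 0 < x -> `|f1 x| <= C * (1 + x) &
          forall x, 0 < x -> `|x * f2 x| <= C * (1 + x ^+ 2)].
  apply: growth3.
  - apply: solution_growth; exists 1.
    apply: (@const_growth _ 1 1) => x x0.
    exact: (stein_sol_le1 alpha0 G0 dhb hbK hb1_le1).
  - by apply: solution_growth; exact: (stein_sol1_linear_growth alpha0 G0 dhb hbK hb1_le1).
  - by exists (2 / beta); apply: (const_growth (F := fun x => x * f2 x)).
by exists f, f1, f2, c, C.
Qed.

Section SmoothSolution.
Variables (h2 : R -> R) (K1 : R).
Hypotheses (dh1 : forall x, 0 < x -> is_derive x 1 h1 (h2 x))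
  (ch2 : forall x, 0 < x -> {for x, continuous h2})
  (h2_le1 : forall x, 0 < x -> `|h2 x| <= 1)
  (h1K : forall x, 0 < x -> `|h1 x| <= K1 * (1 + x)).

Let hb2 x := k * beta * beta * h2 (beta * x).
Let dhb1 x : 0 < x -> is_derive x 1 hb1 (hb2 x).
Proof. exact: unscale_deriv. Qed.
Let hb1K x : 0 < x -> `|hb1 x| <= `|k * beta| * K1 * (1 + beta ^+ 1) * (1 + x).
Proof. exact: (@scale_growth _ K1 h1 1). Qed.

Let f3 x := (k * beta)^-1 / beta / beta / beta * stein_sol3 alpha hb hb1 hb2 (x / beta).

Lemma stein_solution_smooth : k = beta^-2 ->
  exists g g1 g2 g3 d C,
    [/\ stein_solution g g1 g2 h d C,
        forall x, 0 < x -> is_derive x 1 g2 (g3 x),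
        forall x, 0 < x -> {for x, continuous g3},
        forall x, 0 < x -> `|g2 x| <= e_const alpha / beta &
        forall x, 0 < x -> `|x * g3 x| <= 2 / beta].
Proof.
move=> kE2.
have kb : (k * beta)^-1 / beta = 1.
  by rewrite kE2; field; rewrite gt_eqF.
have hb2_le1 x : 0 < x -> `|hb2 x| <= 1.
  move=> x0; rewrite /hb2 -[X in X * _]invrK invfM kb invr1 mul1r.
  by rewrite h2_le1// mulr_gt0.
have f2_le x : 0 < x -> `|f2 x| <= e_const alpha / beta.
  move=> x0; have := stein_sol2_le_e_const alpha0 G0 dhb hbK dhb1 hb2_le1 hb1K (div_gt0 x0) => le2.
  by rewrite /f2 kb mul1r normrM (gtr0_norm ib0) [leLHS]mulrC ler_pM2r.
have f3_le x : 0 < x -> `|x * f3 x| <= 2 / beta.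
  move=> x0; have := stein_sol3_le2 alpha0 G0 dhb hbK dhb1 hb2_le1 hb1K (div_gt0 x0).
  rewrite /f3 kb mul1r => le2.
  rewrite (_ : x * _ = beta^-1 * (x / beta * stein_sol3 alpha hb hb1 hb2 (x / beta))); last by ring.
  by rewrite normrM gtr0_norm// mulrC ler_wpM2r// ltW.
have df2 x : 0 < x -> is_derive x 1 f2 (f3 x).
  by apply: scale_deriv => y; exact: (stein_sol2_deriv alpha0 G0 dhb hbK dhb1).
have [C [fC f1C f2C]] : exists C, [/\ forall x, 0 < x -> `|f x| <= C * (1 + x),
          forall x, 0 < x -> `|f1 x| <= C * (1 + x) &
          forall x, 0 < x -> `|x * f2 x| <= C * (1 + x ^+ 2)].
  apply: growth3.
  - by apply: solution_growth; exact: (stein_sol_linear_growth alpha0 G0 dhb hbK hb1K).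
  - by apply: solution_growth; exact: (stein_sol1_linear_growth2 alpha0 G0 dhb hbK dhb1 hb2_le1 hb1K).
  - exists (e_const alpha / beta) => x x0.
    have e0 := le_trans (normr_ge0 _) (f2_le _ x0).
    rewrite normrM (gtr0_norm x0) mulrC; apply: ler_pM => //; first exact: ltW.
      exact: f2_le.
    by have := sqr_ge0 (x - 1); rewrite sqrrB1; have := sqr_ge0 x; lra.
have cf3 x : 0 < x -> {for x, continuous f3}.
  (* The Stein equation differentiated once reads [beta x f2 = k1]; [k2] is the derivative of [k1],
     so differentiating again shows that [f3] is continuous. *)
  pose k1 y := (h1 y + f y - (alpha * beta - y) * f1 y) - beta * f1 y.
  pose k2 y := (h2 y + f1 y - (- f1 y + (alpha * beta - y) * f2 y)) - beta * f2 y.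
  have da y : is_derive y 1 (fun z : R => alpha * beta - z) (- 1).
    by apply: is_deriv_eq (is_deriv_sub (is_deriv_cst (alpha * beta) y) (is_deriv_id y)) _; ring.
  have dk1 y : 0 < y -> is_derive y 1 k1 (k2 y).
    move=> y0; apply: is_deriv_eq (is_deriv_sub (is_deriv_sub (is_deriv_add (dh1 y0) (df y0))
      (is_deriv_mul (da y) (df1 y0))) (is_deriv_mul (is_deriv_cst beta y) (df1 y0))) _.
    by rewrite /k2; ring.
  apply: (continuous_deriv_pos beta0 df2 dk1).
    exact: (product_rule_pos beta0 df1 dk kE).
  move=> {}x x0.
  have cf := is_deriv_continuous (df1 x0).
  apply: continuousB; last by apply: continuousM; [exact: cst_continuous|exact: cf2].
  apply: continuousB; first by apply: continuousD => //; exact: ch2.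
  apply: continuousD; first exact: continuousN.
  by apply: continuousM; [exact: is_deriv_continuous (da x)|exact: cf2].
by exists f, f1, f2, f3, c, C; split.
Qed.

End SmoothSolution.

End Solution.

End ScaledStein.

(** * Smooth test functions *)

Section TestFunctions.
Context {R : realType}.
Implicit Types (h : R -> R) (x : R).

Lemma sup_norm_pos_le1 h x : (sup_norm_pos h <= 1)%E -> 0 < x -> `|h x| <= 1.
Proof.
move=> h1 x0; rewrite -lee_fin; apply: le_trans h1.
by apply: ereal_sup_ubound; exists x => //=; rewrite in_itv/= x0.
Qed.

Lemma is_deriv_derive1 h x : derivable h x 1 -> is_derive x 1 h (h^`()%classic x).
Proof. by move=> dh; rewrite derive1E; exact: derivableP. Qed.

Lemma lipschitz_linear_growth h (h1 : R -> R) :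
  (forall x, 0 < x -> is_derive x 1 h (h1 x)) -> (forall x, 0 < x -> `|h1 x| <= 1) ->
  forall x, 0 < x -> `|h x| <= (`|h 1| + 1) * (1 + x).
Proof.
move=> dh h1_le1 x x0.
have L := lipschitz_of_deriv dh h1_le1 x0 ltr01.
have -> : h x = h 1 + (h x - h 1) by ring.
apply: le_trans (ler_normD _ _) _.
have : `|x - 1| <= x + 1 by rewrite (le_trans (ler_normB _ _))// normr1 (gtr0_norm x0).
have := normr_ge0 (h 1); nra.
Qed.

Lemma linear_quadratic_growth h (K : R) :
  (forall x, 0 < x -> `|h x| <= K * (1 + x)) ->
  forall x, 0 < x -> `|h x| <= 2 * K * (1 + x ^+ 2).
Proof.
move=> hK x x0; apply: le_trans (hK _ x0) _.
have K0 : 0 <= K by have := le_trans (normr_ge0 _) (hK _ ltr01); rewrite pmulr_lge0.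
rewrite [2 * K]mulrC -mulrA ler_wpM2l//.
by have := sqr_ge0 (x - 1); have := sqr_ge0 x; rewrite sqrrB1; lra.
Qed.

Lemma quadratic_growth_of_deriv h (h1 : R -> R) (K : R) :
  (forall x, 0 < x -> is_derive x 1 h (h1 x)) ->
  (forall x, 0 < x -> `|h1 x| <= K * (1 + x)) ->
  forall x, 0 < x -> `|h x| <= (`|h 1| + 4 * K) * (1 + x ^+ 2).
Proof.
move=> dh h1K x x0.
have K0 : 0 <= K by have := le_trans (normr_ge0 _) (h1K _ ltr01); rewrite pmulr_lge0.
have L : `|h x - h 1| <= K * (2 + x) * (1 + x).
  have bnd (a b : R) : 0 < a -> a <= b -> b <= 1 + x ->
      `|h b - h a| <= K * (2 + x) * (b - a).
    move=> a0 ab bx.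
    have dab y : a <= y <= b -> is_derive y 1 h (h1 y).
      by move=> /andP[ay _]; apply: dh; exact: lt_le_trans ay.
    have [y /andP[ay yb] ->] := mvt ab dab.
    rewrite normrM [X in _ * X]ger0_norm ?subr_ge0// ler_wpM2r ?subr_ge0//.
    apply: le_trans (h1K _ (lt_le_trans a0 ay)) _.
    by rewrite ler_wpM2l//; lra.
  have c0 : 0 <= K * (2 + x) by rewrite mulr_ge0// addr_ge0// ltW.
  have [x1|x1] := lerP x 1.
    rewrite distrC; apply: le_trans (bnd _ _ x0 x1 _) _; first by lra.
    by rewrite ler_wpM2l//; lra.
  apply: le_trans (bnd _ _ ltr01 (ltW x1) _) _; first by lra.
  by rewrite ler_wpM2l//; lra.
have -> : h x = h 1 + (h x - h 1) by ring.
apply: le_trans (ler_normD _ _) _.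
have q : (2 + x) * (1 + x) <= 4 * (1 + x ^+ 2).
  by have := sqr_ge0 (x - 1); have := sqr_ge0 x; rewrite sqrrB1; lra.
have := ler_wpM2l K0 q.
have := normr_ge0 (h 1); have := sqr_ge0 x; nra.
Qed.

End TestFunctions.

(** * The distances given by smooth test functions *)

Section GammaComparison.
Context {R : realType} {d1 d2 : measure_display}
  {T1 : measurableType d1} (P1 : probability T1 R)
  {T2 : measurableType d2} (P2 : probability T2 R)
  (N : nat) (alphas betas : 'I_N -> R)
  (G : 'I_N -> {RV P1 >-> R}) (GN : {RV P1 >-> R}) (alpha beta : R)
  (U : {RV P2 >-> R}).
Hypotheses (hN : (1 <= N)%N)
  (halphas : forall i, 0 < alphas i) (hbetas : forall i, 0 < betas i)
  (hind : mutually_independent P1 G)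
  (hG : forall i, has_gamma_law P1 (G i) (alphas i) (betas i))
  (hGN : forall w : T1, GN w = \sum_(i < N) G i w)
  (halpha : 0 < alpha) (hbeta : 0 < beta)
  (hmean : alpha * beta = \sum_(i < N) alphas i * betas i)
  (hvar : alpha * beta ^+ 2 = \sum_(i < N) alphas i * betas i ^+ 2)
  (hU : has_gamma_law P2 U alpha beta).

Let G0 : 0 < Gamma alpha := gamma_law_Gamma_gt0 hU.

Let indU : mutually_independent P2 (fun _ : 'I_1 => U).
Proof.
move=> J B mB; have [->|[i iJ]] := set_0Vmem J.
  rewrite big_set0 (_ : \bigcap_(i in _) _ = setT) ?probability_setT//.
  by apply/seteqP; split=> // w _ i; rewrite /= inE.
have -> : J = [set ord0]%SET.
  by apply/setP => j; rewrite !ord1 inE eqxx -(ord1 i).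
rewrite big_set1; congr (P2 _); apply/seteqP; split=> [w|w Bw j /=].
  by apply; rewrite /= inE.
by rewrite inE => /eqP ->.
Qed.

Section Solution.
Variables (h f f1 f2 : R -> R) (c C K : R).
Hypotheses (sol : stein_solution alpha beta f f1 f2 h c C)
  (ch : forall x : R, 0 < x -> {for x, continuous h})
  (hK : forall x : R, 0 < x -> `|h x| <= K * (1 + x ^+ 2)).

(** [U] is itself a sum with a single Gamma summand of scale [beta], and the expansion for it has
    the coefficient [beta - beta = 0]. The constant of the Stein equation is thus the mean of [h],
    without transforming an integral. *)
Lemma expect_test_gamma : expect_test P2 U h = c%:E.
Proof.
have [df df1 cf2 [fC f1C f2C] eqn] := sol.
have U1 w : U w = \sum_(i < 1) U w by rewrite big_ord1.
have h1 (i : 'I_1) : 0 < alpha by [].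
have h2 (i : 'I_1) : 0 < beta by [].
have h3 (i : 'I_1) : has_gamma_law P2 U alpha beta by [].
have m1 : alpha * beta = \sum_(i < 1) alpha * beta by rewrite big_ord1.
have v1 : alpha * beta ^+ 2 = \sum_(i < 1) alpha * beta ^+ 2 by rewrite big_ord1.
have e := expect_testE h1 h2 indU h3 U1 isT ch hK.
rewrite e; congr EFin.
have := stein_expansion h1 h2 indU h3 U1 isT m1 v1 df df1 cf2 fC f1C f2C eqn.
by rewrite big_ord1 subrr !mul0r => /eqP; rewrite subr_eq0 => /eqP.
Qed.

Lemma expect_test_steep (M : R) : (forall x : R, 0 < x -> `|x * f2 x| <= M) ->
  (`|expect_test P1 GN h - expect_test P2 U h| <= (beta * A_max betas beta * M)%:E)%E.
Proof.
have [df df1 cf2 [fC f1C f2C] eqn] := sol => f2M.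
rewrite expect_test_gamma (expect_testE halphas hbetas hind hG hGN hN ch hK).
rewrite -EFinB abse_EFin lee_fin.
exact: (steep_expansion_le halphas hbetas hind hG hGN hN hbeta hmean hvar df df1 cf2
  fC f1C f2C eqn f2M).
Qed.

Lemma expect_test_smooth (f3 : R -> R) (M2 M3 : R) :
  (forall x : R, 0 < x -> is_derive x 1 f2 (f3 x)) ->
  (forall x : R, 0 < x -> {for x, continuous f3}) ->
  (forall x : R, 0 < x -> `|f2 x| <= M2) -> (forall x : R, 0 < x -> `|x * f3 x| <= M3) ->
  (`|expect_test P1 GN h - expect_test P2 U h| <=
    (beta * B_max betas beta * M3 + beta * A_max betas beta * (alpha * beta) * M2)%:E)%E.
Proof.
have [df df1 cf2 [fC f1C f2C] eqn] := sol => df2 cf3 f2M f3M.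
rewrite expect_test_gamma (expect_testE halphas hbetas hind hG hGN hN ch hK).
rewrite -EFinB abse_EFin lee_fin.
exact: (smooth_expansion_le halphas hbetas hind hG hGN hN hbeta hmean hvar df df1 cf2
  fC f1C f2C eqn df2 cf3 f2M f3M).
Qed.

End Solution.

Lemma expect_test_Z1 (h : R -> R) : Z1 h ->
  (`|expect_test P1 GN h - expect_test P2 U h| <= (2 * A_max betas beta)%:E)%E.
Proof.
move=> [dh ch1 sup1].
have dh' x (x0 : 0 < x) := is_deriv_derive1 (dh x x0).
have h1_le1 x (x0 : 0 < x) := sup_norm_pos_le1 sup1 x0.
have hK := linear_quadratic_growth (lipschitz_linear_growth dh' h1_le1).
have b0 : 0 < beta^-1 by rewrite invr_gt0.
have [f [f1 [f2 [c [C [sol f2M]]]]]] :=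
  stein_solution_lipschitz halpha hbeta G0 dh' ch1 hK b0 erefl h1_le1.
have ch (x : R) (x0 : 0 < x) := is_deriv_continuous (dh' x x0).
have := expect_test_steep sol ch hK f2M.
by rewrite (_ : beta * _ * _ = 2 * A_max betas beta)//; field; rewrite gt_eqF.
Qed.

Lemma expect_test_Z2 (h : R -> R) : Z2 h ->
  (`|expect_test P1 GN h - expect_test P2 U h| <=
    (2 * B_max betas beta + alpha * beta * e_const alpha * A_max betas beta)%:E)%E.
Proof.
move=> [dh dh1 ch2 sup2].
have dh' x (x0 : 0 < x) := is_deriv_derive1 (dh x x0).
have dh1' x (x0 : 0 < x) := is_deriv_derive1 (dh1 x x0).
have h2_le1 x (x0 : 0 < x) := sup_norm_pos_le1 sup2 x0.
have h1K := lipschitz_linear_growth dh1' h2_le1.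
have hK := quadratic_growth_of_deriv dh' h1K.
have b0 : 0 < beta^-2 by rewrite invr_gt0 exprn_gt0.
have ch1 (x : R) (x0 : 0 < x) := is_deriv_continuous (dh1' x x0).
have [f [f1 [f2 [f3 [c [C [sol df2 cf3 f2M f3M]]]]]]] :=
  stein_solution_smooth halpha hbeta G0 dh' ch1 hK b0 dh1' ch2 h2_le1 h1K erefl.
have ch (x : R) (x0 : 0 < x) := is_deriv_continuous (dh' x x0).
have := expect_test_smooth sol ch hK df2 cf3 f2M f3M.
by rewrite (_ : beta * _ * _ + _ = 2 * B_max betas beta +
  alpha * beta * e_const alpha * A_max betas beta)//; field; rewrite gt_eqF.
Qed.

End GammaComparison.

(** * The Gamma function *)

Section GammaFunction.
Context {R : realType}.
Notation mu := (@lebesgue_measure R).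
Implicit Types x y t : R.

Let g y t := t `^ y * expR (- t).

Let powRE t y : 0 < t -> t `^ y = expR (y * ln t).
Proof. by move=> t0; rewrite /powR gt_eqF. Qed.

Lemma ln_le_sub1 t : 0 < t -> ln t <= t - 1.
Proof.
by move=> t0; have := expR_ge1Dx (ln t); rewrite lnK ?posrE// lerBrDl.
Qed.

(** The maximum is at [t = m b]; the inequality is [ln u <= u - 1] at [u = t / (m b)]. It yields
    both the convergence of the Gamma integral and the bound of the density by its mode. *)
Lemma powR_expR_le_max (m b t : R) : 0 < m -> 0 < b -> 0 < t ->
  t `^ m * expR (- t / b) <= (m * b) `^ m * expR (- m).
Proof.
move=> m0 b0 t0; have mb0 : 0 < m * b by rewrite mulr_gt0.
rewrite !powRE// -!expRD ler_expR.
have := ln_le_sub1 (divr_gt0 t0 mb0); rewrite ln_div ?posrE// => /(ler_wpM2l (ltW m0)).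
rewrite (_ : m * (t / (m * b) - 1) = t / b - m); last by field; rewrite !gt_eqF.
by rewrite mulNr; lra.
Qed.

Let g_deriv y t : 0 < t -> is_derive t 1 (g y) (y * g (y - 1) t - g y t).
Proof.
move=> t0; apply: is_deriv_eq (is_deriv_mul (is_derive1_powR y t0)
  (is_deriv_exp (is_deriv_opp (is_deriv_id t)))) _.
by rewrite /g; ring.
Qed.

Let g_continuous y t : 0 < t -> {for t, continuous (g y)}.
Proof. by move=> t0; exact: is_deriv_continuous (g_deriv y t0). Qed.

Let g_ge0 y t : 0 <= g y t.
Proof. by rewrite mulr_ge0 ?powR_ge0 ?expR_ge0. Qed.

Let expR_half_integrable (C : R) : 0 <= C ->
  mu.-integrable `]0, +oo[ (EFin \o (fun t => C * expR (- t / 2))).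
Proof.
move=> C0.
have de t : is_derive t 1 (fun t => expR (- t / 2)) (- expR (- t / 2) / 2).
  apply: is_deriv_eq (is_deriv_exp (f := fun t => - t / 2) (is_deriv_mul
    (is_deriv_opp (is_deriv_id t)) (is_deriv_cst 2^-1 t))) _.
  by field.
have dC c t : is_derive t 1 (fun t => c * expR (- t / 2)) (- c / 2 * expR (- t / 2)).
  by apply: is_deriv_eq (is_deriv_mul (is_deriv_cst c t) (de t)) _; ring.
apply: (@ge0_integrable_pos _ _ (fun t => - 2 * C * expR (- t / 2)) (- 2 * C) 0).
- by move=> t _; rewrite mulr_ge0// expR_ge0.
- by move=> t _; exact: is_deriv_continuous (dC C t).
- by move=> t _; apply: is_deriv_eq (dC (- 2 * C) t) _; field.
- apply: cvg_at_right_filter.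
  have := is_deriv_continuous (dC (- 2 * C) 0).
  by rewrite /prop_for /continuous_at oppr0 mul0r expR0 mulr1.
- have e0 : expR (- t / 2) @[t --> +oo] --> (0 : R).
    have := powR_expR_cvgy (R := R) 0 (ltr0n R 2).
    by under eq_fun do rewrite powRr0 mul1r.
  by refine (cvg_to_eq (cvg_mull (- 2 * C) e0) _); rewrite mulr0.
Qed.

Lemma Gamma_integrable_pos y : 0 < y -> mu.-integrable `]0, +oo[ (EFin \o g y).
Proof.
move=> y0; pose C := (y * 2) `^ y * expR (- y).
have C0 : 0 <= C by rewrite mulr_ge0 ?powR_ge0 ?expR_ge0.
have mD : measurable (`]0%R, +oo[%classic : set (measurableTypeR R)) by exact: measurable_itv.
apply: (le_integrable _ _ _ (expR_half_integrable C0)) => //.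
  by apply/measurable_EFinP; apply: measurable_pos; exact: g_continuous.
move=> t; rewrite /= in_itv/= andbT => t0; rewrite lee_fin.
apply: le_trans (ler_norm _); rewrite ger0_norm ?g_ge0//.
have tE : - t = - t / 2 + - t / 2 by field.
by rewrite /g [X in _ * expR X <= _]tE expRD mulrA ler_wpM2r ?expR_ge0// powR_expR_le_max.
Qed.

Let GammaE y : Gamma (y + 1) = \int[mu]_(t in `]0%R, +oo[) g y t.
Proof. by rewrite /Gamma addrK. Qed.

Let g_cvg0 y : 0 < y -> g y t @[t --> 0^'+] --> 0.
Proof.
move=> y0; apply: (@cvg0_le _ _ _ _ _ (fun x => x `^ y) 1); last exact: powR_cvg0.
near=> t; have t0 : 0 < t by near: t; exact: nbhs_right_gt.
rewrite ger0_norm ?g_ge0// mul1r ler_piMr ?powR_ge0//.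
by rewrite -[leRHS]expR0 ler_expR oppr_le0 ltW.
Unshelve. all: by end_near. Qed.

Let g_cvgy y : g y t @[t --> +oo] --> 0.
Proof.
have := powR_expR_cvgy (R := R) y ltr01.
by under eq_fun do rewrite divr1.
Qed.

Lemma Gamma_succ y : 0 < y -> Gamma (y + 1 + 1) = (y + 1) * Gamma (y + 1).
Proof.
move=> y0; have y10 : 0 < y + 1 by rewrite addr_gt0.
have mD : measurable (`]0%R, +oo[%classic : set (measurableTypeR R)) by exact: measurable_itv.
have i0 := Gamma_integrable_pos y0; have i1 := Gamma_integrable_pos y10.
have iZ : mu.-integrable `]0, +oo[ (EFin \o (fun t => (y + 1) * g y t)).
  exact: (integrableZl mD (y + 1) i0).
have d t : 0 < t -> is_derive t 1 (g (y + 1)) ((y + 1) * g y t - g (y + 1) t).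
  by move=> t0; have := g_deriv (y + 1) t0; rewrite addrK.
have c t : 0 < t -> {for t, continuous (fun t => (y + 1) * g y t - g (y + 1) t)}.
  move=> t0; apply: continuousB; last exact: g_continuous.
  by apply: continuousM; [exact: cst_continuous|exact: g_continuous].
have := FTC_pos (integrableB mD iZ i1) c d (g_cvg0 y10) (g_cvgy (y + 1)).
move/(congr1 fine); rewrite [X in X = _ -> _](RintegralB mD iZ i1) (RintegralZl (y + 1) mD i0) /= subrr.
by rewrite -!GammaE => /eqP; rewrite subr_eq0 => /eqP ->.
Qed.

Lemma ln1D_ge (v : R) : 0 <= v -> v - v ^+ 2 / 2 <= ln (1 + v).
Proof.
move=> v0; rewrite -subr_ge0.
pose f (w : R) := ln (1 + w) - (w - w ^+ 2 / 2).
have d w : 0 <= w <= v -> is_derive w 1 f (w ^+ 2 / (1 + w)).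
  move=> /andP[w0 _]; have w1 : 0 < 1 + w by lra.
  apply: is_deriv_eq (is_deriv_sub (is_deriv_ln (f := fun w => 1 + w) w1
     (is_deriv_add (is_deriv_cst 1 w) (is_deriv_id w)))
     (is_deriv_sub (is_deriv_id w) (is_deriv_mul (is_deriv_mul (is_deriv_id w) (is_deriv_id w))
     (is_deriv_cst 2^-1 w)))) _.
  by field; rewrite gt_eqF.
have f0 : f 0 = 0 by rewrite /f addr0 ln1 expr0n/= mul0r !subr0.
rewrite -f0; apply: nondecr_of_deriv v0 d _ => w /andP[w0 _].
by rewrite divr_ge0 ?sqr_ge0// addr_ge0.
Qed.

Lemma ln1B_ge (v : R) : 0 <= v -> v < 1 -> - v - v ^+ 2 / (2 * (1 - v)) <= ln (1 - v).
Proof.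
move=> v0 v1; rewrite -subr_ge0.
pose f (w : R) := ln (1 - w) - (- w - w ^+ 2 / (2 * (1 - w))).
have d w : 0 <= w <= v -> is_derive w 1 f (w ^+ 2 / (2 * (1 - w) ^+ 2)).
  move=> /andP[w0 wv]; have w1 : 0 < 1 - w by lra.
  have w2 : 2 * (1 - w) != 0 by rewrite mulf_neq0 ?gt_eqF.
  have d1 := is_deriv_sub (is_deriv_cst 1 w) (is_deriv_id w).
  have d2 := is_deriv_mul (is_deriv_cst 2 w) d1.
  have d3 := is_deriv_mul (is_deriv_id w) (is_deriv_id w).
  apply: is_deriv_eq (is_deriv_sub (is_deriv_ln (f := fun w => 1 - w) w1 d1)
     (is_deriv_sub (is_deriv_opp (is_deriv_id w))
     (is_deriv_div (g := fun w => 2 * (1 - w)) w2 d3 d2))) _.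
  by field; rewrite ?w2 ?gt_eqF.
have f0 : f 0 = 0 by rewrite /f subr0 ln1 expr0n/= mul0r !(oppr0, addr0).
rewrite -f0; apply: nondecr_of_deriv v0 d _ => w _.
by rewrite divr_ge0 ?sqr_ge0// mulr_ge0 ?sqr_ge0.
Qed.

Let Psi := primitive (@gauss_fun R).

Let gauss_integrable : mu.-integrable `[0, +oo[ (EFin \o gauss_fun).
Proof. by apply: integrableS (@integrableT_gauss R). Qed.

Let Psi_deriv x : 0 < x -> is_derive x 1 Psi (expR (- x ^+ 2)).
Proof. by move=> x0; apply: primitive_deriv => //; exact: continuous_gauss_fun. Qed.

Let Psi_cvg0 : Psi x @[x --> 0^'+] --> 0.
Proof. exact: primitive_cvg0. Qed.

Let Psi_cvgy : Psi x @[x --> +oo] --> Num.sqrt pi / 2.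
Proof.
by have := primitive_cvgy gauss_integrable; rewrite /Rintegral integral0y_gauss.
Qed.

Let Psi_le x : 0 < x -> Psi x <= x.
Proof.
move=> x0; rewrite -subr_ge0.
apply: (ge0_of_incr_cvg0 (f := fun x => x - Psi x) (df := fun x => 1 - expR (- x ^+ 2))) => //.
- by move=> t t0; exact: is_deriv_sub (is_deriv_id t) (Psi_deriv t0).
- by move=> t _; rewrite subr_ge0 -[leRHS]expR0 ler_expR oppr_le0 sqr_ge0.
- refine (cvg_to_eq (cvg_sub _ Psi_cvg0) (subrr 0)).
  by apply: cvg_at_right_filter; exact: cvg_id.
Qed.

(** * Laplace's method for the Gamma integral *)

Section Laplace.
Variable y : R.
Hypothesis y0 : 0 < y.

Let A := primitive (g y).
(** The Gaussian width at the maximum [y] of the integrand: with [v = r u / y] one has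
    [y v^2 / 2 = u^2]. *)
Let r := Num.sqrt (2 * y).
Let c := r * g y y.

Let r0 : 0 < r. Proof. by rewrite sqrtr_gt0 mulr_gt0. Qed.
Let r2 : r ^+ 2 = 2 * y. Proof. by rewrite sqr_sqrtr// mulr_ge0// ltW. Qed.

Let g_integrable : mu.-integrable `[0, +oo[ (EFin \o g y).
Proof. by apply: integrable_obnd_cbnd; exact: Gamma_integrable_pos. Qed.

Let A_deriv x : 0 < x -> is_derive x 1 A (g y x).
Proof. by move=> x0; apply: primitive_deriv => //; exact: g_continuous. Qed.

Let A_cvgy : A x @[x --> +oo] --> Gamma (y + 1).
Proof.
refine (cvg_to_eq (primitive_cvgy g_integrable) _).
by rewrite GammaE Rintegral_itv_obnd_cbnd//; exact: Gamma_integrable_pos.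
Qed.

Let A_ge0 x : 0 <= A x.
Proof. by apply: Rintegral_ge0 => t _; exact: g_ge0. Qed.

Let A_le x : 0 < x -> A x <= Gamma (y + 1).
Proof.
move=> x0; rewrite -subr_ge0.
apply: (ge0_of_decr_cvgy (m := 0) (f := fun x => Gamma (y + 1) - A x)
  (df := fun x => 0 - g y x)) => //.
- by move=> t t0; apply: is_deriv_sub (A_deriv t0); exact: is_deriv_cst.
- by move=> t _; rewrite sub0r oppr_le0 g_ge0.
- by refine (cvg_to_eq (cvg_sub (cvg_cst (Gamma (y + 1))) A_cvgy) _); rewrite subrr.
Qed.

(** Exactly, [g y (y (1 + v)) = g y y * exp (y (ln (1 + v) - v))]. *)
Let g_scaled (v q : R) : 0 < 1 + v -> q <= y * (ln (1 + v) - v) ->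
  g y y * expR q <= g y (y * (1 + v)).
Proof.
move=> v1 qle; have yv : 0 < y * (1 + v) by rewrite mulr_gt0.
rewrite /g !powRE// -!expRD ler_expR lnM ?posrE//; lra.
Qed.

Let A_shift_deriv (s u : R) : 0 < y + s * u ->
  is_derive u 1 (fun u => A (y + s * u)) (s * g y (y + s * u)).
Proof.
move=> yu0.
have d : is_derive u 1 (fun u : R => y + s * u) s.
  apply: is_deriv_eq (is_deriv_add (is_deriv_cst y u)
    (is_deriv_mul (is_deriv_cst s u) (is_deriv_id u))) _; ring.
by apply: is_deriv_eq (is_deriv_comp (g := fun u => y + s * u) (A_deriv yu0) d) _; rewrite mulrC.
Qed.

Let A_shift_cvg0 (s : R) : A (y + s * u) @[u --> 0^'+] --> A y.
Proof.
apply: cvg_at_right_filter.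
have yu0 : 0 < y + s * 0 by rewrite mulr0 addr0.
have := is_deriv_continuous (A_shift_deriv yu0).
by rewrite /prop_for /continuous_at mulr0 addr0.
Qed.

(** To the right of the maximum [ln (1 + v) - v >= - v^2 / 2], so the integrand dominates the full
    Gaussian and nothing is lost. Comparing derivatives in [u] replaces a change of variables. *)
Let laplace_right : c * (Num.sqrt pi / 2) <= Gamma (y + 1) - A y.
Proof.
have cP : c * Psi x @[x --> +oo] --> c * (Num.sqrt pi / 2) by exact: cvg_mull Psi_cvgy.
apply: (cvgr_to_le cP); near=> u.
have u0 : 0 < u by near: u; apply: nbhs_pinfty_gt; exact: num_real.
have shift_gt0 z : 0 < z -> 0 < y + r * z by move=> z0; rewrite addr_gt0// mulr_gt0.
apply: (@le_trans _ _ (A (y + r * u) - A y)); last by rewrite lerD2r A_le// shift_gt0.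
rewrite -subr_ge0.
apply: (ge0_of_incr_cvg0 (f := fun u => A (y + r * u) - A y - c * Psi u)
  (df := fun u => r * g y (y + r * u) - 0 - (0 * Psi u + c * expR (- u ^+ 2)))) => //.
- move=> z z0; apply: is_deriv_sub; last exact: is_deriv_mul (is_deriv_cst c z) (Psi_deriv z0).
  by apply: is_deriv_sub (is_deriv_cst (A y) z); apply: A_shift_deriv; exact: shift_gt0.
- move=> z z0; rewrite subr0 mul0r add0r subr_ge0 /c -mulrA ler_pM2l//.
  have -> : y + r * z = y * (1 + r * z / y) by field; rewrite gt_eqF.
  have v0 : 0 < r * z / y by rewrite divr_gt0// mulr_gt0.
  apply: g_scaled; first by rewrite addr_gt0.
  have := ler_wpM2l (ltW y0) (ln1D_ge (ltW v0)).
  rewrite mulrBr mulrBr.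
  have -> : y * ((r * z / y) ^+ 2 / 2) = z ^+ 2.
    by rewrite exprMn exprMn r2; field; rewrite gt_eqF.
  lra.
- refine (cvg_to_eq (cvg_sub (cvg_sub (A_shift_cvg0 r) (cvg_cst (A y))) (cvg_mull c Psi_cvg0)) _).
  by rewrite subrr mulr0 subrr.
Unshelve. all: by end_near. Qed.

(** To the left the quadratic bound on the logarithm degenerates as [v] approaches 1. The range is
    cut at [v <= 1 - k], where the exponent is at least [- (u / k)^2]; the narrower Gaussian costs
    the factor [k]. *)
Let laplace_left (k b : R) : 0 < k -> k < 1 -> 0 < b -> r * (k * b) <= (1 - k) * y ->
  c * (k * Psi b) <= A y.
Proof.
move=> k0 k1 b0 rb.
apply: (@le_trans _ _ (A y - A (y + - r * (k * b)))); last by rewrite lerBlDr lerDl A_ge0.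
rewrite -subr_ge0.
have kb0 : 0 < k * b by rewrite mulr_gt0.
have v_le z : z <= k * b -> r * z / y <= 1 - k.
  move=> zb; rewrite ler_pdivrMr//; apply: le_trans rb; by rewrite ler_pM2l.
have shiftE z : y + - r * z = y * (1 - r * z / y) by field; rewrite gt_eqF.
have shift_gt0 z : z <= k * b -> 0 < y + - r * z.
  move=> zb; rewrite shiftE mulr_gt0//; have := v_le _ zb; lra.
have dP (z : R) : 0 < z -> is_derive z 1 (fun z : R => Psi (z / k)) (expR (- (z / k) ^+ 2) / k).
  move=> z0; have zk0 : 0 < z / k by rewrite divr_gt0.
  have d : is_derive z 1 (fun z : R => z / k) k^-1.
    by apply: is_deriv_eq (is_deriv_mul (is_deriv_id z) (is_deriv_cst k^-1 z)) _; ring.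
  exact: (is_deriv_comp (g := fun z => z / k) (Psi_deriv zk0) d).
rewrite [c * _]mulrA (_ : Psi b = Psi (k * b / k)); last by rewrite mulrAC divff ?gt_eqF// mul1r.
apply: (ge0_at_of_incr_cvg0 (f := fun u => A y - A (y + - r * u) - c * k * Psi (u / k))
  (df := fun u => 0 - (- r * g y (y + - r * u)) -
    (0 * Psi (u / k) + c * k * (expR (- (u / k) ^+ 2) / k))) kb0).
- move=> z z0 zb.
  apply: is_deriv_sub; last exact: is_deriv_mul (is_deriv_cst (c * k) z) (dP z z0).
  apply: is_deriv_sub (is_deriv_cst (A y) z) _.
  by apply: A_shift_deriv; exact: shift_gt0.
- move=> z z0 zb; rewrite mul0r !add0r mulNr opprK subr_ge0.
  rewrite (_ : c * k * _ = r * (g y y * expR (- (z / k) ^+ 2))); last first.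
    by rewrite /c; field; rewrite gt_eqF.
  rewrite ler_pM2l// shiftE.
  have v0 : 0 < r * z / y by rewrite divr_gt0// mulr_gt0.
  have vk := v_le _ zb; have v1 : r * z / y < 1 by lra.
  have vk0 : 0 < 1 - r * z / y by lra.
  apply: (g_scaled (v := - (r * z / y))); first by lra.
  have := ler_wpM2l (ltW y0) (ln1B_ge (ltW v0) v1).
  have le1 : y * ((r * z / y) ^+ 2 / (2 * (1 - r * z / y))) <= (z / k) ^+ 2.
    rewrite (_ : y * _ = z ^+ 2 / (1 - r * z / y)); last first.
      have v2 : (r * z / y) ^+ 2 = 2 * z ^+ 2 / y.
        by rewrite exprMn exprMn r2; field; rewrite gt_eqF.
      rewrite v2; move: (r * z / y) vk0 => v vk0.
      by field; rewrite !gt_eqF.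
    (* What remains is [k^2 <= k <= 1 - v]. *)
    rewrite exprMn ler_wpM2l ?sqr_ge0// exprVn lef_pV2 ?posrE ?exprn_gt0//.
    apply: (@le_trans _ _ k); last by lra.
    by rewrite expr2 ler_piMr// ltW.
  lra.
- have P0 : Psi (u / k) @[u --> 0^'+] --> 0.
    apply: (@cvg0_le _ _ _ _ _ (fun u => u) k^-1); last first.
      by apply: cvg_at_right_filter; exact: cvg_id.
    near=> u; have u0 : 0 < u by near: u; exact: nbhs_right_gt.
    rewrite ger0_norm; last by apply: Rintegral_ge0 => t _; exact: expR_ge0.
    by rewrite [leRHS]mulrC Psi_le// divr_gt0.
  refine (cvg_to_eq (cvg_sub (cvg_sub (cvg_cst (A y)) (A_shift_cvg0 (- r))) (cvg_mull (c * k) P0)) _).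
  by rewrite subrr mulr0 subrr.
Unshelve. all: by end_near. Qed.

Lemma Gamma_laplace (k b : R) : 0 < k -> k < 1 -> 0 < b ->
  Num.sqrt (2 * y) * (k * b) <= (1 - k) * y ->
  Num.sqrt (2 * y) * (y `^ y * expR (- y)) * (Num.sqrt pi / 2 + k * primitive gauss_fun b) <=
  Gamma (y + 1).
Proof.
move=> k0 k1 b0 rb; rewrite -/r -/Psi mulrDr.
have := laplace_right; have := laplace_left k0 k1 b0 rb; rewrite /c /g; lra.
Qed.

End Laplace.

End GammaFunction.

(** * Robbins' lower bound and the maximum of the density *)

Section Robbins.
Context {R : realType}.
Notation mu := (@lebesgue_measure R).
Implicit Types x y t : R.

(** This is the convexity needed in the next lemma. With [s = x (x + 1)] and
    [q = (12 x + 1) (12 x + 13)], clearing denominators leaves [(144 s)^2 (48 + q) <= q^3], and [q]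
    exceeds [144 s] by the linear polynomial [r]. *)
Lemma robbins_poly x : 0 < x ->
  288 / (12 * x + 1) ^+ 3 - 288 / (12 * x + 13) ^+ 3 <= 1 / (2 * (x * (x + 1)) ^+ 2).
Proof.
move=> x0; rewrite -subr_ge0.
pose s := x * (x + 1); pose v := 12 * x + 1; pose q := v * (v + 12).
have v0 : 0 < v by rewrite /v; lra.
have s0 : 0 < s by rewrite mulr_gt0//; lra.
have q0 : 0 < q by rewrite mulr_gt0//; lra.
rewrite -/s -/v (_ : 12 * x + 13 = v + 12); last by rewrite /v; ring.
rewrite (_ : _ - _ = (q ^+ 3 - (144 * s) ^+ 2 * (48 + q)) / (2 * s ^+ 2 * q ^+ 3)); last first.
  by rewrite /q; field; rewrite !gt_eqF//; lra.
apply: divr_ge0; last by apply/ltW; rewrite mulr_gt0 ?exprn_gt0// mulr_gt0 ?exprn_gt0.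
pose r := 24 * x + 13.
have -> : q = 144 * s + r by rewrite /q /s /v /r; ring.
have -> : (144 * s + r) ^+ 3 - (144 * s) ^+ 2 * (48 + (144 * s + r)) =
    144 * s * (2 * (144 * s) * (r - 24) + 3 * r ^+ 2) + r ^+ 3 by ring.
have r0 : 0 <= r by rewrite /r; lra.
apply: addr_ge0; last exact: exprn_ge0.
apply: mulr_ge0; first by apply: mulr_ge0; [exact: ler0n|exact: ltW].
(* Since [r - 24] is negative for small [x], the nonnegativity is made visible by completing a
   square. *)
have -> : 2 * (144 * s) * (r - 24) + 3 * r ^+ 2 =
    48 * (144 * (x * x ^+ 2) + 87 * x ^+ 2) + 81 * (4 * x - 2) ^+ 2 + 183.
  by rewrite /s /r; ring.
have x30 : 0 <= x * x ^+ 2 by rewrite mulr_ge0 ?sqr_ge0// ltW.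
have := sqr_ge0 x; have := sqr_ge0 (4 * x - 2).
lra.
Qed.

(* The difference of the two sides is convex, and it tends to 0 at +oo together
   with its derivative. *)
Lemma robbins_step x : 0 < x ->
  1 / (12 * x + 1) - 1 / (12 * x + 13) <= (x + 2^-1) * (ln (x + 1) - ln x) - 1.
Proof.
move=> x0; rewrite -subr_ge0.
pose D (z : R) := (z + 2^-1) * (ln (z + 1) - ln z) - 1 - (1 / (12 * z + 1) - 1 / (12 * z + 13)).
pose D1 (z : R) := (ln (z + 1) - ln z) + (z + 2^-1) * ((z + 1)^-1 - z^-1) +
  (12 / (12 * z + 1) ^+ 2 - 12 / (12 * z + 13) ^+ 2).
pose D2 (z : R) := 1 / (2 * (z * (z + 1)) ^+ 2) - (288 / (12 * z + 1) ^+ 3 - 288 / (12 * z + 13) ^+ 3).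
have dl (z : R) : 0 < z -> is_derive z 1 (fun z : R => ln (z + 1) - ln z) ((z + 1)^-1 - z^-1).
  move=> z0; have z10 : 0 < z + 1 by lra.
  apply: is_deriv_eq (is_deriv_sub (is_deriv_ln (f := fun z => z + 1) z10
    (is_deriv_add (is_deriv_id z) (is_deriv_cst 1 z))) (is_deriv_ln z0 (is_deriv_id z))) _.
  by ring.
have dz (b z : R) : is_derive z 1 (fun z : R => 12 * z + b) 12.
  apply: is_deriv_eq (is_deriv_add (is_deriv_mul (is_deriv_cst 12 z) (is_deriv_id z))
    (is_deriv_cst b z)) _; ring.
have di (b z : R) : 0 < 12 * z + b ->
    is_derive z 1 (fun z : R => 1 / (12 * z + b)) (- 12 / (12 * z + b) ^+ 2).
  move=> bz; apply: is_deriv_eq (is_deriv_div (g := fun z => 12 * z + b)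
    (lt0r_neq0 bz) (is_deriv_cst 1 z) (dz b z)) _.
  by rewrite mul0r sub0r mul1r mulNr.
have di2 (b z : R) : 0 < 12 * z + b ->
    is_derive z 1 (fun z : R => 12 / (12 * z + b) ^+ 2) (- 288 / (12 * z + b) ^+ 3).
  move=> bz; have b2 : (12 * z + b) ^+ 2 != 0 by rewrite expf_neq0// gt_eqF.
  apply: is_deriv_eq (is_deriv_div (g := fun z => (12 * z + b) ^+ 2) b2
    (is_deriv_cst 12 z) (is_deriv_mul (dz b z) (dz b z))) _.
  by field; rewrite gt_eqF.
have dx (z : R) : is_derive z 1 (fun z : R => z + 2^-1) 1.
  by apply: is_deriv_eq (is_deriv_add (is_deriv_id z) (is_deriv_cst 2^-1 z)) _; ring.
have dr (z : R) : 0 < z -> is_derive z 1 (fun z : R => (z + 1)^-1 - z^-1) (z ^- 2 - (z + 1) ^- 2).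
  move=> z0; have z10 : z + 1 != 0 by rewrite gt_eqF//; lra.
  have d1 : is_derive z 1 (fun z : R => z + 1) 1.
    by apply: is_deriv_eq (is_deriv_add (is_deriv_id z) (is_deriv_cst 1 z)) _; ring.
  have e1 := is_deriv_div (g := fun z => z + 1) z10 (is_deriv_cst 1 z) d1.
  have e2 := is_deriv_div (lt0r_neq0 z0) (is_deriv_cst 1 z) (is_deriv_id z).
  have := is_deriv_sub e1 e2.
  under eq_fun do rewrite !mul1r.
  by move=> e; apply: is_deriv_eq e _; field; rewrite z10 gt_eqF.
have dD (z : R) : 0 < z -> is_derive z 1 D (D1 z).
  move=> z0; have a1 : 0 < 12 * z + 1 by lra.
  have a2 : 0 < 12 * z + 13 by lra.
  apply: is_deriv_eq (is_deriv_sub (is_deriv_sub (is_deriv_mul (dx z) (dl z z0)) (is_deriv_cst 1 z))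
    (is_deriv_sub (di 1 z a1) (di 13 z a2))) _.
  by rewrite /D1; ring.
have dD1 (z : R) : 0 < z -> is_derive z 1 D1 (D2 z).
  move=> z0; have a1 : 0 < 12 * z + 1 by lra.
  have a2 : 0 < 12 * z + 13 by lra.
  apply: is_deriv_eq (is_deriv_add (is_deriv_add (dl z z0) (is_deriv_mul (dx z) (dr z z0)))
    (is_deriv_sub (di2 1 z a1) (di2 13 z a2))) _.
  by rewrite /D2; field; rewrite !gt_eqF//=; lra.
have l_le (z : R) : 0 < z -> 0 <= ln (z + 1) - ln z /\
    (z + 1)^-1 <= ln (z + 1) - ln z <= z^-1.
  move=> z0; have z10 : 0 < z + 1 by lra.
  have e1 := ln_le_sub1 (divr_gt0 z10 z0); have e2 := ln_le_sub1 (divr_gt0 z0 z10).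
  rewrite ln_div ?posrE// in e1; rewrite ln_div ?posrE// in e2.
  have i1 : (z + 1) / z - 1 = z^-1 by field; rewrite gt_eqF.
  have i2 : z / (z + 1) - 1 = - (z + 1)^-1 by field; rewrite gt_eqF.
  have : 0 < (z + 1)^-1 by rewrite invr_gt0.
  by rewrite i1 in e1; rewrite i2 in e2; split; [lra|apply/andP; split; lra].
have small (b c : R) (n : nat) (z : R) : 1 <= b -> 0 <= c -> 1 < z -> 0 <= c / (12 * z + b) ^+ n.+1 <= c / z.
  move=> b1 c0 z1; have z0 : 0 < z by lra.
  have zb : z <= 12 * z + b by lra.
  have p0 : 0 < (12 * z + b) ^+ n.+1 by rewrite exprn_gt0//; lra.
  rewrite divr_ge0//=; last exact: ltW.
  rewrite ler_wpM2l// lef_pV2 ?posrE//; apply: le_trans zb _.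
  by rewrite -[leLHS]expr1 ler_weXn2l//; lra.
have D1y : D1 z @[z --> +oo] --> 0.
  (* Each piece of [D1] is of order [1 / z]; 100 is a generous total of their constants. *)
  apply: (@cvg0_le _ _ _ _ _ (fun z => z^-1) 100); last exact: cvg_invy.
  near=> z; have z1 : 1 < z by near: z; apply: nbhs_pinfty_gt; exact: num_real.
  have z0 : 0 < z by lra.
  have [l0 /andP[l1 l2]] := l_le z z0.
  have /andP[s1 s1'] := small 1 12 1%N z (lexx _) (ler0n _ 12) z1.
  have /andP[s2 s2'] := small 13 12 1%N z (ler1n _ 13) (ler0n _ 12) z1.
  have r1 : (z + 2^-1) * ((z + 1)^-1 - z^-1) = - (1 / 2 / z + 1 / 2 / (z + 1)).
    by field; rewrite !gt_eqF//; lra.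
  have i0 : 0 < (z + 1)^-1 by rewrite invr_gt0; lra.
  have i1 : (z + 1)^-1 <= z^-1 by rewrite lef_pV2 ?posrE; lra.
  rewrite /D1 r1 ler_norml; apply/andP; split; lra.
have D1_le0 (z : R) : 0 < z -> D1 z <= 0.
  move=> z0; rewrite -oppr_ge0.
  apply: (ge0_of_decr_cvgy (m := 0) (f := fun z => - D1 z) (df := fun z => - D2 z)) => //.
  - by move=> t t0; exact: is_deriv_opp (dD1 t t0).
  - by move=> t t0; rewrite oppr_le0 subr_ge0; exact: robbins_poly.
  - by refine (cvg_to_eq (cvgN D1y) _); rewrite oppr0.
apply: (ge0_of_decr_cvgy (m := 0) (f := D) dD) => //.
apply: (@cvg0_le _ _ _ _ _ (fun z => z^-1) 100); last exact: cvg_invy.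
near=> z; have z1 : 1 < z by near: z; apply: nbhs_pinfty_gt; exact: num_real.
have z0 : 0 < z by lra.
have [l0 /andP[l1 l2]] := l_le z z0.
have /andP[s1 s1'] := small 1 1 0%N z (lexx _) ler01 z1.
have /andP[s2 s2'] := small 13 1 0%N z (ler1n _ 13) ler01 z1.
rewrite !expr1 in s1 s1' s2 s2'.
have zh : 0 <= z + 2^-1 by lra.
have := ler_wpM2l zh l1; have := ler_wpM2l zh l2.
have -> : (z + 2^-1) / z = 1 + 1 / 2 / z by field; rewrite gt_eqF.
have -> : (z + 2^-1) / (z + 1) = 1 - 1 / 2 / (z + 1) by field; rewrite gt_eqF//; lra.
have i1 : (z + 1)^-1 <= z^-1 by rewrite lef_pV2 ?posrE; lra.
move=> u1 u2; rewrite /D ler_norml; apply/andP; split; lra.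
Unshelve. all: by end_near. Qed.

(** The logarithm of [Gamma (y + 1)] over its Robbins approximation without the factor
    [sqrt (2 pi)]. Under a unit shift the correction becomes [1 / (12 y + 13)], which matches
    [robbins_step]. *)
Definition log_gamma_ratio y : R :=
  ln (Gamma (y + 1)) - (y + 2^-1) * ln y + y - 1 / (12 * y + 1).

Let Psi_cvgy : primitive gauss_fun x @[x --> +oo] --> (Num.sqrt pi / 2 : R).
Proof.
have i : mu.-integrable `[0, +oo[ (EFin \o gauss_fun).
  by apply: integrableS (@integrableT_gauss R).
by have := primitive_cvgy i; rewrite /Rintegral integral0y_gauss.
Qed.

Let scale_gt0 y : 0 < y -> 0 < Num.sqrt (2 * y) * (y `^ y * expR (- y)).
Proof.
by move=> y0; rewrite !mulr_gt0 ?sqrtr_gt0 ?powR_gt0 ?expR_gt0// mulr_gt0.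
Qed.

(** No law is at hand here; positivity comes from the Laplace bound with [k = 1/2] and the largest
    admissible [b]. *)
Lemma Gamma_gt0 y : 0 < y -> 0 < Gamma (y + 1).
Proof.
move=> y0; have r0 : 0 < Num.sqrt (2 * y) by rewrite sqrtr_gt0 mulr_gt0.
pose b := (1 - 2^-1) * y / (Num.sqrt (2 * y) * 2^-1).
have b0 : 0 < b by rewrite divr_gt0// mulr_gt0//; lra.
have h0 : 0 < (2^-1 : R) by lra.
have h1 : (2^-1 : R) < 1 by lra.
apply: lt_le_trans (Gamma_laplace y0 h0 h1 b0 _); last first.
  by rewrite /b mulrA le_eqVlt; apply/orP; left; apply/eqP; field; rewrite gt_eqF.
rewrite mulr_gt0 ?scale_gt0// ltr_pwDl//; first by rewrite divr_gt0// sqrtr_gt0 pi_gt0.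
by rewrite mulr_ge0// Rintegral_ge0// => t _; exact: expR_ge0.
Qed.

Let log_gamma_ratio_step y : 0 < y -> log_gamma_ratio (y + 1) <= log_gamma_ratio y.
Proof.
move=> y0; have y10 : 0 < y + 1 by lra.
rewrite /log_gamma_ratio Gamma_succ// lnM ?posrE ?Gamma_gt0//.
have := robbins_step y0.
rewrite (_ : 12 * (y + 1) + 1 = 12 * y + 13); last by ring.
lra.
Qed.

Let log_gamma_ratio_iter y n : 0 < y -> log_gamma_ratio (y + n%:R) <= log_gamma_ratio y.
Proof.
move=> y0; elim: n => [|n]; first by rewrite addr0.
apply: le_trans; rewrite -natr1 addrA log_gamma_ratio_step//.
by rewrite ltr_wpDr.
Qed.

Let scaleE y : 0 < y -> Num.sqrt (2 * y) * (y `^ y * expR (- y)) =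
  Num.sqrt 2 * expR ((y + 2^-1) * ln y - y).
Proof.
move=> y0; rewrite sqrtrM// -mulrA; congr (_ * _).
rewrite -powR12_sqrt ?(ltW y0)// /powR gt_eqF// -!expRD; congr expR; ring.
Qed.

(** The ratio does not increase along [y, y + 1, y + 2, ...], so it may be bounded from below far
    out, where the Laplace bound applies to any fixed [k] and [b] and the Robbins correction is
    negligible. *)
Let limit_bound y (k b : R) : 0 < y -> 0 < k -> k < 1 -> 0 < b ->
  Num.sqrt 2 * (Num.sqrt pi / 2 + k * primitive gauss_fun b) <= expR (log_gamma_ratio y).
Proof.
move=> y0 k0 k1 b0; set X := Num.sqrt 2 * _.
have X0 : 0 <= X.
  rewrite mulr_ge0 ?addr_ge0 ?divr_ge0 ?sqrtr_ge0 ?mulr_ge0//; first exact: ltW.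
  by rewrite Rintegral_ge0// => t _; exact: expR_ge0.
apply/ler_addgt0Pr => e e0.
(* The first term secures the range condition of the Laplace bound, the second makes the correction
   cost at most [e]. *)
pose M := 2 * (k * b) ^+ 2 / (1 - k) ^+ 2 + X / e.
have M0 : 0 <= M.
  apply: addr_ge0; apply: divr_ge0 => //; [|exact: sqr_ge0|exact: ltW].
  by apply: mulr_ge0 => //; exact: sqr_ge0.
pose n := Num.bound M; have Mn : M < n%:R := archi_boundP M0.
pose z := y + n%:R; have Mz : M < z by rewrite /z; lra.
have z0 : 0 < z by exact: le_lt_trans Mz.
have kp : 0 < (1 - k) ^+ 2 by rewrite exprn_gt0// subr_gt0.
have zb : Num.sqrt (2 * z) * (k * b) <= (1 - k) * z.
  have kb0 : 0 <= k * b by rewrite mulr_ge0// ltW.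
  have kz0 : 0 <= (1 - k) * z by rewrite mulr_ge0 ?subr_ge0// ltW.
  rewrite -(@ler_pXn2r _ 2) ?nnegrE ?(mulr_ge0 (sqrtr_ge0 _) kb0)//.
  rewrite exprMn sqr_sqrtr ?mulr_ge0 ?(ltW z0)// [leRHS]exprMn.
  have : 2 * (k * b) ^+ 2 / (1 - k) ^+ 2 <= z.
    by apply: le_trans (ltW Mz); rewrite lerDl divr_ge0// ltW.
  rewrite ler_pdivrMr// => /(ler_wpM2l (ltW z0)); lra.
have := Gamma_laplace z0 k0 k1 b0 zb; rewrite scaleE// mulrAC -/X => L.
have Le : X * expR (- (1 / (12 * z + 1))) <= expR (log_gamma_ratio z).
  rewrite /log_gamma_ratio.
  have -> : ln (Gamma (z + 1)) - (z + 2^-1) * ln z + z - 1 / (12 * z + 1) =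
    ln (Gamma (z + 1)) - ((z + 2^-1) * ln z - z) + - (1 / (12 * z + 1)) by ring.
  rewrite expRD ler_wpM2r ?expR_ge0// expRD lnK ?posrE ?Gamma_gt0//.
  by rewrite expRN ler_pdivlMr ?expR_gt0.
have Lz : X * expR (- (1 / (12 * z + 1))) <= expR (log_gamma_ratio y).
  by apply: le_trans Le _; rewrite ler_expR log_gamma_ratio_iter.
have e1 := expR_ge1Dx (- (1 / (12 * z + 1))).
have := le_trans (ler_wpM2l X0 e1) Lz.
have Xe : X / (12 * z + 1) <= e.
  have z1 : 0 < 12 * z + 1 by lra.
  rewrite ler_pdivrMr// mulrC -ler_pdivrMr//.
  apply: (@le_trans _ _ z); last by lra.
  apply: le_trans (ltW Mz); rewrite lerDr; apply: divr_ge0; last exact: sqr_ge0.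
  by apply: mulr_ge0 => //; exact: sqr_ge0.
lra.
Qed.

(* Robbins' refinement of Stirling's formula, at a real argument. *)
Lemma Gamma_ge_stirling y : 0 < y ->
  Num.sqrt (2 * pi * y) * (y `^ y * expR (- y)) * expR (1 / (12 * y + 1)) <= Gamma (y + 1).
Proof.
move=> y0.
have lim1 (k : R) : 0 < k -> k < 1 ->
    Num.sqrt 2 * (Num.sqrt pi / 2 + k * (Num.sqrt pi / 2)) <= expR (log_gamma_ratio y).
  move=> k0 k1.
  have c : Num.sqrt 2 * (Num.sqrt pi / 2 + k * primitive gauss_fun x) @[x --> +oo] -->
      (Num.sqrt 2 * (Num.sqrt pi / 2 + k * (Num.sqrt pi / 2)) : R).
    exact: cvg_mull (cvg_add (cvg_cst (Num.sqrt pi / 2 : R)) (cvg_mull k Psi_cvgy)).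
  apply: (cvgr_to_le c); near=> b.
  have b0 : 0 < b by near: b; apply: nbhs_pinfty_gt; exact: num_real.
  exact: limit_bound.
(* After [b] has been sent to +oo, [k = 1 - t] tends to 1 and both halves of the Gaussian are
   recovered. *)
have lim2 : Num.sqrt 2 * Num.sqrt pi <= expR (log_gamma_ratio y).
  apply/ler_addgt0Pr => e e0.
  have S0 : 0 < Num.sqrt 2 * Num.sqrt pi :> R by rewrite mulr_gt0 ?sqrtr_gt0 ?pi_gt0.
  pose t := Num.min (2^-1) (e / (Num.sqrt 2 * Num.sqrt pi)).
  have t0 : 0 < t by rewrite lt_min divr_gt0//; lra.
  have t1 : t <= 2^-1 by rewrite ge_min lexx.
  have te : t * (Num.sqrt 2 * Num.sqrt pi) <= e by rewrite -ler_pdivlMr// ge_min lexx orbT.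
  have k0 : 0 < 1 - t by lra.
  have k1 : 1 - t < 1 by lra.
  by have := lim1 _ k0 k1; lra.
have L : expR (log_gamma_ratio y) * (expR ((y + 2^-1) * ln y - y) * expR (1 / (12 * y + 1))) =
    Gamma (y + 1).
  rewrite -!expRD -[RHS]lnK ?posrE ?Gamma_gt0//; congr expR.
  by rewrite /log_gamma_ratio; ring.
rewrite -[leRHS]L [2 * pi * y]mulrAC sqrtrM ?mulr_ge0 ?(ltW y0)//.
rewrite (_ : Num.sqrt (2 * y) * Num.sqrt pi * _ =
  Num.sqrt pi * (Num.sqrt (2 * y) * (y `^ y * expR (- y)))); last by ring.
rewrite scaleE// mulrA [Num.sqrt pi * _]mulrC -[leLHS]mulrA ler_wpM2r// mulr_ge0 ?expR_ge0.
Unshelve. all: by end_near. Qed.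

Lemma gamma_pdf_le (a b x : R) : 1 < a -> 0 < b ->
  gamma_pdf a b x <= (b * Num.sqrt (2 * pi * (a - 1)) * expR (1 / (12 * a - 11)))^-1.
Proof.
move=> a1 b0; have m0 : 0 < a - 1 by rewrite subr_gt0.
set rho := b * _ * _.
have rho0 : 0 < rho.
  by rewrite !mulr_gt0 ?expR_gt0 ?sqrtr_gt0 ?mulr_gt0 ?pi_gt0.
have [x0|x0] := lerP x 0; first by rewrite gamma_pdf_le0// invr_ge0 ltW.
have G0 := Gamma_gt0 m0; rewrite subrK in G0.
have ba0 : 0 < b `^ a by rewrite powR_gt0.
have S := Gamma_ge_stirling m0; rewrite subrK in S.
rewrite (_ : 12 * (a - 1) + 1 = 12 * a - 11) in S; last by ring.
rewrite gamma_pdf_pos// mulrC ler_pdivrMr ?mulr_gt0//.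
apply: le_trans (powR_expR_le_max m0 b0 x0) _.
rewrite ler_pdivlMl// powRM ?(ltW m0) ?(ltW b0)//.
have baE : b `^ a = b * b `^ (a - 1).
  have e1 : a = 1 + (a - 1) by ring.
  by rewrite {1}e1 (@powRD _ b 1) ?(gt_eqF b0) ?implybT// powRr1 ?(ltW b0).
rewrite baE (_ : rho * _ = b * b `^ (a - 1) * (Num.sqrt (2 * pi * (a - 1)) *
  ((a - 1) `^ (a - 1) * expR (- (a - 1))) * expR (1 / (12 * a - 11)))); last by rewrite /rho; ring.
rewrite [Gamma a * _]mulrC ler_wpM2l//.
by rewrite mulr_ge0 ?powR_ge0// ltW.
Qed.

End Robbins.

(** * Smoothing of the Kolmogorov distance *)

Section Smoothing.
Context {R : realType}.
Implicit Types (f : R -> R) (x y z e d : R).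

(** Meant for the squared positive part, which is differentiable at its kink although its two
    branches are different polynomials. *)
Lemma is_deriv_of_quadratic f (l C x : R) :
  (forall y, `|f y - f x - l * (y - x)| <= C * (y - x) ^+ 2) -> is_derive x 1 f l.
Proof.
move=> fC.
have cv : (fun t : R => t^-1 *: ((f \o shift x) (t *: (1 : R)) - f x)) @ 0^' --> l.
  apply/cvgrPdist_le => /= e e0; near=> t.
  have t0 : t != 0 by near: t; exact: nbhs_dnbhs_neq.
  rewrite distrC /= /GRing.scale/= mulr1.
  rewrite (_ : _ - l = t^-1 * (f (t + x) - f x - l * (t + x - x))); last by field.
  rewrite normrM; apply: le_trans (ler_wpM2l (normr_ge0 _) (fC _)) _.
  rewrite addrK normfV -real_normK ?num_real// expr2 mulrCA [_^-1 * _]mulrA mulVf ?normr_eq0// mul1r.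
  have tb : `|t| <= e / (`|C| + 1).
    near: t; apply: dnbhs0_le; by rewrite divr_gt0// ltr_wpDl.
  have C1 : 0 < `|C| + 1 by rewrite ltr_wpDl.
  rewrite ler_pdivlMr// in tb; apply: le_trans tb.
  rewrite mulrC ler_wpM2l//; apply: le_trans (ler_norm C) _; by rewrite lerDl.
split; first by apply/cvg_ex; exists l.
exact: cvg_lim cv.
Unshelve. all: by end_near. Qed.

Let pos x := Num.max 0 x.

Let posE x : (0 <= x /\ pos x = x) \/ (x <= 0 /\ pos x = 0).
Proof.
have [x0|x0] := lerP 0 x; [left|right]; split => //.
  by rewrite /pos; apply/max_idPr.
  exact: ltW.
by rewrite /pos; apply/max_idPl; exact: ltW.
Qed.

Let pos_sqr_deriv x : is_derive x 1 (fun x => pos x ^+ 2 / 2) (pos x).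
Proof.
apply: (@is_deriv_of_quadratic _ _ (1 / 2)) => y.
have s1 := sqr_ge0 x; have s2 := sqr_ge0 y; have s3 := sqr_ge0 (y - x).
have [[x0 ->]|[x0 ->]] := posE x; have [[y0 ->]|[y0 ->]] := posE y;
  rewrite ler_norml; apply/andP; split; nra.
Qed.

(** The height is [e], not 1, so that the slope is -1 and the average over a window lies in [Z1]
    without rescaling. *)
Definition ramp z e x := e - Num.max 0 (x - z) + Num.max 0 (x - z - e).

Let ramp_primitive z e x := e * x - pos (x - z) ^+ 2 / 2 + pos (x - z - e) ^+ 2 / 2.

Let ramp_primitive_deriv z e x : is_derive x 1 (ramp_primitive z e) (ramp z e x).
Proof.
have ds (c : R) : is_derive x 1 (fun x => x - c) 1.
  by apply: is_deriv_eq (is_deriv_sub (is_deriv_id x) (is_deriv_cst c x)) _; rewrite subr0.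
have d1 := is_deriv_comp (g := fun x => x - z) (pos_sqr_deriv (x - z)) (ds z).
have d2' : is_derive x 1 (fun x => x - z - e) 1.
  by apply: is_deriv_eq (is_deriv_sub (ds z) (is_deriv_cst e x)) _; rewrite subr0.
have d2 := is_deriv_comp (g := fun x => x - z - e) (pos_sqr_deriv (x - z - e)) d2'.
apply: is_deriv_eq (is_deriv_add (is_deriv_sub (is_deriv_mul (is_deriv_cst e x) (is_deriv_id x)) d1) d2) _.
by rewrite /ramp /pos; ring.
Qed.

Lemma ramp_decr z e x y : 0 < e -> x <= y -> 0 <= ramp z e x - ramp z e y <= y - x.
Proof.
move=> e0 xy; rewrite /ramp -!/(pos _).
have [[x0 ->]|[x0 ->]] := posE (x - z); have [[y0 ->]|[y0 ->]] := posE (y - z);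
have [[x1 ->]|[x1 ->]] := posE (x - z - e); have [[y1 ->]|[y1 ->]] := posE (y - z - e);
  apply/andP; split; lra.
Qed.

Lemma ramp_cases z e x : 0 < e ->
  [\/ x <= z /\ ramp z e x = e, z <= x <= z + e /\ ramp z e x = z + e - x |
      z + e <= x /\ ramp z e x = 0].
Proof.
move=> e0; rewrite /ramp -!/(pos _).
have [[x0 ->]|[x0 ->]] := posE (x - z); have [[x1 ->]|[x1 ->]] := posE (x - z - e).
- by apply: Or33; split; [lra|ring].
- by apply: Or32; split; [apply/andP; split; lra|ring].
- by exfalso; lra.
- by apply: Or31; split; [lra|ring].
Qed.

Lemma ramp_bounds z e x : 0 < e -> 0 <= ramp z e x <= e.
Proof.
by move=> e0; have [[? ->]|[/andP[? ?] ->]|[? ->]] := ramp_cases z x e0;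
  apply/andP; split; lra.
Qed.

Lemma ramp_continuous z e : 0 < e -> continuous (ramp z e).
Proof.
move=> e0 x; apply/cvgrPdist_le => /= s s0; near=> t.
have ts : `|x - t| <= s by near: t; exact: cvgr_dist_le.
apply: le_trans ts; have [xt|tx] := lerP x t.
  have /andP[r0 r1] := ramp_decr z e0 xt.
  by rewrite ger0_norm// distrC ger0_norm ?subr_ge0.
have /andP[r0 r1] := ramp_decr z e0 (ltW tx).
by rewrite distrC ger0_norm// ger0_norm// subr_ge0 ltW.
Unshelve. all: by end_near. Qed.

(* The average of [ramp z e] over [x, x + d]. *)
Definition smooth_ramp z e d x := (ramp_primitive z e (x + d) - ramp_primitive z e x) / d.

Let smooth_ramp1 z e d x := (ramp z e (x + d) - ramp z e x) / d.

Let smooth_ramp_deriv z e d x : is_derive x 1 (smooth_ramp z e d) (smooth_ramp1 z e d x).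
Proof.
have ds : is_derive x 1 (fun x => x + d) 1.
  by apply: is_deriv_eq (is_deriv_add (is_deriv_id x) (is_deriv_cst d x)) _; rewrite addr0.
have d1 := is_deriv_comp (g := fun x => x + d) (ramp_primitive_deriv z e (x + d)) ds.
apply: is_deriv_eq (is_deriv_mul (is_deriv_sub d1 (ramp_primitive_deriv z e x)) (is_deriv_cst d^-1 x)) _.
by rewrite /smooth_ramp1; ring.
Qed.

Lemma smooth_ramp_Z1 z e d : 0 < e -> 0 < d -> Z1 (smooth_ramp z e d).
Proof.
move=> e0 d0.
have dE : (smooth_ramp z e d)^`()%classic = smooth_ramp1 z e d.
  by apply/funext => x; exact: is_deriv_val (smooth_ramp_deriv z e d x).
split=> [x _|x _|].
- exact: is_deriv_derivable (smooth_ramp_deriv z e d x).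
- rewrite dE; apply: continuousM; last exact: cst_continuous.
  apply: continuousB; last exact: ramp_continuous.
  apply: continuous_comp; last exact: ramp_continuous.
  exact: is_deriv_continuous (is_deriv_add (is_deriv_id x) (is_deriv_cst d x)).
- rewrite /sup_norm_pos dE; apply: ge_ereal_sup => _ [x _ <-]; rewrite lee_fin.
  have xd : x <= x + d by rewrite lerDl ltW.
  have /andP[r0 r1] := ramp_decr z e0 xd.
  rewrite normrM normfV (gtr0_norm d0) ler_pdivrMr// mul1r distrC ger0_norm//.
  by apply: le_trans r1 _; rewrite addrAC subrr add0r.
Qed.

(** The average is a value of the ramp at some point of the window, and the ramp is nonincreasing
    with slope at most 1 in absolute value. The loss [d] is sent to 0 at the very end. *)
Lemma smooth_ramp_bounds z e d x : 0 < e -> 0 < d ->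
  ramp z e x - d <= smooth_ramp z e d x <= ramp z e x.
Proof.
move=> e0 d0; have xd : x <= x + d by rewrite lerDl ltW.
have [c /andP[xc cd] E] := mvt (f := ramp_primitive z e) (df := ramp z e) xd
  (fun y _ => ramp_primitive_deriv z e y).
rewrite /smooth_ramp E (_ : x + d - x = d) ?mulfK ?gt_eqF//; last by ring.
have /andP[r0 r1] := ramp_decr z e0 xc.
apply/andP; split; lra.
Qed.

Lemma smooth_ramp_ge0 z e d x : 0 < e -> 0 < d -> 0 <= smooth_ramp z e d x.
Proof.
move=> e0 d0; have xd : x <= x + d by rewrite lerDl ltW.
have [c /andP[xc cd] E] := mvt (f := ramp_primitive z e) (df := ramp z e) xd
  (fun y _ => ramp_primitive_deriv z e y).
rewrite /smooth_ramp E (_ : x + d - x = d) ?mulfK ?gt_eqF//; last by ring.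
by have /andP[] := ramp_bounds z c e0.
Qed.

Lemma smooth_ramp_continuous z e d : continuous (smooth_ramp z e d).
Proof. by move=> x; exact: is_deriv_continuous (smooth_ramp_deriv z e d x). Qed.

End Smoothing.

(** * Comparison of test expectations with distribution functions *)

Section TestCdf.
Context {R : realType} {d : measure_display} {T : measurableType d}
  (P : probability T R) (X : {RV P >-> R}).

Let ind (z : R) (w : T) : R := \1_(X @^-1` `]-oo, z]) w.

Let mX : measurable_fun [set: T] X := measurable_funPT X.

Let m_pre (z : R) : measurable (X @^-1` `]-oo, z]).
Proof. by rewrite -[X in measurable X]setTI; exact: mX. Qed.

Let m_comp (f : R -> R) : measurable_fun [set: R] f ->
  measurable_fun [set: T] (fun w => (f (X w))%:E).
Proof. by move=> mf; apply/measurable_EFinP; exact: measurableT_comp. Qed.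

Let m_test (f : R -> R) : measurable_fun [set: R] f ->
  measurable_fun [set: T] (fun w => (if 0 < X w then f (X w) else 0)%:E).
Proof.
move=> mf; apply/measurable_EFinP; apply: measurable_fun_if => //.
- by apply: measurable_fun_ltr.
- by apply: measurable_funTS; exact: measurableT_comp.
Qed.

Let int_ind (e z : R) : 0 <= e ->
  (\int[P]_w (e * ind z w)%:E = e%:E * cdf X z)%E.
Proof.
move=> e0; under eq_integral do rewrite EFinM.
rewrite ge0_integralZl_EFin//; last 2 first.
- by move=> w _; rewrite lee_fin.
- by apply/measurable_EFinP; exact: measurable_indic.
by rewrite integral_indic// setIT.
Qed.

Let m_ind (e z : R) : measurable_fun [set: T] (fun w => (e * ind z w)%:E).
Proof.
by apply/measurable_EFinP; apply: measurable_funM => //; exact: measurable_indic.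
Qed.

Variables (f q : R -> R) (e z : R).
Hypotheses (mf : measurable_fun [set: R] f) (mq : measurable_fun [set: R] q)
  (e0 : 0 <= e) (f0 : forall x, 0 <= f x) (q0 : forall x, 0 <= q x).

Let test_ge0 w : 0 <= (if 0 < X w then f (X w) else 0).
Proof. by case: ifP. Qed.

Let ind_ge0 (s : R) w : 0 <= e * ind s w.
Proof. by rewrite mulr_ge0. Qed.

Let test_ge0E w : [set: T] w -> (0 <= (if 0 < X w then f (X w) else 0)%:E)%E.
Proof. by move=> _; rewrite lee_fin. Qed.

Let ind_ge0E (s : R) w : [set: T] w -> (0 <= (e * ind s w)%:E)%E.
Proof. by move=> _; rewrite lee_fin. Qed.

Let q_ge0E w : [set: T] w -> (0 <= (q (X w))%:E)%E.
Proof. by move=> _; rewrite lee_fin. Qed.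

Lemma expect_test_le_cdf :
  (forall x, x <= z -> f x <= e + q x) -> (forall x, z < x -> f x <= q x) ->
  (expect_test P X f <= e%:E * cdf X z + \int[P]_w (q (X w))%:E)%E.
Proof.
move=> f1 f2; rewrite -int_ind//.
rewrite -(ge0_integralD P measurableT (ind_ge0E z) (m_ind e z) q_ge0E (m_comp mq)).
rewrite /expect_test unlock; apply: ge0_le_integral => //.
- exact: m_test.
- by apply: emeasurable_funD; [exact: m_ind|exact: m_comp].
move=> w _; rewrite -EFinD lee_fin; case: ifP => _; last by rewrite addr_ge0.
rewrite /ind indicE; have [xz|xz] := lerP (X w) z.
  by rewrite mem_set/= ?in_itv/= ?xz// mulr1; exact: f1.
by rewrite memNset/= ?in_itv/= ?mulr0 ?add0r; [exact: f2|apply/negP; rewrite -ltNge].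
Qed.

Lemma cdf_le_expect_test : P (X @^-1` `]-oo, 0]) = 0%E ->
  (forall x, x <= z -> e <= f x + q x) ->
  (e%:E * cdf X z <= expect_test P X f + \int[P]_w (q (X w))%:E)%E.
Proof.
move=> X0 f1.
(* Where [X] is not positive the tested integrand is 0 and the pointwise bound may fail; adding this
   null term restores it. *)
have F0 : (e%:E * cdf X 0 = 0)%E by rewrite /cdf /distribution/= /pushforward X0 mule0.
rewrite -[leRHS]adde0 -F0 -!int_ind//.
rewrite /expect_test unlock.
have mtq := emeasurable_funD (m_test mf) (m_comp mq).
have tq_ge0 w : [set: T] w ->
    (0 <= (if 0 < X w then f (X w) else 0)%:E + (q (X w))%:E)%E.
  by move=> _; rewrite -EFinD lee_fin addr_ge0.
rewrite -(ge0_integralD P measurableT test_ge0E (m_test mf) q_ge0E (m_comp mq)).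
rewrite -(ge0_integralD P measurableT tq_ge0 mtq (ind_ge0E 0) (m_ind e 0)).
apply: ge0_le_integral => //.
- by move=> w _; rewrite lee_fin.
- by apply: emeasurable_funD => //; exact: m_ind.
move=> w _; rewrite -!EFinD lee_fin.
have [xz|xz] := lerP (X w) z; last first.
  rewrite {1}/ind indicE memNset/= ?in_itv/= ?mulr0 ?addr_ge0//.
  by apply/negP; rewrite -ltNge.
rewrite {1}/ind indicE mem_set/= ?in_itv/= ?xz// mulr1.
case: ltP => Xw0; first by rewrite (le_trans (f1 _ xz))// lerDl.
by rewrite /ind indicE mem_set/= ?in_itv/= ?Xw0// mulr1 add0r lerDr.
Qed.

End TestCdf.

Section Bump.
Context {R : realType} {d : measure_display} {T : measurableType d}
  (P : probability T R) (U : {RV P >-> R}) (a b rho : R).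
Hypotheses (b0 : 0 < b) (law : has_gamma_law P U a b)
  (p_le : forall x, gamma_pdf a b x <= rho).
Notation mu := (@lebesgue_measure R).

(** An affine piece, used for the triangle between the ramp and the scaled indicator. *)
Definition bump (c s u v x : R) : R := ((fun x => c + s * x) \_ `[u, v]) x.

Lemma measurable_bump (c s u v : R) : measurable_fun [set: R] (bump c s u v).
Proof.
apply/(measurable_restrictT _ _).1 => //; apply: measurable_funTS.
by apply: measurable_funD => //; exact: measurable_funM.
Qed.

Lemma bump_integral_le (c s u v : R) : u < v ->
  (forall x, 0 <= bump c s u v x) ->
  (\int[P]_w (bump c s u v (U w))%:E <=
    (rho * ((c * v + s * (v ^+ 2 / 2)) - (c * u + s * (u ^+ 2 / 2))))%:E)%E.
Proof.
move=> uv q0; pose F x := c * x + s * (x ^+ 2 / 2).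
have rho0 : 0 <= rho by apply: le_trans (p_le 0); exact: gamma_pdf_ge0.
have mq : measurable_fun [set: measurableTypeR R] (fun x => (bump c s u v x)%:E).
  by apply/measurable_EFinP; exact: measurable_bump.
have dF (x : R) : is_derive x 1 F (c + s * x).
  apply: is_deriv_eq (is_deriv_add (is_deriv_mul (is_deriv_cst c x) (is_deriv_id x))
    (is_deriv_mul (is_deriv_cst s x) (is_deriv_mul (is_deriv_mul (is_deriv_id x) (is_deriv_id x))
    (is_deriv_cst 2^-1 x)))) _.
  by field.
have df (x : R) : is_derive x 1 (fun x => c + s * x) s.
  by apply: is_deriv_eq (is_deriv_add (is_deriv_cst c x) (is_deriv_mul (is_deriv_cst s x) (is_deriv_id x))) _; ring.
have intq : (\int[mu]_x (bump c s u v x)%:E = (F v - F u)%:E)%E.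
  rewrite (_ : (fun x => _) = (fun x => (c + s * x)%:E) \_ `[u, v]); last first.
    by apply/funext => x; rewrite /bump !patchE; case: ifP.
  rewrite -integral_mkcond; apply: continuous_FTC2 => //.
  - by apply: continuous_within => x _; exact: is_deriv_continuous (df x).
  - split; first by move=> x _; exact: is_deriv_derivable (dF x).
      by apply: cvg_at_right_filter; exact: is_deriv_continuous (dF u).
    by apply: cvg_at_left_filter; exact: is_deriv_continuous (dF v).
  - by move=> x _; exact: is_deriv_val (dF x).
rewrite (gamma_law_ge0_integral b0 law (f := fun x => (bump c s u v x)%:E) mq); last first.
  by move=> x; rewrite lee_fin.
rewrite EFinM -[X in (_ <= _ * X)%E]intq -ge0_integralZl_EFin//; last first.
  by move=> x _; rewrite lee_fin.
apply: ge0_le_integral => //.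
- by move=> x _; rewrite mule_ge0 ?lee_fin ?gamma_pdf_ge0.
- by apply: emeasurable_funM => //; apply/measurable_EFinP; exact: measurable_gamma_pdf.
- by apply: emeasurable_funM.
- by move=> x _; rewrite -!EFinM lee_fin mulrC ler_wpM2r.
Qed.

End Bump.

(** * From the Lipschitz distance to the Kolmogorov distance *)

Section Kolmogorov.
Context {R : realType} {d1 d2 : measure_display}
  {T1 : measurableType d1} (P1 : probability T1 R)
  {T2 : measurableType d2} (P2 : probability T2 R)
  (X : {RV P1 >-> R}) (U : {RV P2 >-> R}) (alpha beta rho K : R).
Hypotheses (b0 : 0 < beta) (law : has_gamma_law P2 U alpha beta)
  (p_le : forall x, gamma_pdf alpha beta x <= rho) (rho0 : 0 < rho)
  (X_le0 : P1 (X @^-1` `]-oo, 0]) = 0%E)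
  (d1_le : forall h, Z1 h -> (`|expect_test P1 X h - expect_test P2 U h| <= K%:E)%E).

Let smooth_measurable (z e s : R) : measurable_fun [set: R] (smooth_ramp z e s).
Proof. by apply: continuous_measurable_fun; exact: smooth_ramp_continuous. Qed.

Let int_cst {d} {T : measurableType d} (P : probability T R) (s : R) :
  (\int[P]_w (s%:E) = s%:E)%E.
Proof.
rewrite integral_cst// [X in (_ * X)%E](_ : _ = 1%E) ?mule1//.
exact: probability_setT.
Qed.

Let expect_ramp_fin {d} {T : measurableType d} (P : probability T R) (Y : {RV P >-> R}) (z e s : R) :
  0 < e -> 0 < s -> expect_test P Y (smooth_ramp z e s) \is a fin_num.
Proof.
move=> e0 s0.
have le : (expect_test P Y (smooth_ramp z e s) <= 0%:E * cdf Y z + \int[P]_w (e%:E))%E.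
  have le_e x : smooth_ramp z e s x <= e.
    have /andP[_ h] := smooth_ramp_bounds z x e0 s0.
    by apply: le_trans h _; have /andP[] := ramp_bounds z x e0.
  apply: (expect_test_le_cdf Y (q := fun=> e)) => //.
  - by move=> x; exact: smooth_ramp_ge0.
  - by move=> x; exact: ltW.
  - by move=> x _; rewrite add0r.
rewrite ge0_fin_numE; last first.
  rewrite /expect_test unlock; apply: integral_ge0 => w _; rewrite lee_fin.
  by case: ifP => // _; exact: smooth_ramp_ge0.
by apply: le_lt_trans le _; rewrite mul0e add0e int_cst ltry.
Qed.

Let cdf_fin {d} {T : measurableType d} (P : probability T R) (Y : {RV P >-> R}) (z : R) :
  cdf Y z \is a fin_num.
Proof. exact: fin_num_measure. Qed.

Let expect_le (z e s : R) : 0 < e -> 0 < s ->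
  `|fine (expect_test P1 X (smooth_ramp z e s)) -
    fine (expect_test P2 U (smooth_ramp z e s))| <= K.
Proof.
move=> e0 s0; rewrite -lee_fin -abse_EFin EFinB !fineK ?expect_ramp_fin//.
by apply: d1_le; exact: smooth_ramp_Z1.
Qed.

Let bump_down (z e x : R) : 0 < e -> 0 <= bump (z + e) (-1) z (z + e) x.
Proof.
move=> e0; rewrite /bump patchE; case: ifPn => // /set_mem/=.
by rewrite in_itv/= => /andP[]; lra.
Qed.

Let bump_up (z e x : R) : 0 < e -> 0 <= bump (e - z) 1 (z - e) z x.
Proof.
move=> e0; rewrite /bump patchE; case: ifPn => // /set_mem/=.
by rewrite in_itv/= => /andP[]; lra.
Qed.

(** The ramp starts at [z] here and ends at [z] in [kol_lower]. Either way the triangle between ramp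
    and indicator is integrated against the law of [U], the only one with a known density bound; its
    area is [e ^ 2 / 2]. *)
Let kol_upper (z e s : R) : 0 < e -> 0 < s ->
  e * fine (cdf X z) <= e * fine (cdf U z) + K + rho * (e ^+ 2 / 2) + s.
Proof.
move=> e0 s0; pose h := smooth_ramp z e s.
have h0 x : 0 <= h x := smooth_ramp_ge0 z x e0 s0.
have mh : measurable_fun [set: R] h by exact: smooth_measurable.
have up : (e%:E * cdf X z <= expect_test P1 X h + \int[P1]_w s%:E)%E.
  apply: (cdf_le_expect_test (q := fun=> s)) => //.
  - exact: ltW.
  - by move=> _; exact: ltW.
  move=> x xz; have /andP[h1 _] := smooth_ramp_bounds z x e0 s0.
  have [[_ r]|[/andP[zx _] r]|[zx _]] := ramp_cases z x e0; rewrite -/h in h1; lra.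
rewrite int_cst -(fineK (cdf_fin X z)) -(fineK (expect_ramp_fin X z e0 s0)) in up.
rewrite -EFinM -EFinD lee_fin in up.
have low : (expect_test P2 U h <= e%:E * cdf U z +
    \int[P2]_w (bump (z + e) (-1) z (z + e) (U w))%:E)%E.
  apply: (expect_test_le_cdf U (q := bump (z + e) (-1) z (z + e))) => //.
  - exact: measurable_bump.
  - exact: ltW.
  - by move=> x; exact: bump_down.
  - move=> x xz; have /andP[_ h1] := smooth_ramp_bounds z x e0 s0.
    apply: le_trans h1 _; have /andP[_ h2] := ramp_bounds z x e0.
    by apply: le_trans h2 _; rewrite lerDl bump_down.
  - move=> x xz; have /andP[_ h1] := smooth_ramp_bounds z x e0 s0.
    apply: le_trans h1 _.
    have [[zx _]|[/andP[zx xe] ->]|[zx ->]] := ramp_cases z x e0.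
    + by exfalso; lra.
    + by rewrite /bump patchE mem_set/= ?in_itv/= ?zx ?xe//; lra.
    + exact: bump_down.
have ze : z < z + e by rewrite ltrDl.
have B := bump_integral_le b0 law p_le ze (fun x => bump_down z x e0).
have low2 := le_trans low (leeD2l (e%:E * cdf U z)%E B).
rewrite -(fineK (cdf_fin U z)) -(fineK (expect_ramp_fin U z e0 s0)) in low2.
rewrite -EFinM -EFinD lee_fin in low2.
have := expect_le z e0 s0; rewrite ler_norml => /andP[k1 k2].
have E : (z + e) * (z + e) + -1 * ((z + e) ^+ 2 / 2) - ((z + e) * z + -1 * (z ^+ 2 / 2)) =
  e ^+ 2 / 2 by field.
rewrite E in low2; rewrite -/h in k1 k2; lra.
Qed.

Let kol_lower (z e s : R) : 0 < e -> 0 < s ->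
  e * fine (cdf U z) <= e * fine (cdf X z) + K + rho * (e ^+ 2 / 2) + s.
Proof.
move=> e0 s0; pose h := smooth_ramp (z - e) e s.
have h0 x : 0 <= h x := smooth_ramp_ge0 (z - e) x e0 s0.
have mh : measurable_fun [set: R] h by exact: smooth_measurable.
have low : (expect_test P1 X h <= e%:E * cdf X z + \int[P1]_w 0%:E)%E.
  apply: (expect_test_le_cdf X (q := fun=> 0)) => //.
  - exact: ltW.
  - move=> x xz; have /andP[_ h1] := smooth_ramp_bounds (z - e) x e0 s0.
    by rewrite addr0; apply: le_trans h1 _; have /andP[] := ramp_bounds (z - e) x e0.
  - move=> x xz; have /andP[_ h1] := smooth_ramp_bounds (z - e) x e0 s0.
    apply: le_trans h1 _.
    by have [[zx _]|[/andP[zx xe] ->]|[zx ->]] := ramp_cases (z - e) x e0; lra.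
rewrite int_cst -(fineK (cdf_fin X z)) -(fineK (expect_ramp_fin X (z - e) e0 s0)) in low.
rewrite -EFinM -EFinD lee_fin in low.
have up : (e%:E * cdf U z <= expect_test P2 U h +
    \int[P2]_w (bump (e - z) 1 (z - e) z (U w) + s)%:E)%E.
  apply: (cdf_le_expect_test (q := fun x => bump (e - z) 1 (z - e) z x + s)) => //.
  - by apply: measurable_funD => //; exact: measurable_bump.
  - exact: ltW.
  - by move=> x; rewrite addr_ge0 ?bump_up ?ltW.
  - exact: gamma_law_le0 law.
  move=> x xz; have /andP[h1 _] := smooth_ramp_bounds (z - e) x e0 s0.
  rewrite -/h in h1; have B0 := bump_up z x e0.
  have [[_ r]|[/andP[zx xe] r]|[zx r]] := ramp_cases (z - e) x e0; first by lra.
    by rewrite /bump patchE mem_set/= ?in_itv/= ?zx ?xz//; lra.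
  (* The flat part of the ramp meets the range [x <= z] only at its endpoint, where the bump has
     height [e]. *)
  have xe : x = z by lra.
  have hz := h0 z.
  by rewrite /bump patchE mem_set/= ?in_itv/= xe; [lra|apply/andP; split; lra].
have ze : z - e < z by rewrite ltrBlDr ltrDl.
have B := bump_integral_le b0 law p_le ze (fun x => bump_up z x e0).
have mB : measurable_fun [set: T2] (fun w => (bump (e - z) 1 (z - e) z (U w))%:E).
  apply/measurable_EFinP; apply: measurableT_comp; first exact: measurable_bump.
  exact: measurable_funPT.
have Bs : (\int[P2]_w (bump (e - z) 1 (z - e) z (U w) + s)%:E =
    \int[P2]_w (bump (e - z) 1 (z - e) z (U w))%:E + s%:E)%E.
  rewrite -[in RHS](int_cst P2 s) -ge0_integralD//.
  - by move=> w _; rewrite lee_fin bump_up.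
  - by move=> w _; rewrite lee_fin ltW.
rewrite Bs in up.
have up2 := le_trans up (leeD2l (expect_test P2 U h) (leeD2r s%:E B)).
rewrite -(fineK (cdf_fin U z)) -(fineK (expect_ramp_fin U (z - e) e0 s0)) in up2.
rewrite -EFinM -!EFinD lee_fin in up2.
have := expect_le (z - e) e0 s0; rewrite ler_norml => /andP[k1 k2].
have E : (e - z) * z + 1 * (z ^+ 2 / 2) - ((e - z) * (z - e) + 1 * ((z - e) ^+ 2 / 2)) =
  e ^+ 2 / 2 by field.
rewrite E in up2; rewrite -/h in k1 k2; lra.
Qed.

Let kol_smoothing (z e : R) : 0 < e ->
  e * `|fine (cdf X z) - fine (cdf U z)| <= K + rho * (e ^+ 2 / 2).
Proof.
move=> e0; rewrite -[X in X * _](gtr0_norm e0) -normrM ler_norml.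
apply/andP; split; apply/ler_addgt0Pr => s s0.
  by have := kol_lower z e0 s0; lra.
by have := kol_upper z e0 s0; lra.
Qed.

Lemma cdf_dist_le (z : R) : (`|cdf X z - cdf U z| <= (Num.sqrt (2 * K * rho))%:E)%E.
Proof.
rewrite -(fineK (cdf_fin X z)) -(fineK (cdf_fin U z)) -EFinB abse_EFin lee_fin.
set x := `|_|; have x0 : 0 <= x by exact: normr_ge0.
have [->|xn0] := eqVneq x 0; first exact: sqrtr_ge0.
have xp : 0 < x by rewrite lt_neqAle eq_sym xn0.
(* The width [x / rho] maximises [e x - rho e^2 / 2]; it must be positive, so [x = 0] was treated
   apart. *)
have := kol_smoothing z (divr_gt0 xp rho0); rewrite -/x => k.
rewrite -(ger0_norm x0) -sqrtr_sqr ler_wsqrtr//.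
have k2 := ler_wpM2r (ltW rho0) k.
rewrite (_ : x / rho * x * rho = x ^+ 2) in k2; last by field; rewrite gt_eqF.
rewrite (_ : (K + rho * ((x / rho) ^+ 2 / 2)) * rho = K * rho + x ^+ 2 / 2) in k2; last first.
  by field; rewrite gt_eqF.
lra.
Qed.

End Kolmogorov.

Unset Implicit Arguments.

Theorem theorem2p1 (R : realType)
    (d1 d2 : measure_display)
    (T1 : measurableType d1) (P1 : probability T1 R)
    (T2 : measurableType d2) (P2 : probability T2 R)
    (N : nat) (hN : (1 <= N)%N)
    (alphas betas : 'I_N -> R)
    (halphas : forall i, 0 < alphas i) (hbetas : forall i, 0 < betas i)
    (G : 'I_N -> {RV P1 >-> R})
    (hind : mutually_independent P1 G)
    (hG : forall i, has_gamma_law P1 (G i) (alphas i) (betas i))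
    (GN : {RV P1 >-> R}) (hGN : forall w : T1, GN w = \sum_(i < N) G i w)
    (alpha beta : R) (halpha : 0 < alpha) (hbeta : 0 < beta)
    (hmean : alpha * beta = \sum_(i < N) alphas i * betas i)
    (hvar : alpha * beta ^+ 2 = \sum_(i < N) alphas i * betas i ^+ 2)
    (U : {RV P2 >-> R}) (hU : has_gamma_law P2 U alpha beta) :
  let A := A_max betas beta in
  let B := B_max betas beta in
  let r := expR (1 / (12 * alpha - 11)) in
  [/\ (dist1 P1 GN P2 U <= (2 * A)%:E)%E,
      (dist2 P1 GN P2 U <= (2 * B + alpha * beta * e_const alpha * A)%:E)%E &
      1 < alpha ->
      (dist_Kol P1 GN P2 U <=
        (2 * Num.sqrt (A / (beta * Num.sqrt (2 * pi * (alpha - 1)) * r)))%:E)%E].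
Proof.
move=> A B r; split.
- apply: ge_ereal_sup => _ [h Zh <-].
  exact: (expect_test_Z1 hN halphas hbetas hind hG hGN halpha hbeta hmean hvar hU Zh).
- apply: ge_ereal_sup => _ [h Zh <-].
  exact: (expect_test_Z2 hN halphas hbetas hind hG hGN halpha hbeta hmean hvar hU Zh).
move=> alpha1; apply: ge_ereal_sup => _ [z _ <-].
have GN_le0 : P1 (GN @^-1` `]-oo, 0]) = 0%E.
  apply: (subset_measure0 (B := ~` all_pos G)).
  - by rewrite -[X in measurable X]setTI; exact: measurable_funPT.
  - exact/measurableC/measurable_all_pos.
  - move=> w /=; rewrite in_itv/= => GN0 Gw.
    by have := GN_gt0 hGN hN Gw; rewrite ltNge GN0.
  - exact: all_pos_setC hind hG.
pose rho := (beta * Num.sqrt (2 * pi * (alpha - 1)) * r)^-1.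
have rho0 : 0 < rho.
  by rewrite invr_gt0 !mulr_gt0 ?expR_gt0 ?sqrtr_gt0 ?mulr_gt0 ?pi_gt0 ?subr_gt0.
have dle (h : R -> R) (Zh : Z1 h) :=
  expect_test_Z1 hN halphas hbetas hind hG hGN halpha hbeta hmean hvar hU Zh.
have p_le x := gamma_pdf_le x alpha1 hbeta.
apply: le_trans (cdf_dist_le hbeta hU p_le rho0 GN_le0 dle z) _.
have -> : 2 * (2 * A) * rho = 2 ^+ 2 * (A * rho) by rewrite expr2 !mulrA.
by rewrite lee_fin sqrtrM ?sqr_ge0// sqrtr_sqr ger0_norm.
Qed.
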